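(* Let $A$ be a non-empty compact, convex and symmetric subset of $\mathbb{R}^d$, and suppose $f:\mathbb{R}^d\to\mathbb{C}$. Then the following are equivalent: (a) $f$ is the Fourier transform of a smooth function with support contained in $A$; (b) $f$ extends to a rapidly decreasing entire function on $\mathbb{C}^d$ of exponential type corresponding to $A$.
   Context: Symmetric means $A=-A$. The Fourier transform is $\mathcal{F}g(\lambda)=(2\pi)^{-d/2}\int_{\mathbb{R}^d}g(x)e^{-i\lambda\cdot x}\,dx$. The supporting function $H_A:\mathbb{R}^d\to\mathbb{R}$ of $A$ is $H_A(x)=\max_{a\in A}a\cdot x$. A function $F:\mathbb{C}^d\to\mathbb{C}$ is a rapidly decreasing entire function of exponential type corresponding to $A$ if $F$ is entire and, for each $n\in\mathbb{N}_0=\{0,1,2,\ldots\}$, there exists a positive constant $C_n$ such that $|F(z)|\le C_n(1+|z|)^{-n}e^{H_A(\operatorname{Im}z)}$ for all $z\in\mathbb{C}^d$. *)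

(* Defs.v *)
From HB Require Import structures.
From mathcomp Require Import all_boot all_order all_algebra complex.
From mathcomp Require Import all_classical all_reals all_analysis.
Set Implicit Arguments. Unset Strict Implicit. Unset Printing Implicit Defensive.
Import Order.TTheory GRing.Theory Num.Theory numFieldNormedType.Exports.

Local Open Scope classical_set_scope.
Local Open Scope complex_scope.
Local Open Scope ring_scope.

(* The n-th power of a sigma-finite measure, on n-tuples with the product
   sigma-algebra: the unit mass at the empty tuple for n = 0, and the image of
   the product measure under (x, t) |-> x :: t for n.+1. *)
Section power_measure.
Context (disp : measure_display) (T : measurableType disp) (R : realType).
Variable m : {sigma_finite_measure set T -> \bar R}.

Definition tuple_cons n (p : T * n.-tuple T) : n.+1.-tuple T :=
  [tuple of p.1 :: p.2].

Lemma measurable_tuple_cons n : measurable_fun setT (@tuple_cons n).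
Proof. exact: measurable_cons. Qed.

Section step.
Context (n : nat) (mu : {sigma_finite_measure set (n.-tuple T) -> \bar R}).

Definition power_measureS : set (n.+1.-tuple T) -> \bar R :=
  pushforward (m \x mu)%E (@tuple_cons n).

Let push : {measure set (n.+1.-tuple T) -> \bar R} :=
  measure_function_pushforward__canonical__measure_function_Measure
    (m \x mu)%E (@measurable_tuple_cons n).

HB.instance Definition _ := isMeasure.Build _ _ _ power_measureS
  (measure0 push) (measure_ge0 push) (@measure_semi_sigma_additive _ _ _ push).

Lemma power_measureS_sigma_finite : sigma_finite setT power_measureS.
Proof.
have /sigma_finiteP[F [TF ndF Foo]] := sigma_finiteT m.
have /sigma_finiteP[G [TG ndG Goo]] := sigma_finiteT mu.
pose uncons (t : n.+1.-tuple T) : T * n.-tuple T :=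
  (thead t, [tuple of behead t]).
have munc : measurable_fun setT uncons.
  apply/measurable_fun_pairP; split; first exact: measurable_tnth.
  exact: measurable_behead.
have consK p : uncons (tuple_cons p) = p.
  by case: p => x t; congr pair; exact/val_inj.
exists (fun k => uncons @^-1` (F k `*` G k)).
  rewrite -preimage_bigcup -(preimage_setT uncons); congr (_ @^-1` _).
  apply/esym; rewrite -subTset => -[x y] _.
  have : setT x by []. rewrite TF => -[k _ Fx].
  have : setT y by []. rewrite TG => -[l _ Gy].
  exists (maxn k l) => //; split => /=.
  - by move: x Fx; exact/subsetPset/ndF/leq_maxl.
  - by move: y Gy; exact/subsetPset/ndG/leq_maxr.
move=> k; have [mF Fk] := Foo k; have [mG Gk] := Goo k; split.
  by rewrite -[X in measurable X]setTI; apply: munc => //; exact: measurableX.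
rewrite /power_measureS /pushforward/= -comp_preimage.
rewrite (_ : uncons \o _ = id); last exact/funext.
by rewrite preimage_id product_measure1E// lte_mul_pinfty// ge0_fin_numE.
Qed.

HB.instance Definition _ := Measure_isSigmaFinite.Build _ _ _
  power_measureS power_measureS_sigma_finite.

End step.

Fixpoint power_measure n : {sigma_finite_measure set (n.-tuple T) -> \bar R} :=
  if n is k.+1 then power_measureS (power_measure k)
  else \d_ ([tuple] : 0.-tuple T).

End power_measure.

Definition lebesgue_tuple (R : realType) (n : nat) :
    {sigma_finite_measure set (n.-tuple (measurableTypeR R)) -> \bar R} :=
  power_measure (@lebesgue_measure R) n.

Section fourier.
Context (R : realType).

Definition cexp (z : R[i]) : R[i] :=
  (expR (complex.Re z))%:C * (cos (complex.Im z) +i* sin (complex.Im z)).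

Context (d : nat).

Definition dot (x y : 'rV[R]_d) : R := \sum_i x 0 i * y 0 i.

Definition integralC (h : 'rV[R]_d -> R[i]) : R[i] :=
  (\int[lebesgue_tuple R d]_x complex.Re (h (\row_i tnth x i))) +i*
  (\int[lebesgue_tuple R d]_x complex.Im (h (\row_i tnth x i))).

Definition fourier (g : 'rV[R]_d -> R[i]) (lambda : 'rV[R]_d) : R[i] :=
  ((2 * pi) `^ (- (d%:R / 2)))%:C *
  integralC (fun x => g x * cexp (- 'i%C * (dot lambda x)%:C)).

(* [partials [:: i; j; ...] h] is d/dx_i (d/dx_j (... h)). *)
Definition partials (s : seq 'I_d) (h : 'rV[R]_d -> R) : 'rV[R]_d -> R :=
  foldr (fun i k => 'D_(delta_mx 0 i) k) h s.

Definition smooth (h : 'rV[R]_d -> R) : Prop := forall s : seq 'I_d,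
  continuous (partials s h) /\
  forall x i, derivable (partials s h) x (delta_mx 0 i).

Definition smoothC (g : 'rV[R]_d -> R[i]) : Prop :=
  smooth (fun x => complex.Re (g x)) /\ smooth (fun x => complex.Im (g x)).

Definition supp (g : 'rV[R]_d -> R[i]) : set 'rV[R]_d :=
  closure [set x | g x != 0].

Definition supporting (A : set 'rV[R]_d) (x : 'rV[R]_d) : R :=
  sup [set dot a x | a in A].

Lemma continuous_dot (x : 'rV[R]_d) : continuous (dot^~ x).
Proof.
move=> a; apply: cvg_big => [||i _]; [exact: add_continuous|exact: nbhs_filter|].
apply: cvgMr_tmp; first exact: nbhs_filter.
exact: coord_continuous.
Qed.

(* The supremum is a maximum. *)
Lemma supporting_max (A : set 'rV[R]_d) (x : 'rV[R]_d) :
  A !=set0 -> compact A ->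
  (exists2 a, A a & supporting A x = dot a x) /\
  (forall a, A a -> dot a x <= supporting A x).
Proof.
move=> A0 cA.
have [|c /set_mem Ac cmax] := @compact_EVT_max _ _ (dot^~ x) _ A0 cA.
  by apply: continuous_subspaceT => a; exact: continuous_dot.
suff -> : supporting A x = dot c x.
  by split; [exists c|move=> a /mem_set; exact: cmax].
apply/eqP; rewrite eq_le; apply/andP; split.
  apply: ge_sup; first by exists (dot c x), c.
  by move=> _ [a /mem_set Aa <-]; exact: cmax.
apply: ub_le_sup; last by exists c.
by exists (dot c x) => _ [a /mem_set Aa <-]; exact: cmax.
Qed.

(* Euclidean norm; the library's norm on row vectors is the max norm. *)
Definition normCd (z : 'rV[R[i]]_d) : R :=
  Num.sqrt (\sum_i ComplexField.Normc.normc (z 0 i) ^+ 2).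

(* [R[i]^o] is the complex line as a normed space over the field R[i], so
   differentiability here is complex differentiability. *)
Definition entire (F : 'rV[R[i]]_d -> R[i]) : Prop :=
  forall z, differentiable (F : 'rV[R[i]]_d -> R[i]^o) z.

Definition rapidly_decreasing_entire (A : set 'rV[R]_d)
    (F : 'rV[R[i]]_d -> R[i]) : Prop :=
  entire F /\
  forall n : nat, exists2 C : R, 0 < C & forall z,
    ComplexField.Normc.normc (F z) <=
    C * (1 + normCd z) ^- n * expR (supporting A (map_mx (@complex.Im R) z)).

End fourier.

(* Main.v *)
(* From (b) to (a).  Let g be the inverse transform of the restriction of F to
   R^d; it is smooth because F decreases rapidly there.  Shifting the domain of
   integration from R^d to R^d + i y, one variable at a time by Cauchy's theorem,
   bounds |g x| by a constant times exp (H_A(y) - x.y).  If x is not in A, some y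
   has H_A(y) < x.y, and replacing y by t y with t -> oo gives g x = 0.  To see
   that F is the transform of g, damp g by exp (- e (|x_1| + ... + |x_d|)): by
   Fubini's theorem the transform of the damped function is the average of F
   against a product of Poisson kernels, which tends to F as e -> 0, while the
   damping changes little since g has bounded support.

   From (a) to (b).  Differentiate under the integral sign to see that the
   transform is entire.  On A the kernel exp (- i z.x) is at most
   exp (H_A(Im z)) in modulus, and N integrations by parts in the variable x_j
   multiply the transform by (i z_j)^N, which gives the decay. *)

Require Import Defs.
From HB Require Import structures.
From mathcomp Require Import all_boot all_order all_algebra complex.
From mathcomp Require Import all_classical all_reals all_analysis.
From mathcomp Require Import measurable_realfun ring lra.
Import Order.TTheory GRing.Theory Num.Theory numFieldNormedType.Exports.
Set Implicit Arguments. Unset Strict Implicit. Unset Printing Implicit Defensive.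
Local Open Scope classical_set_scope.
Local Open Scope complex_scope.
Local Open Scope ring_scope.

Local Notation normc := ComplexField.Normc.normc.
Local Notation Re := complex.Re.
Local Notation Im := complex.Im.

(** * Integration over row vectors *)

Section rows.
Context {R : realType}.

(** Coordinates are treated one at a time, so Fubini's theorem is needed with every slice integrable
    and not only almost every one. The integrands that are sliced are therefore continuous and
    bounded by a multiple of [1 / wt], the inverse of the product of the [1 + x_i^2]: this bound
    passes to each slice and is integrable on the line and on the whole space. Complex integrals are
    handled through real and imaginary parts; a modulus estimate then loses a factor 2, which is
    harmless because constants are never optimised. The damping uses the sum of the [|x_i|] because
    it splits into one-variable factors with elementary antiderivatives, and the resulting kernels
    have mass 1 by the arctangent integral. Their tails are heavy, but of size [e] away from the
    centre, which is enough. Inversion is proved only for a function whose inverse transform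
    vanishes off a box; the contour shift has established this beforehand, and on the box the
    damping changes the integrand by at most a multiple of [e]. *)

Definition row_of n (t : n.-tuple (measurableTypeR R)) : 'rV[R]_n :=
  \row_i tnth t i.

Arguments row_of {n} t.

(** Row-vector counterpart of [tuple_cons]; inductions on the dimension split off coordinate [ord0]
    through it. *)
Definition vcons (T : Type) n (x : T) (v : 'rV[T]_n) : 'rV[T]_n.+1 :=
  \row_i oapp (v 0) x (unlift ord0 i).

Lemma vcons0 (T : Type) n x (v : 'rV[T]_n) : vcons x v 0 ord0 = x.
Proof. by rewrite mxE unlift_none. Qed.

Lemma vconsS (T : Type) n x (v : 'rV[T]_n) i : vcons x v 0 (lift ord0 i) = v 0 i.
Proof. by rewrite mxE liftK. Qed.

Lemma vcons_eta (T : Type) n (v : 'rV[T]_n.+1) :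
  v = vcons (v 0 ord0) (\row_i v 0 (lift ord0 i)).
Proof.
apply/rowP => i; case: (unliftP ord0 i) => [j|] ->; rewrite ?vconsS ?vcons0//.
by rewrite mxE.
Qed.

Lemma row_of_cons n x (t : n.-tuple (measurableTypeR R)) :
  row_of (tuple_cons (x, t)) = vcons x (row_of t).
Proof.
apply/rowP => i; rewrite !mxE.
by case: unliftP => [j|] ->; rewrite /= ?mxE ?tnthS ?tnth0.
Qed.

(** Stated over a [numFieldType] because it serves both real rows and, when the two notions of
    complex differentiability are compared, complex ones. *)
Lemma nbhs_rV (K : numFieldType) n (v : 'rV[K]_n) (P : 'rV[K]_n -> Prop) :
  nbhs v P <-> exists2 e : K, 0 < e &
    forall u : 'rV[K]_n, (forall i, `|u 0 i - v 0 i| < e) -> P u.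
Proof.
split.
- move=> /nbhs_ballP[e /= e0 eP]; exists e => // u ue; apply: eP.
  split => // i j; rewrite (ord1 i) -ball_normE/= distrC; exact: ue.
- move=> [e e0 eP]; apply/nbhs_ballP; exists e => // u [_ ue]; apply: eP => i.
  by have := ue 0 i; rewrite -ball_normE/= distrC.
Qed.

Lemma continuous_rV n (h : 'rV[R]_n -> R) :
  continuous h <-> forall (v : 'rV[R]_n) (e : R), 0 < e -> exists2 r : R, 0 < r &
    forall u : 'rV[R]_n, (forall i, `|u 0 i - v 0 i| < r) -> `|h u - h v| < e.
Proof.
split.
- move=> ch v e e0.
  have /nbhs_rV[r r0 rP] : nbhs v [set u | `|h u - h v| < e].
    have /cvgrPdist_lt/(_ e e0) := ch v.
    by apply: filterS => u; rewrite distrC.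
  by exists r.
- move=> H v; apply/(@cvgrPdist_lt _ _ _ _ (nbhs_filter v)) => e e0.
  apply/nbhs_rV.
  have [r r0 rP] := H v e e0; exists r => // u ur.
  by rewrite distrC; exact: rP.
Qed.

Lemma rV_continuousD n (h k : 'rV[R]_n -> R) : continuous h -> continuous k ->
  continuous (fun v => h v + k v).
Proof.
move=> ch ck v; apply: (cvgD (f := h) (g := k)); first exact: nbhs_filter.
  exact: ch.
exact: ck.
Qed.

Lemma rV_continuousM n (h k : 'rV[R]_n -> R) : continuous h -> continuous k ->
  continuous (fun v => h v * k v).
Proof.
move=> ch ck v; apply: (cvgM (f := h) (g := k)); first exact: nbhs_filter.
  exact: ch.
exact: ck.
Qed.

Lemma rV_continuousN n (h : 'rV[R]_n -> R) : continuous h ->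
  continuous (fun v => - h v).
Proof.
move=> ch v; apply: (cvgN (f := h)); first exact: nbhs_filter.
exact: ch.
Qed.

(* A continuous function is the pointwise limit of its values at grid points,
   and these depend only on countably many integer vectors. *)
Lemma measurable_continuous_rV d (T : measurableType d) n
    (h : 'rV[R]_n -> R) (X : T -> 'rV[R]_n) :
  continuous h -> (forall i, measurable_fun setT (fun t => X t 0 i)) ->
  measurable_fun setT (h \o X).
Proof.
move=> ch mX.
pose q m t : 'rV[int]_n := \row_i Num.floor (m.+1%:R * X t 0 i).
pose g m (z : 'rV[int]_n) : 'rV[R]_n := \row_i ((z 0 i)%:~R / m.+1%:R).
apply: (measurable_fun_cvg (h := fun m t => h (g m (q m t)))) => //.
- move=> m _ Y mY; rewrite setTI.
  rewrite (_ : _ @^-1` Y = \bigcup_z (q m @^-1` [set z] `&` [set t | Y (h (g m z))])); last first.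
    apply/seteqP; split => [t /= Yt|t /= [z _ /= [<-]//]]; by exists (q m t).
  apply: countable_bigcupT_measurable => [|z].
    exact: countableP.
  apply: measurableI; last first.
    have [Yz|nYz] := pselect (Y (h (g m z))).
      by rewrite (_ : [set _ | _] = setT)//; apply/seteqP; split.
    by rewrite (_ : [set _ | _] = set0)//; apply/seteqP; split.
  rewrite (_ : _ @^-1` _ = \bigcap_(i in [set: 'I_n])
     [set t | Num.floor (m.+1%:R * X t 0 i) = z 0 i]); last first.
    apply/seteqP; split => [t /= <- i _ /=|t /= H]; first by rewrite mxE.
    by apply/rowP => i; rewrite mxE; exact: H.
  apply: fin_bigcap_measurable => // i _.
  rewrite (_ : [set _ | _] = (fun t => X t 0 i) @^-1` `[(z 0 i)%:~R / m.+1%:R, (z 0 i + 1)%:~R / m.+1%:R[%classic); last first.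
    apply/seteqP; split => t /=; rewrite in_itv/= ler_pdivrMr// ltr_pdivlMr// mulrC.
      by move=> <-; rewrite ge_floor /= floorD1_gt.
    by move=> H; apply: floor_def.
  by rewrite -[X in measurable X]setTI; exact: mX.
- move=> t _ /=; apply/cvgrPdist_lt => e e0.
  have /continuous_rV/(_ (X t) e e0)[r r0 rP] := ch.
  near=> m; rewrite distrC; apply: rP => i; rewrite !mxE.
  have m0 : 0 < m.+1%:R :> R by [].
  rewrite -[X in _ - X](mulfK (lt0r_neq0 m0)) -mulrBl normrM.
  rewrite [X t 0 i * _]mulrC.
  rewrite [X in _ * X]gtr0_norm ?invr_gt0// ltr_pdivrMr//.
  have := ge_floor (m.+1%:R * X t 0 i); have := floorD1_gt (m.+1%:R * X t 0 i).
  rewrite intrD => h1 h2.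
  rewrite ler0_norm ?subr_le0//.
  apply: (@lt_trans _ _ 1); first by move: h1; lra.
  rewrite mulrC -ltr_pdivrMr//.
  near: m.
  exists (Num.trunc (1/r)).+1 => // m /= hm.
  apply: (lt_le_trans (truncnS_gt _)). by rewrite ler_nat ltnW.
Unshelve. all: by end_near. Qed.

End rows.
Arguments row_of {R n} t.

(** * Tonelli and Fubini for the power measure, and integrals of products *)

Section tuple_integral.
Context {R : realType}.
Notation mu := (@lebesgue_measure R).
Notation LT n := (lebesgue_tuple R n).

Lemma ge0_integral_tupleS n (f : n.+1.-tuple (measurableTypeR R) -> \bar R) :
  measurable_fun setT f -> (forall t, (0 <= f t)%E) ->
  (\int[LT n.+1]_t f t = \int[mu]_x \int[LT n]_t f (tuple_cons (x, t)))%E.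
Proof.
move=> mf f0.
have mc := @measurable_tuple_cons _ (measurableTypeR R) n.
(* By definition the measure on [n.+1]-tuples is this pushforward. *)
rewrite (_ : (\int[_]_t f t = \int[pushforward (mu \x LT n)%E (@tuple_cons _ _ n)]_t f t)%E)//.
rewrite ge0_integral_pushforward// preimage_setT.
by rewrite fubini_tonelli1//; [apply: measurableT_comp|move=> x; exact: f0].
Qed.

Section fubini.
Context n (f : n.+1.-tuple (measurableTypeR R) -> R).
Hypothesis mf : measurable_fun setT f.
Hypothesis intf : (LT n.+1).-integrable setT (EFin \o f).

Let intf' : (mu \x LT n)%E.-integrable setT (EFin \o (f \o @tuple_cons _ _ n)).
Proof.
have mc := @measurable_tuple_cons _ (measurableTypeR R) n.
apply/integrableP; split.
  by apply/measurable_EFinP; exact: measurableT_comp.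
have /integrableP[_] := intf.
rewrite ge0_integral_tupleS// ; last first.
  by apply: measurableT_comp => //; exact/measurable_EFinP.
rewrite fubini_tonelli1//=.
apply/measurable_EFinP; apply: (measurableT_comp (f := @Num.norm R R)) => //.
exact: measurableT_comp.
Qed.

Let pushE : (\int[LT n.+1]_t (f t)%:E = \int[mu \x LT n]_z (f (tuple_cons z))%:E)%E.
Proof.
have mc := @measurable_tuple_cons _ (measurableTypeR R) n.
rewrite (_ : (\int[_]_t _ = \int[pushforward (mu \x LT n)%E (@tuple_cons _ _ n)]_t (f t)%:E)%E)//.
rewrite integral_pushforward// ?preimage_setT//.
exact/measurable_EFinP.
Qed.

(** All slices are assumed integrable, so the inner extended-real integral is finite everywhere and
    [fine] can be moved inside the outer integral. *)
Lemma Rintegral_tupleS1 :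
  (forall x, (LT n).-integrable setT (EFin \o (fun t => f (tuple_cons (x, t))))) ->
  \int[LT n.+1]_t f t = \int[mu]_x \int[LT n]_t f (tuple_cons (x, t)).
Proof.
move=> isl; rewrite /Rintegral pushE -integral12_prod_meas1//; congr fine.
apply: eq_integral => x _; rewrite /fubini_F /= fineK//.
exact: (integrable_fin_num _ (isl x)).
Qed.

Lemma Rintegral_tupleS2 :
  (forall t, mu.-integrable setT (EFin \o (fun x => f (tuple_cons (x, t))))) ->
  \int[LT n.+1]_t f t = \int[LT n]_t \int[mu]_x f (tuple_cons (x, t)).
Proof.
move=> isl; rewrite /Rintegral pushE -integral21_prod_meas1//; congr fine.
apply: eq_integral => t _; rewrite /fubini_G /= fineK//.
exact: (integrable_fin_num _ (isl t)).
Qed.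

End fubini.

(** Stated with extended-real integrals, so that integrability of the product can be deduced from
    it. *)
Lemma ge0_integral_tuple_prod n (k : 'I_n -> R -> R) (c : 'I_n -> R) :
  (forall i, measurable_fun setT (k i)) -> (forall i x, 0 <= k i x) ->
  (forall i, (\int[mu]_x (k i x)%:E = (c i)%:E)%E) ->
  (\int[LT n]_t (\prod_i k i (tnth t i))%:E = (\prod_i c i)%:E)%E.
Proof.
elim: n k c => [|n IHn] k c mk k0 kc.
  rewrite big_ord0; under eq_integral do rewrite big_ord0.
  by rewrite integral_cst//= mul1e diracT.
have mp m (l : 'I_m -> R -> R) : (forall i, measurable_fun setT (l i)) ->
    measurable_fun setT (fun t : m.-tuple (measurableTypeR R) => \prod_i l i (tnth t i)).
  move=> ml; apply: measurable_prod => i _.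
  exact: (measurableT_comp (ml i) (@measurable_tnth _ (measurableTypeR R) m i)).
have c0 i : 0 <= c i by rewrite -lee_fin -kc; apply: integral_ge0 => x _; rewrite lee_fin.
rewrite ge0_integral_tupleS//; last 2 first.
- by apply/measurable_EFinP; exact: mp.
- by move=> t; rewrite lee_fin prodr_ge0.
pose C := \prod_(i < n) c (lift ord0 i).
transitivity (\int[mu]_x (C%:E * (k ord0 x)%:E))%E.
  apply: eq_integral => x _.
  transitivity (\int[LT n]_t ((k ord0 x)%:E * (\prod_(i < n) k (lift ord0 i) (tnth t i))%:E))%E.
    apply: eq_integral => t _; rewrite big_ord_recl tnth0 EFinM.
    by under eq_bigr do rewrite tnthS.
  rewrite ge0_integralZl//; last 3 first.
  - by apply/measurable_EFinP; exact: (mp n (fun i => k (lift ord0 i))).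
  - by move=> t _; rewrite lee_fin prodr_ge0.
  - by rewrite lee_fin.
  by rewrite (IHn (fun i => k (lift ord0 i)) (fun i => c (lift ord0 i)))// muleC.
rewrite ge0_integralZl//; last 3 first.
- by apply/measurable_EFinP; exact: (mk ord0).
- by move=> t _; rewrite lee_fin.
- by rewrite lee_fin prodr_ge0.
by rewrite (kc ord0) big_ord_recl -EFinM mulrC.
Qed.

Lemma integrable_tuple_prod n (k : 'I_n -> R -> R) :
  (forall i, measurable_fun setT (k i)) -> (forall i x, 0 <= k i x) ->
  (forall i, mu.-integrable setT (EFin \o k i)) ->
  (LT n).-integrable setT (EFin \o (fun t => \prod_i k i (tnth t i))).
Proof.
move=> mk k0 ik; apply/integrableP; split.
  apply/measurable_EFinP; apply: measurable_prod => i _.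
  exact: (measurableT_comp (mk i) (@measurable_tnth _ (measurableTypeR R) n i)).
under eq_integral do rewrite /= ger0_norm ?prodr_ge0//.
rewrite (@ge0_integral_tuple_prod n k (fun i => \int[mu]_x k i x))// ?ltry// => i.
by rewrite /Rintegral fineK//; exact: (integrable_fin_num _ (ik i)).
Qed.

Lemma Rintegral_tuple_prod n (k : 'I_n -> R -> R) :
  (forall i, measurable_fun setT (k i)) -> (forall i x, 0 <= k i x) ->
  (forall i, mu.-integrable setT (EFin \o k i)) ->
  \int[LT n]_t (\prod_i k i (tnth t i)) = \prod_i \int[mu]_x k i x.
Proof.
move=> mk k0 ik; rewrite /Rintegral.
rewrite (@ge0_integral_tuple_prod n k (fun i => \int[mu]_x k i x))// => i.
by rewrite /Rintegral fineK//; exact: (integrable_fin_num _ (ik i)).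
Qed.

End tuple_integral.

(** * Modulus, real part and imaginary part *)

Section complex_norm.
Context {R : realType}.
Implicit Types (z w : R[i]) (x : R).

Lemma normc_ge0 z : 0 <= normc z.
Proof. by case: z => a b; exact: sqrtr_ge0. Qed.

Lemma normcR x : normc x%:C = `|x|.
Proof. by rewrite /= expr0n/= addr0 sqrtr_sqr. Qed.

Lemma normc_sqr z : normc z ^+ 2 = Re z ^+ 2 + Im z ^+ 2.
Proof. by case: z => a b; rewrite /= sqr_sqrtr// addr_ge0 ?sqr_ge0. Qed.

Lemma normRe_le z : `|Re z| <= normc z.
Proof. by rewrite -(@ler_pXn2r _ 2) ?nnegrE ?normc_ge0// normc_sqr real_normK ?num_real// lerDl sqr_ge0. Qed.

Lemma normIm_le z : `|Im z| <= normc z.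
Proof. by rewrite -(@ler_pXn2r _ 2) ?nnegrE ?normc_ge0// normc_sqr real_normK ?num_real// lerDr sqr_ge0. Qed.

Lemma normc_le_ReIm z : normc z <= `|Re z| + `|Im z|.
Proof.
rewrite -(@ler_pXn2r _ 2) ?nnegrE ?normc_ge0 ?addr_ge0// normc_sqr sqrrD.
by rewrite !real_normK ?num_real// [leRHS]addrAC lerDl mulrn_wge0// mulr_ge0.
Qed.

Lemma le_normcB z w : normc (z - w) <= normc z + normc w.
Proof. by rewrite (le_trans (le_normcD _ _))// normcN. Qed.

Lemma cReD z w : Re (z + w) = Re z + Re w. Proof. by case: z w => ? ? []. Qed.
Lemma cImD z w : Im (z + w) = Im z + Im w. Proof. by case: z w => ? ? []. Qed.
Lemma cReN z : Re (- z) = - Re z. Proof. by case: z. Qed.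
Lemma cImN z : Im (- z) = - Im z. Proof. by case: z. Qed.
Lemma cReM z w : Re (z * w) = Re z * Re w - Im z * Im w.
Proof. by case: z w => ? ? []. Qed.
Lemma cImM z w : Im (z * w) = Re z * Im w + Im z * Re w.
Proof. by case: z w => ? ? []. Qed.

Lemma complex_ext z w : Re z = Re w -> Im z = Im w -> z = w.
Proof. by case: z w => ? ? [] ? ? /= -> ->. Qed.

End complex_norm.

(** * The dominating weight and real integrals over row vectors *)

Section integrals.
Context {R : realType}.
Notation mu := (@lebesgue_measure R).
Notation LT n := (lebesgue_tuple R n).

Lemma integral_oneDsqrV : (\int[mu]_x ((1 + x ^+ 2)^-1)%:E = pi%:E)%E.
Proof.
rewrite (@ge0_symfun_integralT R (fun x => (oneDsqr x)^-1)).
- rewrite (_ : [set x | _] = `[0, +oo[%classic); last first.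
    by apply/seteqP; split => x /=; rewrite in_itv/= andbT.
  by rewrite integral0y_oneDsqr -EFinM mulrC divfK.
- by move=> x; rewrite invr_ge0.
- exact: continuous_oneDsqrV.
- by move=> x /=; rewrite /oneDsqr sqrrN.
Qed.

Lemma measurable_oneDsqrV : measurable_fun setT (fun x : R => (1 + x ^+ 2)^-1).
Proof. by apply: continuous_measurable_fun; exact: continuous_oneDsqrV. Qed.

Lemma integrable_oneDsqrV :
  mu.-integrable setT (EFin \o (fun x : R => (1 + x ^+ 2)^-1)).
Proof.
apply/integrableP; split.
  by apply/measurable_EFinP; exact: measurable_oneDsqrV.
under eq_integral => x _.
  rewrite /= ger0_norm; last by rewrite invr_ge0 addr_ge0// sqr_ge0.
  over.
by rewrite integral_oneDsqrV ltry.
Qed.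

(* The reciprocal is an integrable product; it serves as the dominating function
   throughout. *)
Definition wt n (v : 'rV[R]_n) : R := \prod_i (1 + v 0 i ^+ 2).

Lemma wt_gt0 n (v : 'rV[R]_n) : 0 < wt v.
Proof. by apply: prodr_gt0 => i _; rewrite ltr_pwDl// sqr_ge0. Qed.

Lemma wt_ge1 n (v : 'rV[R]_n) : 1 <= wt v.
Proof.
rewrite /wt; elim/big_ind: _ => // [x y x1 y1|i _]; last by rewrite lerDl sqr_ge0.
by rewrite -[1]mulr1 ler_pM.
Qed.

Lemma wt_cons n x (v : 'rV[R]_n) : wt (vcons x v) = (1 + x ^+ 2) * wt v.
Proof.
rewrite /wt big_ord_recl vcons0; congr (_ * _).
by apply: eq_bigr => i _; rewrite vconsS.
Qed.

Definition rint n (h : 'rV[R]_n -> R) : R := \int[LT n]_t h (row_of t).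

Definition rintegrable n (h : 'rV[R]_n -> R) : Prop :=
  (LT n).-integrable setT (EFin \o (h \o row_of)).

Lemma rintegrable_wtV n : rintegrable (fun v : 'rV[R]_n => (wt v)^-1).
Proof.
have := @integrable_tuple_prod R n (fun _ x => (1 + x ^+ 2)^-1)
  (fun=> measurable_oneDsqrV) _ (fun=> integrable_oneDsqrV).
rewrite /rintegrable (_ : (fun t => _) = (fun v : 'rV[R]_n => (wt v)^-1) \o row_of).
  by apply => _ x; rewrite invr_ge0 addr_ge0// sqr_ge0.
apply/funext => t /=; rewrite /wt prodfV; congr _^-1.
by apply: eq_bigr => i _; rewrite mxE.
Qed.

Lemma measurable_row_of n i : measurable_fun setT (fun t => @row_of R n t 0 i).
Proof.
rewrite (_ : (fun t => _) = (fun t => tnth t i)); first exact: measurable_tnth.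
by apply/funext => t; rewrite mxE.
Qed.

Lemma measurable_rV n (h : 'rV[R]_n -> R) : continuous h ->
  measurable_fun setT (h \o row_of).
Proof.
by move=> ch; apply: measurable_continuous_rV => // i; exact: measurable_row_of.
Qed.

Lemma rintegrable_le n (h k : 'rV[R]_n -> R) :
  measurable_fun setT (h \o row_of) ->
  (forall v, `|h v| <= k v) -> rintegrable k -> rintegrable h.
Proof.
move=> mh hk ik; apply: (le_integrable _ _ _ ik) => //; first exact/measurable_EFinP.
by move=> t _ /=; rewrite lee_fin (le_trans (hk _))// ler_norm.
Qed.

Lemma rintegrableZ n c (h : 'rV[R]_n -> R) : rintegrable h ->
  rintegrable (fun v => c * h v).
Proof. by move=> ih; exact: (integrableZl measurableT c ih). Qed.

Lemma rintegrableD n (h k : 'rV[R]_n -> R) : rintegrable h -> rintegrable k ->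
  rintegrable (fun v => h v + k v).
Proof. by move=> ih ik; exact: (integrableD measurableT ih ik). Qed.

Lemma rintZ n c (h : 'rV[R]_n -> R) : rintegrable h ->
  rint (fun v => c * h v) = c * rint h.
Proof. by move=> ih; rewrite /rint RintegralZl. Qed.

Lemma rintD n (h k : 'rV[R]_n -> R) : rintegrable h -> rintegrable k ->
  rint (fun v => h v + k v) = rint h + rint k.
Proof. by move=> ih ik; rewrite /rint RintegralD. Qed.

Lemma rint_le n (h k : 'rV[R]_n -> R) : rintegrable h -> rintegrable k ->
  (forall v, h v <= k v) -> rint h <= rint k.
Proof. by move=> ih ik hk; apply: le_Rintegral. Qed.

Lemma rint_abs_le n (h k : 'rV[R]_n -> R) : rintegrable h -> rintegrable k ->
  (forall v, `|h v| <= k v) -> `|rint h| <= rint k.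
Proof.
move=> ih ik hk; rewrite ler_norml; apply/andP; split.
  rewrite lerNl -mulN1r -rintZ//; apply: rint_le => //; first exact: rintegrableZ.
  by move=> v; rewrite mulN1r (le_trans _ (hk v))// -normrN ler_norm.
by apply: rint_le => // v; rewrite (le_trans _ (hk v))// ler_norm.
Qed.

Lemma eq_rint n (h k : 'rV[R]_n -> R) : h =1 k -> rint h = rint k.
Proof. by move=> /funext ->. Qed.

(** Unlike bare integrability, continuity with this bound is inherited by every slice; it is the
    hypothesis under which Fubini's theorem is applied coordinate by coordinate. *)
Definition dom n (h : 'rV[R]_n -> R) : Prop :=
  continuous h /\ exists C, forall v, `|h v| <= C / wt v.

Lemma dom_rintegrable n (h : 'rV[R]_n -> R) : dom h -> rintegrable h.
Proof.
move=> [ch [C hC]]; apply: (rintegrable_le _ hC); first exact: measurable_rV.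
exact/rintegrableZ/rintegrable_wtV.
Qed.

Lemma continuous_vcons_r n (h : 'rV[R]_n.+1 -> R) x : continuous h ->
  continuous (fun v => h (vcons x v)).
Proof.
move=> /continuous_rV ch; apply/continuous_rV => v e e0.
have [r r0 rP] := ch (vcons x v) e e0; exists r => // u ur; apply: rP => i.
by case: (unliftP ord0 i) => [j|] ->; rewrite ?vconsS ?vcons0 ?subrr ?normr0.
Qed.

Lemma continuous_vcons_l n (h : 'rV[R]_n.+1 -> R) (v : 'rV[R]_n) : continuous h ->
  continuous (fun x => h (vcons x v)).
Proof.
move=> /continuous_rV ch x; apply/cvgrPdist_lt => e e0.
have [r r0 rP] := ch (vcons x v) e e0.
exists r => // y /= yr.
rewrite distrC; apply: rP => i.
by case: (unliftP ord0 i) => [j|] ->; rewrite ?vconsS ?vcons0 ?subrr ?normr0// distrC.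
Qed.

Lemma dom_vcons_r n (h : 'rV[R]_n.+1 -> R) x : dom h -> dom (fun v => h (vcons x v)).
Proof.
move=> [ch [C hC]]; split; first exact: continuous_vcons_r.
exists (C / (1 + x ^+ 2)) => v; have := hC (vcons x v).
by rewrite wt_cons invfM mulrA.
Qed.

Lemma integrable_dominated_oneDsqrV (h : R -> R) C : continuous h ->
  (forall x, `|h x| <= C / (1 + x ^+ 2)) ->
  mu.-integrable setT (EFin \o h).
Proof.
move=> ch hC.
apply: (le_integrable _ _ _ (integrableZl measurableT C integrable_oneDsqrV)) => //.
  by apply/measurable_EFinP; exact: continuous_measurable_fun.
by move=> x _ /=; rewrite lee_fin (le_trans (hC _))// ler_norm.
Qed.

Lemma dom_vcons_l n (h : 'rV[R]_n.+1 -> R) (v : 'rV[R]_n) : dom h ->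
  mu.-integrable setT (EFin \o (fun x => h (vcons x v))).
Proof.
move=> [ch [C hC]]; apply: (@integrable_dominated_oneDsqrV _ (C / wt v)).
  exact: continuous_vcons_l.
move=> x; have := hC (vcons x v).
by rewrite wt_cons invfM mulrA [C / _ / _]mulrAC.
Qed.

Lemma rint_vcons1 n (h : 'rV[R]_n.+1 -> R) : dom h ->
  rint h = \int[mu]_x rint (fun v => h (vcons x v)).
Proof.
move=> dh; have ih := dom_rintegrable dh.
rewrite {1}/rint (Rintegral_tupleS1 (f := h \o row_of)) //.
- apply: eq_Rintegral => x _; apply: eq_Rintegral => t _ /=.
  by rewrite row_of_cons.
- by apply: measurable_rV; case: dh.
- move=> x; have := dom_rintegrable (dom_vcons_r x dh).
  rewrite /rintegrable; congr (_.-integrable _ _); apply/funext => t /=.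
  by rewrite row_of_cons.
Qed.

Lemma rint_vcons2 n (h : 'rV[R]_n.+1 -> R) : dom h ->
  rint h = rint (fun v => \int[mu]_x h (vcons x v)).
Proof.
move=> dh; have ih := dom_rintegrable dh.
rewrite {1}/rint (Rintegral_tupleS2 (f := h \o row_of)) //.
- apply: eq_Rintegral => t _; apply: eq_Rintegral => x _ /=.
  by rewrite row_of_cons.
- by apply: measurable_rV; case: dh.
- move=> t; have := dom_vcons_l (row_of t) dh.
  congr (_.-integrable _ _); apply/funext => x /=.
  by rewrite row_of_cons.
Qed.

(** Fubini for two blocks of variables. The product bound makes the iterated integral of the modulus
    finite; [a] and [b] enter that estimate through their absolute values, so no sign is asked of
    them. *)
Lemma rint_swap m n (H : 'rV[R]_m -> 'rV[R]_n -> R) a b :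
  measurable_fun setT (fun p : m.-tuple (measurableTypeR R) * n.-tuple (measurableTypeR R) =>
    H (row_of p.1) (row_of p.2)) ->
  (forall x y, `|H x y| <= a x * b y) ->
  rintegrable a -> rintegrable b ->
  (forall x, rintegrable (H x)) -> (forall y, rintegrable (H ^~ y)) ->
  rint (fun x => rint (H x)) = rint (fun y => rint (H ^~ y)).
Proof.
move=> mH Hab ia ib i1 i2.
have iH : (LT m \x LT n)%E.-integrable setT
    (EFin \o (fun p => H (row_of p.1) (row_of p.2))).
  apply/integrable12ltyP; first exact/measurable_EFinP.
  apply: (@le_lt_trans _ _ (\int[LT m]_s ((`|a (row_of s)| * rint (fun y => `|b y|))%:E))%E).
    apply: ge0_le_integral => //.
    - by move=> s _; apply: integral_ge0.
    - apply: (measurable_fun_fubini_tonelli_F (fun p => (`|H (row_of p.1) (row_of p.2)|)%:E)) => //.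
      apply/measurable_EFinP; exact: (measurableT_comp (f := @Num.norm R R)).
    - have /integrableP[/measurable_EFinP ma _] := ia.
      apply/measurable_EFinP; apply: measurable_funM => //.
      exact: (measurableT_comp (f := @Num.norm R R)).
    move=> s _ /=.
    apply: (@le_trans _ _ (\int[LT n]_t (`|a (row_of s)| * `|b (row_of t)|)%:E)%E).
      have /integrableP[/measurable_EFinP mb _] := ib.
      apply: ge0_le_integral => //.
      - have /integrableP[/measurable_EFinP mHs _] := i1 (row_of s).
        apply/measurable_EFinP; exact: (measurableT_comp (f := @Num.norm R R)).
      - apply/measurable_EFinP; apply: measurable_funM => //.
        exact: (measurableT_comp (f := @Num.norm R R)).
      by move=> t _; rewrite lee_fin (le_trans (Hab _ _))// -normrM ler_norm.
    have inb : (LT n).-integrable setT (EFin \o (fun t => `|b (row_of t)|)).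
      exact: (integrable_norm ib).
    under eq_integral do rewrite EFinM.
    rewrite integralZl// EFinM /rint /Rintegral fineK//.
    exact: (integrable_fin_num _ inb).
  have ina : (LT m).-integrable setT (EFin \o (fun t => `|a (row_of t)|)).
    exact: (integrable_norm ia).
  under eq_integral do rewrite EFinM.
  rewrite integralZr//; apply: lte_mul_pinfty => //; last exact: ltry.
    exact: integral_ge0.
  exact: (integrable_fin_num _ ina).
have e1 : (rint (fun x => rint (H x))) =
    fine (\int[LT m \x LT n]_p (H (row_of p.1) (row_of p.2))%:E)%E.
  rewrite -integral12_prod_meas1//; congr fine; apply: eq_integral => s _.
  by rewrite /fubini_F /= /rint /Rintegral fineK//; exact: (integrable_fin_num _ (i1 _)).
rewrite e1 -integral21_prod_meas1//; congr fine; apply: eq_integral => t _.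
by rewrite /fubini_G /= /rint /Rintegral fineK//; exact: (integrable_fin_num _ (i2 _)).
Qed.

End integrals.

(** * The complex exponential and complex-valued integrals *)

Section elementary_estimates.
Context {R : realType}.
Implicit Types (x y : R) (z w : R[i]).

(** The derivative is bounded only where [|c| <= |x|], so [M] may depend on [x]: the linear bound on
    [sin] then yields the quadratic one on [cos - 1], and so on. *)
Lemma le_mean_value (f df : R -> R) (M x : R) :
  (forall c : R, is_derive c (1:R) f (df c)) -> (forall c, `|c| <= `|x| -> `|df c| <= M) ->
  `|f x - f 0| <= M * `|x|.
Proof.
move=> fdf dfM.
have cf : continuous f.
  by move=> c; apply/differentiable_continuous/derivable1_diffP/ex_derive.
have [x0|x0] := leP 0 x.
  have [c /[!in_itv]/= /andP[c0 cx] ->] :=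
    MVT_segment x0 (fun c _ => fdf c) (continuous_subspaceT cf).
  rewrite subr0 normrM ler_wpM2r// dfM// !ger0_norm//.
have [c /[!in_itv]/= /andP[cx c0]] :=
  MVT_segment (ltW x0) (fun c _ => fdf c) (continuous_subspaceT cf).
rewrite distrC => ->; rewrite sub0r normrM normrN ler_wpM2r// dfM//.
by rewrite !ler0_norm ?lerN2// ltW.
Qed.

Lemma normr_sin_le x : `|sin x| <= `|x|.
Proof.
have := @le_mean_value sin cos 1 x (fun c => is_derive_sin c) (fun c _ => cos_max c).
by rewrite sin0 subr0 mul1r.
Qed.

Lemma normr_cosB1_le x : `|cos x - 1| <= `|x|.
Proof.
have := @le_mean_value cos (fun c => - sin c) 1 x (fun c => is_derive_cos c).
rewrite cos0 mul1r; apply => c _; rewrite normrN; exact: sin_max.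
Qed.

Lemma normr_cosB1_le2 x : `|cos x - 1| <= x ^+ 2.
Proof.
have := @le_mean_value cos (fun c => - sin c) `|x| x (fun c => is_derive_cos c).
rewrite cos0 -expr2 real_normK ?num_real//; apply => c cx.
by rewrite normrN (le_trans (normr_sin_le c)).
Qed.

Lemma normr_sinB_le2 x : `|sin x - x| <= x ^+ 2.
Proof.
have dsin (c : R) : is_derive c (1 : R) (fun y : R => sin y - y) (cos c - 1).
  by apply: is_deriveB.
have := @le_mean_value _ _ `|x| x dsin.
rewrite sin0 !subr0 -expr2 real_normK ?num_real//; apply => c cx.
by rewrite (le_trans (normr_cosB1_le c)).
Qed.

Lemma normr_expRB1_le x : `|expR x - 1| <= `|x| * expR `|x|.
Proof.
have [x0|x0] := leP 0 x.
  rewrite !ger0_norm ?subr_ge0//; last by rewrite (le_trans _ (expR_ge1Dx _))// lerDl.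
  have := expR_ge1Dx (- x); rewrite expRN => h.
  have e0 := expR_gt0 x.
  (* The inequality [1 - x <= exp (- x)] multiplied by [exp x]; it says [exp x - 1 <= x * exp x]. *)
  have : (1 - x) * expR x <= 1 by rewrite -ler_pdivlMr// div1r.
  by lra.
rewrite !ltr0_norm// ?subr_lt0 ?expR_lt1//.
have h1 := expR_ge1Dx x.
have h2 : 1 <= expR (- x) by rewrite (le_trans _ (expR_ge1Dx _))//; lra.
have h3 : - x * 1 <= - x * expR (- x) by rewrite ler_wpM2l// oppr_ge0 ltW.
by lra.
Qed.

(** From [(1 - x) * exp x <= 1] one gets [exp x - 1 - x <= x * (exp x - 1)], and the first-order
    estimate finishes. *)
Lemma normr_expRB1B_le x : `|expR x - 1 - x| <= x ^+ 2 * expR `|x|.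
Proof.
rewrite ger0_norm; last by have := expR_ge1Dx x; lra.
have h1 := expR_ge1Dx (- x); rewrite expRN in h1.
have e0 := expR_gt0 x.
have h : (1 - x) * expR x <= 1 by rewrite -ler_pdivlMr// div1r.
apply: (@le_trans _ _ (x * (expR x - 1))); first by lra.
apply: (le_trans (ler_norm _)); rewrite normrM.
rewrite -[x ^+ 2]real_normK ?num_real// expr2 -mulrA ler_wpM2l//.
exact: normr_expRB1_le.
Qed.

Lemma Re_cexp z : Re (cexp z) = expR (Re z) * cos (Im z).
Proof. by rewrite /cexp cReM /= mul0r subr0. Qed.

Lemma Im_cexp z : Im (cexp z) = expR (Re z) * sin (Im z).
Proof. by rewrite /cexp cImM /= mul0r addr0. Qed.

Lemma cexpD z w : cexp (z + w) = cexp z * cexp w.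
Proof.
apply: complex_ext.
  rewrite [RHS]cReM !Re_cexp !Im_cexp cReD cImD expRD cosD; ring.
rewrite [RHS]cImM !Re_cexp !Im_cexp cReD cImD expRD sinD; ring.
Qed.

Lemma cexp0 : cexp (0 : R[i]) = 1.
Proof. by apply: complex_ext; rewrite ?Re_cexp ?Im_cexp /= expR0 ?cos0 ?sin0 mul1r. Qed.

Lemma normc_cexp z : normc (cexp z) = expR (Re z).
Proof.
have := normc_sqr (cexp z); rewrite Re_cexp Im_cexp !exprMn -mulrDr cos2Dsin2 mulr1.
by move/eqP; rewrite eqrXn2 ?normc_ge0 ?expR_ge0// => /eqP.
Qed.

(** The quadratic remainder behind complex differentiation under the integral sign. Real and
    imaginary part are each a sum of two terms of size at most [N^2 * exp N], whence the 4. *)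
Lemma normc_cexpB1B_le z :
  normc (cexp z - 1 - z) <= 4 * normc z ^+ 2 * expR (normc z).
Proof.
set a := Re z; set b := Im z; set N := normc z.
have ha : `|a| <= N := normRe_le z; have hb : `|b| <= N := normIm_le z.
have N0 : 0 <= N := normc_ge0 z.
have e1 : 1 <= expR N by rewrite (le_trans _ (expR_ge1Dx _))// lerDl.
have ea : expR a <= expR N by rewrite ler_expR (le_trans (ler_norm _)).
have ean : expR `|a| <= expR N by rewrite ler_expR.
have sqle c : `|c| <= N -> c ^+ 2 <= N ^+ 2.
  by move=> cN; rewrite -[c ^+ 2]real_normK ?num_real// lerXn2r ?nnegrE.
have b2 : b ^+ 2 * expR a <= N ^+ 2 * expR N.
  by rewrite ler_pM ?sqr_ge0 ?expR_ge0// sqle.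
have hRe : `|Re (cexp z - 1 - z)| <= 2 * (N ^+ 2 * expR N).
  rewrite !cReD !cReN Re_cexp /= -/a -/b.
  rewrite (_ : _ - _ = (expR a - 1 - a) + expR a * (cos b - 1)); last by ring.
  rewrite (le_trans (ler_normD _ _))// mulr_natl mulr2n lerD//.
    rewrite (le_trans (normr_expRB1B_le _))// ler_pM ?sqr_ge0 ?expR_ge0//.
    exact: sqle.
  rewrite (le_trans _ b2)// normrM mulrC (ger0_norm (expR_ge0 a)).
  by rewrite ler_wpM2r ?expR_ge0// normr_cosB1_le2.
have hIm : `|Im (cexp z - 1 - z)| <= 2 * (N ^+ 2 * expR N).
  rewrite !cImD !cImN Im_cexp /= oppr0 addr0 -/a -/b.
  rewrite (_ : _ - _ = expR a * (sin b - b) + (expR a - 1) * b); last by ring.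
  rewrite (le_trans (ler_normD _ _))// mulr_natl mulr2n lerD//.
    rewrite (le_trans _ b2)// normrM mulrC (ger0_norm (expR_ge0 a)).
    by rewrite ler_wpM2r ?expR_ge0// normr_sinB_le2.
  rewrite normrM (@le_trans _ _ (N * expR N * N))//; last first.
    by rewrite mulrAC -expr2.
  rewrite ler_pM// (le_trans (normr_expRB1_le _))// ler_pM// expR_ge0//.
rewrite (le_trans (normc_le_ReIm _))//.
by move: hRe hIm; rewrite mulrDl !mulrA; lra.
Qed.

Lemma mulic_real x : 'i%C * x%:C = 0 +i* x :> R[i].
Proof. by simpc. Qed.

(** For imaginary arguments there is no exponential factor, so the bound stays usable when the
    frequency ranges over the whole space. *)
Lemma normc_cexp_imB1B_le x :
  normc (cexp ('i%C * x%:C) - 1 - 'i%C * x%:C) <= 2 * x ^+ 2.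
Proof.
rewrite mulic_real (le_trans (normc_le_ReIm _))// !cReD !cReN !cImD !cImN.
rewrite Re_cexp Im_cexp /= expR0 !mul1r ?subr0 ?oppr0 ?addr0.
by rewrite mulr_natl mulr2n lerD ?normr_cosB1_le2 ?normr_sinB_le2.
Qed.

Lemma normc_cexp_imB1_le x : normc (cexp ('i%C * x%:C) - 1) <= 2 * `|x|.
Proof.
rewrite mulic_real (le_trans (normc_le_ReIm _))// !cReD !cReN !cImD !cImN.
rewrite Re_cexp Im_cexp /= expR0 !mul1r ?subr0 ?oppr0 ?addr0.
by rewrite mulr_natl mulr2n lerD ?normr_cosB1_le ?normr_sin_le.
Qed.

End elementary_estimates.

Section complex_integrals.
Context {R : realType}.
Notation mu := (@lebesgue_measure R).

Definition cintegrable n (h : 'rV[R]_n -> R[i]) : Prop :=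
  rintegrable (fun v => Re (h v)) /\ rintegrable (fun v => Im (h v)).

Lemma integralCE n (h : 'rV[R]_n -> R[i]) :
  integralC h = rint (fun v => Re (h v)) +i* rint (fun v => Im (h v)).
Proof. by []. Qed.

Lemma eq_integralC n (h k : 'rV[R]_n -> R[i]) : h =1 k ->
  integralC h = integralC k.
Proof. by move=> /funext ->. Qed.

Lemma cintegrableD n (h k : 'rV[R]_n -> R[i]) : cintegrable h -> cintegrable k ->
  cintegrable (fun v => h v + k v).
Proof.
move=> [rh ih] [rk ik]; split.
  by rewrite (_ : (fun v => _) = fun v => Re (h v) + Re (k v));
    [exact: rintegrableD|apply/funext => v; rewrite cReD].
by rewrite (_ : (fun v => _) = fun v => Im (h v) + Im (k v));
  [exact: rintegrableD|apply/funext => v; rewrite cImD].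
Qed.

Lemma integralCD n (h k : 'rV[R]_n -> R[i]) : cintegrable h -> cintegrable k ->
  integralC (fun v => h v + k v) = integralC h + integralC k.
Proof.
move=> [rh ih] [rk ik]; apply: complex_ext; rewrite ?cReD ?cImD !integralCE /= -rintD//.
  by apply: eq_rint => v; rewrite cReD.
by apply: eq_rint => v; rewrite cImD.
Qed.

Lemma cintegrableZ n c (h : 'rV[R]_n -> R[i]) : cintegrable h ->
  cintegrable (fun v => c * h v).
Proof.
move=> [rh ih]; split.
  rewrite (_ : (fun v => _) = fun v => Re c * Re (h v) + (- Im c) * Im (h v)).
    by apply: rintegrableD; exact: rintegrableZ.
  by apply/funext => v; rewrite cReM mulNr.
rewrite (_ : (fun v => _) = fun v => Re c * Im (h v) + Im c * Re (h v)).
  by apply: rintegrableD; exact: rintegrableZ.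
by apply/funext => v; rewrite cImM.
Qed.

Lemma integralCZ n c (h : 'rV[R]_n -> R[i]) : cintegrable h ->
  integralC (fun v => c * h v) = c * integralC h.
Proof.
move=> [rh ih]; apply: complex_ext; rewrite ?cReM ?cImM !integralCE /=.
  rewrite -mulNr -!rintZ// -rintD; [|exact: rintegrableZ..].
  by apply: eq_rint => v; rewrite cReM mulNr.
rewrite -!rintZ// -rintD; [|exact: rintegrableZ..].
by apply: eq_rint => v; rewrite cImM.
Qed.

Lemma integralCB n (h k : 'rV[R]_n -> R[i]) : cintegrable h -> cintegrable k ->
  integralC (fun v => h v - k v) = integralC h - integralC k.
Proof.
move=> ih ik; rewrite -mulN1r -integralCZ// -integralCD//; last exact: cintegrableZ.
by apply: eq_integralC => v; rewrite mulN1r.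
Qed.

Lemma cintegrableB n (h k : 'rV[R]_n -> R[i]) : cintegrable h -> cintegrable k ->
  cintegrable (fun v => h v - k v).
Proof.
move=> ih ik; rewrite (_ : (fun v => _) = fun v => h v + (-1) * k v).
  by apply: cintegrableD => //; exact: cintegrableZ.
by apply/funext => v; rewrite mulN1r.
Qed.

(** The factor 2 comes from estimating real and imaginary part separately. *)
Lemma normc_integralC_le n (h : 'rV[R]_n -> R[i]) k : cintegrable h ->
  rintegrable k -> (forall v, normc (h v) <= k v) ->
  normc (integralC h) <= 2 * rint k.
Proof.
move=> [rh ih] rk hk; rewrite (le_trans (normc_le_ReIm _))// integralCE /=.
by rewrite mulr_natl mulr2n lerD// rint_abs_le// => v; rewrite (le_trans _ (hk v))//
  ?normRe_le ?normIm_le.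
Qed.

Definition ccont n (h : 'rV[R]_n -> R[i]) : Prop :=
  continuous (fun v => Re (h v)) /\ continuous (fun v => Im (h v)).

Definition cdom n (h : 'rV[R]_n -> R[i]) : Prop :=
  ccont h /\ exists C, forall v, normc (h v) <= C / wt v.

Lemma cdom_Re n (h : 'rV[R]_n -> R[i]) : cdom h -> dom (fun v => Re (h v)).
Proof.
by move=> [[ch _] [C hC]]; split=> //; exists C => v; rewrite (le_trans (normRe_le _)).
Qed.

Lemma cdom_Im n (h : 'rV[R]_n -> R[i]) : cdom h -> dom (fun v => Im (h v)).
Proof.
by move=> [[_ ch] [C hC]]; split=> //; exists C => v; rewrite (le_trans (normIm_le _)).
Qed.

Lemma cdom_cintegrable n (h : 'rV[R]_n -> R[i]) : cdom h -> cintegrable h.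
Proof.
by move=> dh; split; apply: dom_rintegrable; [exact: cdom_Re|exact: cdom_Im].
Qed.

Lemma ccont_cst n (c : R[i]) : ccont (fun _ : 'rV[R]_n => c).
Proof. by split; exact: cst_continuous. Qed.

Lemma ccontD n (h k : 'rV[R]_n -> R[i]) : ccont h -> ccont k ->
  ccont (fun v => h v + k v).
Proof.
move=> [h1 h2] [k1 k2]; split.
  rewrite (_ : (fun v => _) = fun v => Re (h v) + Re (k v)).
    exact: rV_continuousD.
  by apply/funext => v; rewrite cReD.
rewrite (_ : (fun v => _) = fun v => Im (h v) + Im (k v)).
  exact: rV_continuousD.
by apply/funext => v; rewrite cImD.
Qed.

Lemma ccontM n (h k : 'rV[R]_n -> R[i]) : ccont h -> ccont k ->
  ccont (fun v => h v * k v).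
Proof.
move=> [h1 h2] [k1 k2]; split.
  rewrite (_ : (fun v => _) = fun v => Re (h v) * Re (k v) - Im (h v) * Im (k v)).
    by apply: rV_continuousD; [|apply: rV_continuousN]; exact: rV_continuousM.
  by apply/funext => v; rewrite cReM.
rewrite (_ : (fun v => _) = fun v => Re (h v) * Im (k v) + Im (h v) * Re (k v)).
  by apply: rV_continuousD; exact: rV_continuousM.
by apply/funext => v; rewrite cImM.
Qed.

Lemma ccont_realC n (h : 'rV[R]_n -> R) : continuous h -> ccont (fun v => (h v)%:C).
Proof. by move=> ch; split=> //=; exact: cst_continuous. Qed.

Lemma ccont_cexp n (h : 'rV[R]_n -> R[i]) : ccont h -> ccont (fun v => cexp (h v)).
Proof.
move=> [h1 h2]; split.
  rewrite (_ : (fun v => _) = fun v => expR (Re (h v)) * cos (Im (h v))).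
    apply: rV_continuousM => v.
      by apply: (continuous_comp (h1 v)); exact: continuous_expR.
    by apply: (continuous_comp (h2 v)); exact: continuous_cos.
  by apply/funext => v; rewrite Re_cexp.
rewrite (_ : (fun v => _) = fun v => expR (Re (h v)) * sin (Im (h v))).
  apply: rV_continuousM => v.
    by apply: (continuous_comp (h1 v)); exact: continuous_expR.
  by apply: (continuous_comp (h2 v)); exact: continuous_sin.
by apply/funext => v; rewrite Im_cexp.
Qed.

Lemma cdomM n (h k : 'rV[R]_n -> R[i]) M : cdom h -> ccont k ->
  (forall v, normc (k v) <= M) -> cdom (fun v => k v * h v).
Proof.
move=> [ch [C hC]] ck kM; split; first exact: ccontM.
exists (M * C) => v; rewrite ComplexField.Normc.normcM -mulrA.
by apply: ler_pM => //; exact: normc_ge0.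
Qed.

Definition integralC1 (h : R -> R[i]) : R[i] :=
  (\int[mu]_x Re (h x)) +i* (\int[mu]_x Im (h x)).

Lemma integralC_vcons1 n (h : 'rV[R]_n.+1 -> R[i]) : cdom h ->
  integralC h = integralC1 (fun x => integralC (fun v => h (vcons x v))).
Proof.
move=> dh; rewrite integralCE (rint_vcons1 (cdom_Re dh)).
by rewrite (rint_vcons1 (cdom_Im dh)).
Qed.

Lemma integralC_vcons2 n (h : 'rV[R]_n.+1 -> R[i]) : cdom h ->
  integralC h = integralC (fun v => integralC1 (fun x => h (vcons x v))).
Proof.
move=> dh; rewrite integralCE (rint_vcons2 (cdom_Re dh)).
by rewrite (rint_vcons2 (cdom_Im dh)).
Qed.

End complex_integrals.

(** * Goursat's lemma and the shift of contour *)

Section segment_integral.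
Context {R : realType}.
Notation mu := (@lebesgue_measure R).
Implicit Types f g : R -> R.

Definition iseg f (a b : R) : R := \int[mu]_(x in `[a, b]) f x.

Lemma continuous_integrable_seg f (a b : R) : continuous f ->
  mu.-integrable `[a, b] (EFin \o f).
Proof.
move=> cf; apply: continuous_compact_integrable; first exact: segment_compact.
exact: continuous_subspaceT.
Qed.

Lemma iseg_split f (a m b : R) : continuous f -> a <= m -> m <= b ->
  iseg f a b = iseg f a m + iseg f m b.
Proof.
move=> cf am mb.
have iab : mu.-integrable `[a, b] (EFin \o f) by exact: continuous_integrable_seg.
have := @Rintegral_itvB _ f (BLeft a) (BRight b) m iab.
rewrite !bnd_simp => /(_ am mb).
rewrite Rintegral_itv_obnd_cbnd => [h|]; first by rewrite /iseg -h addrC subrK.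
apply: (integrableS _ _ _ (continuous_integrable_seg m b cf)) => //.
exact: subset_itv_oc_cc.
Qed.

Lemma isegB f g (a b : R) : continuous f -> continuous g ->
  iseg (fun x => f x - g x) a b = iseg f a b - iseg g a b.
Proof. by move=> cf cg; rewrite /iseg RintegralB//; exact: continuous_integrable_seg. Qed.

(** Used with [k = 0] to bound an integral by the length of the segment, and with [k] the increment
    of a linear approximation. *)
Lemma iseg_near_cst f (a b k M : R) : continuous f -> a <= b ->
  (forall x, a <= x <= b -> `|f x - k| <= M) ->
  `|iseg f a b - k * (b - a)| <= M * (b - a).
Proof.
move=> cf ab fkM.
have mab : fine (mu `[a, b]) = b - a.
  rewrite lebesgue_measure_itv /= lte_fin; case: ltP => // ba.
  by apply/esym/eqP; rewrite subr_eq0 eq_le ba ab.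
have cst_int (c : R) : iseg (fun=> c) a b = c * (b - a).
  by rewrite /iseg Rintegral_cst// mab.
have ck (c : R) : continuous (fun _ : R => c) by exact: cst_continuous.
rewrite -cst_int -isegB//.
have cfk : continuous (fun x => f x - k).
  by move=> x; apply: continuousB; [exact: cf|exact: ck].
apply: (le_trans (le_normr_Rintegral _ (continuous_integrable_seg a b cfk))) => //.
rewrite -cst_int /iseg; apply: le_Rintegral => //.
- exact: (integrable_norm (continuous_integrable_seg a b cfk)).
- exact: continuous_integrable_seg.
Qed.

(** Dominated convergence for the restrictions of [f] to [[-n, n]], with [|f|] as the bound. *)
Lemma cvg_iseg f : mu.-integrable setT (EFin \o f) -> continuous f ->
  (fun n : nat => iseg f (- n%:R) n%:R) @ \oo --> \int[mu]_x f x.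
Proof.
move=> intf cf; apply: fine_cvg; rewrite fineK; last first.
  exact: (integrable_fin_num _ intf).
pose S (n : nat) : set R := `[- n%:R, n%:R]%classic.
rewrite (_ : (fun n => _) = (fun n : nat => \int[mu]_x (EFin \o (f \_ (S n))) x)%E); last first.
  apply/funext => n; rewrite integral_mkcond; apply: eq_integral => x _.
  by rewrite restrict_EFin.
have iaf := integrable_abse intf.
apply: (dominated_cvg _ _ _ _ iaf) => //.
- move=> n; have mS : measurable (S n) by exact: measurable_itv.
  apply/measurable_EFinP; apply/(measurable_restrictT _ mS).
  have mf : measurable_fun setT f by exact: continuous_measurable_fun.
  exact: (measurable_funTS mf).
- move=> x _; apply: cvg_near_cst; near=> n; rewrite /= patchE mem_set//=.
  rewrite /S /= in_itv/= -ler_norml (@le_trans _ _ (Num.trunc `|x|).+1%:R)//.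
    exact/ltW/truncnS_gt.
  rewrite ler_nat; near: n; exists (Num.trunc `|x|).+1 => //.
- by move=> n x _ /=; rewrite patchE; case: ifP => // _; rewrite normr0 lee_fin.
Unshelve. all: by end_near. Qed.

(** The rate is that of boundary terms dominated by [1 / (1 + x^2)]: the vertical sides of a long
    rectangle, and the endpoint values in an integration by parts. *)
Lemma Rintegral_eq0_of_iseg f K : mu.-integrable setT (EFin \o f) -> continuous f ->
  (forall n : nat, `|iseg f (- n%:R) n%:R| <= K / (1 + n%:R ^+ 2)) ->
  \int[mu]_x f x = 0.
Proof.
move=> intf cf fK.
have K0 : 0 <= K by have := fK 0%N; rewrite expr0n addr0 divr1; exact: le_trans.
have hc := cvg_iseg intf cf.
apply: (@cvg_unique _ (@norm_hausdorff _ _) _ _ _ _ hc).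
apply/cvgrPdist_le => e e0; near=> n; rewrite sub0r normrN (le_trans (fK n))//.
rewrite ler_pdivrMr ?ltr_pwDl ?sqr_ge0// -ler_pdivrMl// mulrC.
have n1 : 1 <= n%:R :> R by rewrite ler1n; near: n; exists 1%N.
apply: (@le_trans _ _ n%:R).
  apply: (@le_trans _ _ (Num.trunc (K / e)).+1%:R); first exact/ltW/truncnS_gt.
  by rewrite ler_nat; near: n; exists (Num.trunc (K / e)).+1.
by rewrite (@le_trans _ _ (n%:R ^+ 2))// ?lerDr// expr2 ler_peMr.
Unshelve. all: by end_near. Qed.

End segment_integral.

(** * Circulation of a closed form around a rectangle, by bisection *)

Section goursat.
Context {R : realType} (P Q : R -> R -> R).

(* P dx + Q dy is differentiable at every point, and closed there: the
   coefficient [be] is both dP/dy and dQ/dx.  This holds for the real and the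
   imaginary part of f(z) dz when f is holomorphic. *)
Definition closed_form_at (x0 y0 : R) : Prop := exists al be ga : R,
  forall e, 0 < e -> exists2 r, 0 < r & forall x y,
    `|x - x0| < r -> `|y - y0| < r ->
    `|P x y - P x0 y0 - al * (x - x0) - be * (y - y0)| <= e * (`|x - x0| + `|y - y0|) /\
    `|Q x y - Q x0 y0 - be * (x - x0) - ga * (y - y0)| <= e * (`|x - x0| + `|y - y0|).

Hypothesis (cP : forall y, continuous (P ^~ y)) (cQ : forall x, continuous (Q x)).
Hypothesis PQ : forall x y, closed_form_at x y.

(** The integral of [P dx + Q dy] around [[a, b] x [c, d]], counterclockwise. *)
Definition circ (a b c d : R) : R :=
  iseg (P ^~ c) a b + iseg (Q b) c d - iseg (P ^~ d) a b - iseg (Q a) c d.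

Lemma circ_split a m b c n d : a <= m -> m <= b -> c <= n -> n <= d ->
  circ a b c d = circ a m c n + circ m b c n + circ a m n d + circ m b n d.
Proof.
move=> am mb cn nd; rewrite /circ.
rewrite (iseg_split (@cP c) am mb) (iseg_split (@cP d) am mb).
rewrite (iseg_split (@cQ a) cn nd) (iseg_split (@cQ b) cn nd).
ring.
Qed.

(** The linear approximations contribute [- be * m * l] through the horizontal sides and
    [be * l * m] through the vertical ones, and these cancel because the form is closed. The errors
    on opposite sides add up to [2 * e * (l + m)] times [l], respectively [m]. *)
Lemma circ_local x0 y0 e : 0 < e -> exists2 r, 0 < r & forall a c l m,
  0 <= l < r -> 0 <= m < r -> a <= x0 <= a + l -> c <= y0 <= c + m ->
  `|circ a (a + l) c (c + m)| <= 2 * e * (l + m) ^+ 2.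
Proof.
move=> e0; have [al [be [ga /(_ e e0)[r r0 rP]]]] := PQ x0 y0.
exists r => // a c l m /andP[l0 lr] /andP[m0 mr] /andP[ax xa] /andP[cy yc].
have loc x y : a <= x <= a + l -> c <= y <= c + m ->
    `|P x y - P x0 y0 - al * (x - x0) - be * (y - y0)| <= e * (l + m) /\
    `|Q x y - Q x0 y0 - be * (x - x0) - ga * (y - y0)| <= e * (l + m).
  move=> /andP[h1 h2] /andP[h3 h4].
  have hx : `|x - x0| <= l by rewrite ler_norml; lra.
  have hy : `|y - y0| <= m by rewrite ler_norml; lra.
  have [||p q] := rP x y; [exact: le_lt_trans lr|exact: le_lt_trans mr|].
  by split; rewrite (le_trans p, le_trans q)// ler_pM2l// lerD.
have hP : `|iseg (fun x => P x c - P x (c + m)) a (a + l) - (- be * m) * (a + l - a)|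
    <= 2 * e * (l + m) * (a + l - a).
  apply: iseg_near_cst; [|lra|].
    by move=> x; apply: continuousB; [exact: cP|exact: cP].
  move=> x hx.
  have [|p1 _] := loc x c hx; first by apply/andP; split; lra.
  have [|p2 _] := loc x (c + m) hx; first by apply/andP; split; lra.
  move: p1 p2; rewrite !ler_norml => /andP[p1 p2] /andP[p3 p4].
  by apply/andP; split; lra.
have hQ : `|iseg (fun y => Q (a + l) y - Q a y) c (c + m) - (be * l) * (c + m - c)|
    <= 2 * e * (l + m) * (c + m - c).
  apply: iseg_near_cst; [|lra|].
    by move=> x; apply: continuousB; [exact: cQ|exact: cQ].
  move=> y hy.
  have [|//|_ p1] := loc a y; first by apply/andP; split; lra.
  have [|//|_ p2] := loc (a + l) y; first by apply/andP; split; lra.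
  move: p1 p2; rewrite !ler_norml => /andP[p1 p2] /andP[p3 p4].
  by apply/andP; split; lra.
move: hP hQ; rewrite !isegB// /circ.
move: (iseg _ _ _) (iseg _ _ _) (iseg _ _ _) (iseg _ _ _) => i1 i2 i3 i4.
rewrite !ler_norml => /andP[p1 p2] /andP[q1 q2].
have e1 : 2 * e * (l + m) ^+ 2 = 2 * e * (l + m) * l + 2 * e * (l + m) * m by ring.
rewrite e1; apply/andP; split; lra.
Qed.

Section bisection.
Variables (a0 c0 L M ka : R).
Hypotheses (L0 : 0 < L) (M0 : 0 < M) (ka0 : 0 < ka).
Hypothesis big : ka * (L * M) <= `|circ a0 (a0 + L) c0 (c0 + M)|.

Let l n : R := L / 2 ^+ n.
Let m n : R := M / 2 ^+ n.

Let lS n : l n = l n.+1 + l n.+1.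
Proof. by rewrite /l [LHS]splitr exprS invfM mulrA [L / 2 / _]mulrAC. Qed.

Let mS n : m n = m n.+1 + m n.+1.
Proof. by rewrite /m [LHS]splitr exprS invfM mulrA [M / 2 / _]mulrAC. Qed.

Let l_gt0 n : 0 < l n. Proof. by rewrite divr_gt0// exprn_gt0. Qed.
Let m_gt0 n : 0 < m n. Proof. by rewrite divr_gt0// exprn_gt0. Qed.

(** The circulation is at least [ka] times the area. If this failed on all four quarters of a
    rectangle it would fail on the rectangle, so it can be passed down the bisection. *)
Let large n (p : R * R) :=
  ka * (l n * m n) <= `|circ p.1 (p.1 + l n) p.2 (p.2 + m n)|.

(** The last quarter is taken untested; [large_corner] shows that it qualifies when the other three
    do not. *)
Let step n (p : R * R) : R * R :=
  if large n.+1 p then p else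
  if large n.+1 (p.1 + l n.+1, p.2) then (p.1 + l n.+1, p.2) else
  if large n.+1 (p.1, p.2 + m n.+1) then (p.1, p.2 + m n.+1) else
  (p.1 + l n.+1, p.2 + m n.+1).

Fixpoint corner n : R * R :=
  if n is k.+1 then step k (corner k) else (a0, c0).

Let large_corner n : large n (corner n).
Proof.
elim: n => [|n IHn]; first by rewrite /large /l /m expr0 !divr1.
rewrite /=; move: (corner n) IHn => [a c].
have l0 := l_gt0 n.+1; have m0 := m_gt0 n.+1.
rewrite /step /large /= lS mS.
rewrite (@circ_split a (a + l n.+1) (a + (l n.+1 + l n.+1)) c (c + m n.+1)); try lra.
rewrite ![a + (_ + _)]addrA ![c + (_ + _)]addrA.
have le4 (x y z t : R) : `|x + y + z + t| <= `|x| + `|y| + `|z| + `|t|.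
  by rewrite !(le_trans (ler_normD _ _))// !lerD// (le_trans (ler_normD _ _))// !lerD// ler_normD.
case: ifPn => // h1; case: ifPn => // h2; case: ifPn => // h3; move: h1 h2 h3 => /=.
rewrite -!ltNge.
move: (circ _ _ _ _) (circ _ _ _ _) (circ _ _ _ _) (circ _ _ _ _) => i1 i2 i3 i4 h1 h2 h3 h4.
have := le_trans h4 (le4 i4 i3 i2 i1).
rewrite (_ : ka * ((l n.+1 + l n.+1) * _) = 4 * (ka * (l n.+1 * m n.+1))); last by ring.
lra.
Qed.

Let corner_le n : (corner n).1 <= (corner n.+1).1 <= (corner n).1 + l n.+1 /\
  (corner n).2 <= (corner n.+1).2 <= (corner n).2 + m n.+1.
Proof.
have l0 := l_gt0 n.+1; have m0 := m_gt0 n.+1.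
rewrite /= /step; case: (corner n) => a c /=.
by do ![case: ifP => _ /=]; split; apply/andP; split; lra.
Qed.

(** Nested closed intervals share the supremum of their left ends. *)
Let nested (u w : nat -> R) : (forall n, 0 <= w n) ->
  (forall n, u n <= u n.+1) -> (forall n, u n.+1 + w n.+1 <= u n + w n) ->
  exists x, forall n, u n <= x <= u n + w n.
Proof.
move=> w0 uu uw.
have mono : {homo u : i j / (i <= j)%N >-> i <= j}.
  exact: (@homo_leq _ u (fun x y => x <= y) (@lexx _ _) (fun y x z h => le_trans h)).
have anti i j : (i <= j)%N -> u j + w j <= u i + w i.
  by move=> /subnKC <-; elim: (_ - _)%N => [|k IH]; rewrite ?addn0// addnS (le_trans (uw _)).
have bd i j : u i <= u j + w j.
  have [ij|/ltnW ji] := leqP i j.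
    by rewrite (le_trans (mono _ _ ij))// lerDl.
  by rewrite (le_trans _ (anti _ _ ji))// lerDl.
exists (sup (range u)) => n; apply/andP; split.
  apply: ub_le_sup; last by exists n.
  by exists (u 0%N + w 0%N) => _ [i _ <-].
apply: ge_sup; first by exists (u 0%N), 0%N.
by move=> _ [i _ <-].
Qed.

Lemma bisection_false : False.
Proof.
have [x0 xP] : exists x, forall n, (corner n).1 <= x <= (corner n).1 + l n.
  apply: nested => n; first exact/ltW.
    by have [/andP[]] := corner_le n.
  by have [/andP[_ h] _] := corner_le n; rewrite (lS n); lra.
have [y0 yP] : exists x, forall n, (corner n).2 <= x <= (corner n).2 + m n.
  apply: nested => n; first exact/ltW.
    by have [_ /andP[]] := corner_le n.
  by have [_ /andP[_ h]] := corner_le n; rewrite (mS n); lra.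
(* With this [e] the bound of [circ_local] on a rectangle with sides [l n] and [m n] is half of
   [ka * (l n * m n)], against [large_corner]. *)
pose e := ka * (L * M) / (4 * (L + M) ^+ 2).
have LM0 : 0 < (L + M) ^+ 2 by rewrite exprn_gt0// addr_gt0.
have e0 : 0 < e by apply: divr_gt0; apply: mulr_gt0 => //; apply: mulr_gt0.
have [r r0 rP] := circ_local x0 y0 e0.
pose n := (Num.trunc ((L + M) / r)).+1.
have small : (L + M) / 2 ^+ n < r.
  rewrite ltr_pdivrMr ?exprn_gt0// mulrC -ltr_pdivrMr//.
  by rewrite (lt_trans (truncnS_gt _))// -natrX ltr_nat ltn_expl.
have lmE : l n + m n = (L + M) / 2 ^+ n by rewrite /l /m mulrDl.
have l0 := l_gt0 n; have m0 := m_gt0 n.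
have lr : 0 <= l n < r by apply/andP; split; lra.
have mr : 0 <= m n < r by apply/andP; split; lra.
have := le_trans (large_corner n) (rP _ _ _ _ lr mr (xP n) (yP n)).
rewrite lmE /l /m /e leNgt => /negP; apply.
have p0 : 0 < (2 ^+ n)^-1 :> R by rewrite invr_gt0 exprn_gt0.
move: ((2 ^+ n)^-1) p0 => p p0.
rewrite (_ : 2 * _ * _ = ka * (L * p * (M * p)) / 2); last first.
  by field; rewrite lt0r_neq0// addr_gt0.
by rewrite ltr_pdivrMr// ltr_pMr ?ltr1n// !mulr_gt0.
Qed.

End bisection.

(** Degenerate rectangles are treated apart because [ka] is the circulation divided by the area. *)
Lemma circ_eq0 a b c d : a <= b -> c <= d -> circ a b c d = 0.
Proof.
have iseg_pt (f : R -> R) x : iseg f x x = 0.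
  by rewrite /iseg set_itv1 Rintegral_set1.
rewrite le_eqVlt => /predU1P[->|ab].
  by move=> _; rewrite /circ !iseg_pt; lra.
rewrite le_eqVlt => /predU1P[->|cd].
  by rewrite /circ !iseg_pt; lra.
apply/eqP/negPn/negP => nz.
have L0 : 0 < b - a by rewrite subr_gt0.
have M0 : 0 < d - c by rewrite subr_gt0.
pose ka := `|circ a b c d| / ((b - a) * (d - c)).
apply: (@bisection_false a c (b - a) (d - c) ka) => //.
  by rewrite divr_gt0 ?normr_gt0// mulr_gt0.
rewrite [a + _]addrC subrK [c + _]addrC subrK /ka divfK//.
by rewrite mulf_neq0// lt0r_neq0.
Qed.

End goursat.

(** * Moving a horizontal line of integration *)

Section contour_shift.
Context {R : realType}.
Notation mu := (@lebesgue_measure R).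

(* [h x y] stands for the value at x + i y of a function of a complex variable. *)
Definition holomorphic_at (h : R -> R -> R[i]) (x0 y0 : R) : Prop :=
  exists w : R[i], forall e, 0 < e -> exists2 r, 0 < r & forall x y,
    `|x - x0| < r -> `|y - y0| < r ->
    normc (h x y - h x0 y0 - w * ((x - x0) +i* (y - y0))) <=
      e * (`|x - x0| + `|y - y0|).

Context (h : R -> R -> R[i]).
Hypothesis hh : forall x y, holomorphic_at h x y.

Lemma holomorphic_continuous x0 y0 e : 0 < e -> exists2 r, 0 < r & forall x y,
  `|x - x0| < r -> `|y - y0| < r -> normc (h x y - h x0 y0) < e.
Proof.
move=> e0; have [w /(_ 1 ltr01)[r r0 rP]] := hh x0 y0.
pose K := 1 + normc w; have K0 : 0 < K by rewrite ltr_pwDl// normc_ge0.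
exists (Num.min r (e / (2 * K))) => [|x y].
  by rewrite lt_min r0 divr_gt0// mulr_gt0.
rewrite !lt_min => /andP[x1 x2] /andP[y1 y2].
have := rP x y x1 y1; rewrite mul1r => h1.
rewrite -[_ - _](subrK (w * ((x - x0) +i* (y - y0)))) (le_lt_trans (le_normcD _ _))//.
have h2 := normc_le_ReIm ((x - x0) +i* (y - y0)); rewrite /= in h2.
rewrite ComplexField.Normc.normcM (@le_lt_trans _ _ (K * (`|x - x0| + `|y - y0|)))//.
  rewrite mulrDl mul1r lerD// ler_wpM2l// ?normc_ge0//.
rewrite mulrC -ltr_pdivlMr// (lt_le_trans (ltrD x2 y2))//.
by rewrite invfM mulrA [e / 2 / K]mulrAC -splitr.
Qed.

(** The circulation around [[-n, n] x [c, d]] is zero and each vertical side is at most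
    [C / (1 + n^2)] times [d - c], so the difference of the horizontal sides tends to 0. *)
Lemma holomorphic_shift c d C : c <= d ->
  (forall x y, c <= y <= d -> normc (h x y) <= C / (1 + x ^+ 2)) ->
  integralC1 (h ^~ c) = integralC1 (h ^~ d).
Proof.
move=> cd hC.
have ccd : c <= c <= d by rewrite lexx.
have dcd : c <= d <= d by rewrite lexx andbT.
have contx p y : (forall z w, `|p (z - w)| <= normc (z - w) /\ p (z - w) = p z - p w) ->
    continuous (fun x => p (h x y) : R).
  move=> pP x; apply/cvgrPdist_lt => e e0.
  have [r r0 rP] := holomorphic_continuous x y e0.
  exists r => // x' /= x'r; have [p1 p2] := pP (h x' y) (h x y).
  by rewrite distrC -p2 (le_lt_trans p1)// rP// ?subrr ?normr0// distrC.
have conty p x : (forall z w, `|p (z - w)| <= normc (z - w) /\ p (z - w) = p z - p w) ->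
    continuous (fun y => p (h x y) : R).
  move=> pP y; apply/cvgrPdist_lt => e e0.
  have [r r0 rP] := holomorphic_continuous x y e0.
  exists r => // x' /= x'r; have [p1 p2] := pP (h x x') (h x y).
  by rewrite distrC -p2 (le_lt_trans p1)// rP// ?subrr ?normr0// distrC.
have pRe (z w : R[i]) : `|Re (z - w)| <= normc (z - w) /\ Re (z - w) = Re z - Re w.
  by rewrite normRe_le cReD cReN.
have pIm (z w : R[i]) : `|Im (z - w)| <= normc (z - w) /\ Im (z - w) = Im z - Im w.
  by rewrite normIm_le cImD cImN.
have pN (z w : R[i]) : `|- Im (z - w)| <= normc (z - w) /\ - Im (z - w) = - Im z - - Im w.
  by rewrite normrN normIm_le cImD cImN; split=> //; ring.
(* With [h = u + i v], the form [h dz] has real part [u dx - v dy] and imaginary part [v dx + u dy];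
   [p] and [q] pick the two coefficients of either one. *)
have shift (p q : R[i] -> R) : (forall z, `|p z| <= normc z) -> (forall z, `|q z| <= normc z) ->
    (forall y, continuous (fun x => p (h x y) : R)) ->
    (forall x, continuous (fun y => q (h x y) : R)) ->
    (forall x y, closed_form_at (fun x y => p (h x y)) (fun x y => q (h x y)) x y) ->
    \int[mu]_x p (h x c) = \int[mu]_x p (h x d).
  move=> pn qn cp cq pq.
  have ip y : c <= y <= d -> mu.-integrable setT (EFin \o (fun x => p (h x y))).
    move=> ycd; apply: (@integrable_dominated_oneDsqrV _ _ C); first exact: cp.
    by move=> x; rewrite (le_trans (pn _))// hC.
  apply/eqP; rewrite -subr_eq0 -RintegralB//; [|exact: ip|exact: ip].
  apply/eqP; apply: (@Rintegral_eq0_of_iseg _ _ (2 * C * (d - c))).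
  - exact: (integrableB _ (ip c ccd) (ip d dcd)).
  - by move=> x; apply: continuousB; exact: cp.
  move=> n; rewrite isegB//.
  have nn : - n%:R <= n%:R :> R by rewrite (@le_trans _ _ 0)// oppr_le0.
  have := circ_eq0 cp cq pq nn cd; rewrite /circ.
  have side x : `|x| = n%:R ->
     `|iseg (fun y => q (h x y)) c d| <= C / (1 + n%:R ^+ 2) * (d - c).
    move=> xn; rewrite -[iseg _ _ _]subr0 -[X in _ - X](mul0r (d - c)).
    apply: (iseg_near_cst (cq x) cd) => y ycd; rewrite subr0 (le_trans (qn _))// (le_trans (hC _ _ ycd))//.
    by rewrite -(real_normK (num_real x)) xn.
  have := side n%:R (ger0_norm (ler0n _ _)).
  have := side (- n%:R); rewrite normrN ger0_norm// => /(_ erefl).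
  move: (iseg _ _ _) (iseg _ _ _) (iseg _ _ _) (iseg _ _ _) => i1 i2 i3 i4.
  rewrite (_ : 2 * C * (d - c) / (1 + n%:R ^+ 2) = 2 * (C / (1 + n%:R ^+ 2) * (d - c))); last first.
    by rewrite mulrAC -!mulrA.
  rewrite !ler_norml => /andP[p1 p2] /andP[q1 q2] e1; apply/andP; split; lra.
apply: complex_ext => /=.
  have := shift (fun z => Re z) (fun z => - Im z); apply.
  - exact: normRe_le.
  - by move=> z; rewrite normrN normIm_le.
  - by move=> y; apply: contx.
  - by move=> x; apply: (conty (fun z => - Im z)).
  move=> x0 y0; have [w wP] := hh x0 y0.
  (* Cauchy-Riemann: [- Im w] is both the y-derivative of [Re h] and the x-derivative of
     [- Im h]. *)
  exists (Re w), (- Im w), (- Re w) => e /wP[r r0 rP]; exists r => // x y xr yr.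
  have := rP x y xr yr; set z := (X in normc X) => hz.
  have := le_trans (normRe_le z) hz; have := le_trans (normIm_le z) hz.
  rewrite /z !cReD !cReN !cImD !cImN cReM cImM /= => h1 h2; split.
    by apply: le_trans h2; rewrite le_eqVlt; apply/orP; left; apply/eqP; congr `|_|; ring.
  by apply: le_trans h1; rewrite -normrN le_eqVlt; apply/orP; left; apply/eqP; congr `|_|; ring.
have := shift (fun z => Im z) (fun z => Re z); apply.
- exact: normIm_le.
- exact: normRe_le.
- by move=> y; apply: contx.
- by move=> x; apply: conty.
move=> x0 y0; have [w wP] := hh x0 y0.
exists (Im w), (Re w), (- Im w) => e /wP[r r0 rP]; exists r => // x y xr yr.
have := rP x y xr yr; set z := (X in normc X) => hz.
have := le_trans (normRe_le z) hz; have := le_trans (normIm_le z) hz.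
rewrite /z !cReD !cReN !cImD !cImN cReM cImM /= => h1 h2; split.
  by apply: le_trans h1; rewrite le_eqVlt; apply/orP; left; apply/eqP; congr `|_|; ring.
by apply: le_trans h2; rewrite le_eqVlt; apply/orP; left; apply/eqP; congr `|_|; ring.
Qed.

End contour_shift.

(** * Holomorphic functions of several variables *)

Section several_variables.
Context {R : realType}.
Implicit Types (n : nat).

Definition norm1 n (h : 'rV[R[i]]_n) : R := \sum_i normc (h 0 i).

Lemma norm1_ge0 n (h : 'rV[R[i]]_n) : 0 <= norm1 h.
Proof. by apply: sumr_ge0 => i _; exact: normc_ge0. Qed.

Lemma normc_le_norm1 n (h : 'rV[R[i]]_n) i : normc (h 0 i) <= norm1 h.
Proof.
by rewrite /norm1 (bigD1 i)//= lerDl sumr_ge0// => j _; exact: normc_ge0.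
Qed.

Lemma normc_sum_le n (f : 'I_n -> R[i]) :
  normc (\sum_i f i) <= \sum_i normc (f i).
Proof.
elim/big_ind2: _ => // [|x a y b xa yb]; first by rewrite ComplexField.Normc.normc0.
by rewrite (le_trans (le_normcD _ _))// lerD.
Qed.

Lemma normc_lin_le n (w : 'I_n -> R[i]) (h : 'rV[R[i]]_n) :
  normc (\sum_i w i * h 0 i) <= (\sum_i normc (w i)) * norm1 h.
Proof.
rewrite (le_trans (normc_sum_le _))// mulr_suml ler_sum// => i _.
by rewrite ComplexField.Normc.normcM ler_wpM2l ?normc_ge0// normc_le_norm1.
Qed.

(* Differentiability with a real-valued norm and error bound, whereas the norm of
   the normed space [R[i]^o] takes values in [R[i]]; equivalent by
   [differentiable_hol] and [hol_entire]. *)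
Definition hol n (F : 'rV[R[i]]_n -> R[i]) (z : 'rV[R[i]]_n) : Prop :=
  exists w : 'I_n -> R[i], forall e, 0 < e -> exists2 r, 0 < r &
    forall h, norm1 h < r ->
    normc (F (z + h) - F z - \sum_i w i * h 0 i) <= e * norm1 h.

Lemma hol_lipschitz n (F : 'rV[R[i]]_n -> R[i]) z : hol F z ->
  exists2 K, 0 <= K & exists2 r, 0 < r & forall h, norm1 h < r ->
    normc (F (z + h) - F z) <= K * norm1 h.
Proof.
move=> [w /(_ 1 ltr01)[r r0 rP]]; exists (1 + \sum_i normc (w i)).
  by rewrite addr_ge0// sumr_ge0// => i _; exact: normc_ge0.
exists r => // h /rP; rewrite mul1r => hP.
rewrite -[_ - _](subrK (\sum_i w i * h 0 i)) (le_trans (le_normcD _ _))//.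
by rewrite mulrDl mul1r lerD// normc_lin_le.
Qed.

(** One third of the error allowance for a product; the [+ 1] keeps the denominator positive when
    [B = 0]. *)
Lemma third_budget (e B N : R) : 0 < e -> 0 <= B -> 0 <= N ->
  e / (3 * (B + 1)) * N * B <= e / 3 * N.
Proof.
move=> e0 B0 N0; have B1 : 0 < B + 1 by rewrite ltr_pwDr.
rewrite (_ : _ * B = e / 3 * N * (B / (B + 1))); last by field; rewrite lt0r_neq0.
apply: ler_piMr; first by rewrite mulr_ge0// divr_ge0// ltW.
by rewrite ler_pdivrMr// mul1r lerDl.
Qed.

Lemma holM n (F G : 'rV[R[i]]_n -> R[i]) z : hol F z -> hol G z ->
  hol (fun z => F z * G z) z.
Proof.
move=> hF hG; have [K K0 [r1 r10 r1P]] := hol_lipschitz hG.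
move: hF hG => [w wP] [w' wP'].
exists (fun i => w i * G z + F z * w' i) => e e0.
set A := normc (F z); set B := normc (G z) + K * r1; set W := \sum_i normc (w i).
have A0 : 0 <= A := normc_ge0 _.
have B0 : 0 <= B by rewrite addr_ge0 ?normc_ge0// mulr_ge0// ltW.
have W0 : 0 <= W by rewrite sumr_ge0// => i _; exact: normc_ge0.
have e1 : 0 < e / (3 * (B + 1)) by rewrite divr_gt0// mulr_gt0// ltr_pwDr.
have e2 : 0 < e / (3 * (A + 1)) by rewrite divr_gt0// mulr_gt0// ltr_pwDr.
have [r2 r20 r2P] := wP _ e1; have [r3 r30 r3P] := wP' _ e2.
have WK : 0 < 3 * (W * K + 1) by rewrite mulr_gt0// ltr_pwDr// mulr_ge0.
exists (Num.min (Num.min r1 r2) (Num.min r3 (e / (3 * (W * K + 1))))) => [|h].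
  by rewrite !lt_min r10 r20 r30 divr_gt0.
rewrite !lt_min => /andP[/andP[h1 h2] /andP[h3 h4]].
have N0 := norm1_ge0 h; set N := norm1 h in h1 h2 h3 h4 N0 *.
(* Two terms carry the remainders of [F] and [G]; the middle one is a product of two first-order
   quantities and is small because [norm1 h] is. *)
have -> : F (z + h) * G (z + h) - F z * G z - \sum_i (w i * G z + F z * w' i) * h 0 i =
  (F (z + h) - F z - \sum_i w i * h 0 i) * G (z + h) +
  ((\sum_i w i * h 0 i) * (G (z + h) - G z) +
  F z * (G (z + h) - G z - \sum_i w' i * h 0 i)).
  have -> : \sum_i (w i * G z + F z * w' i) * h 0 i =
      G z * (\sum_i w i * h 0 i) + F z * (\sum_i w' i * h 0 i).
    rewrite !mulr_sumr -big_split /=; apply: eq_bigr => i _; ring.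
  ring.
have GB : normc (G (z + h)) <= B.
  rewrite -[G _](subrK (G z)) (le_trans (le_normcD _ _))// addrC lerD//.
  by rewrite (le_trans (r1P _ h1))// ler_wpM2l// ltW.
have t1 : normc (F (z + h) - F z - \sum_i w i * h 0 i) * normc (G (z + h)) <= e / 3 * N.
  apply: (le_trans (ler_pM (normc_ge0 _) (normc_ge0 _) (r2P _ h2) GB)).
  exact: third_budget.
have t2 : normc (\sum_i w i * h 0 i) * normc (G (z + h) - G z) <= e / 3 * N.
  apply: (le_trans (ler_pM (normc_ge0 _) (normc_ge0 _) (normc_lin_le _ _) (r1P _ h1))).
  rewrite -/W -/N mulrACA mulrA ler_wpM2r//.
  rewrite ltr_pdivlMr// in h4; rewrite ler_pdivlMr//.
  apply: le_trans (ltW h4); rewrite mulrAC mulrC -!mulrA !(mulrC N) !mulrA.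
  by rewrite ler_wpM2r// -mulrA ler_wpM2l// lerDl.
have t3 : normc (F z) * normc (G (z + h) - G z - \sum_i w' i * h 0 i) <= e / 3 * N.
  apply: (le_trans (ler_wpM2l (normc_ge0 _) (r3P _ h3))).
  by rewrite mulrC; exact: third_budget.
rewrite (le_trans (le_normcD _ _))// ComplexField.Normc.normcM.
rewrite (le_trans (lerD t1 (le_normcD _ _)))// !ComplexField.Normc.normcM.
rewrite (le_trans (lerD (lexx _) (lerD t2 t3)))//.
by rewrite -subr_ge0 (_ : _ - _ = 0)//; field.
Qed.

Lemma hol_cexp n (a : 'I_n -> R[i]) z : hol (fun z => cexp (\sum_i a i * z 0 i)) z.
Proof.
pose L (h : 'rV[R[i]]_n) := \sum_i a i * h 0 i.
pose E := cexp (L z); pose A := \sum_i normc (a i).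
have A0 : 0 <= A by rewrite sumr_ge0// => i _; exact: normc_ge0.
pose K := normc E * (4 * A ^+ 2 * expR A).
have K0 : 0 <= K by rewrite !mulr_ge0 ?normc_ge0 ?sqr_ge0 ?expR_ge0.
exists (fun i => E * a i) => e e0.
(* The bound 1 on [norm1 h] caps the exponential factor of the remainder at [expR A]; the other
   bound turns the quadratic remainder into [e * norm1 h]. *)
exists (Num.min 1 (e / (K + 1))) => [|h].
  by rewrite lt_min ltr01 divr_gt0// ltr_pwDr.
rewrite lt_min => /andP[h1 h2]; have N0 := norm1_ge0 h.
have -> : \sum_i a i * (z + h) 0 i = L z + L h.
  by rewrite -big_split /=; apply: eq_bigr => i _; rewrite mxE mulrDr.
rewrite cexpD -/E -/(L z) -/E.
have -> : E * cexp (L h) - E - \sum_i E * a i * h 0 i = E * (cexp (L h) - 1 - L h).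
  rewrite !mulrBr mulr1 /L mulr_sumr; congr (_ - _).
  by apply: eq_bigr => i _; rewrite mulrA.
have hL : normc (L h) <= A * norm1 h by exact: normc_lin_le.
rewrite ComplexField.Normc.normcM.
apply: (@le_trans _ _ (normc E * (4 * (A * norm1 h) ^+ 2 * expR A))).
  rewrite ler_wpM2l ?normc_ge0// (le_trans (normc_cexpB1B_le _))//.
  apply: ler_pM; [by rewrite mulr_ge0// sqr_ge0|exact: expR_ge0| |].
    by rewrite ler_pM2l// lerXn2r// nnegrE ?normc_ge0// mulr_ge0.
  by rewrite ler_expR (le_trans hL)// ler_piMr// ltW.
rewrite (_ : _ * _ = K * norm1 h * norm1 h); last by rewrite /K; ring.
rewrite ler_wpM2r//; rewrite ltr_pdivlMr ?ltr_pwDr// in h2.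
by rewrite (le_trans _ (ltW h2))// mulrC ler_wpM2l// lerDl.
Qed.

Lemma hol_slice_r n (F : 'rV[R[i]]_n.+1 -> R[i]) x v :
  hol F (vcons x v) -> hol (fun v => F (vcons x v)) v.
Proof.
move=> [w wP]; exists (fun i => w (lift ord0 i)) => e /wP[r r0 rP].
exists r => // h hr.
have e1 : vcons x (v + h) = vcons x v + vcons 0 h.
  apply/rowP => i; rewrite [RHS]mxE.
  by case: (unliftP ord0 i) => [j|] ->; rewrite ?vconsS ?vcons0 ?mxE ?addr0.
have e2 : norm1 (vcons 0 h) = norm1 h.
  rewrite /norm1 big_ord_recl vcons0 ComplexField.Normc.normc0 add0r.
  by apply: eq_bigr => i _; rewrite vconsS.
have := rP (vcons 0 h); rewrite e2 e1 big_ord_recl vcons0 mulr0 add0r.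
by under eq_bigr do rewrite vconsS; apply.
Qed.

Lemma hol_slice_l n (F : 'rV[R[i]]_n.+1 -> R[i]) x y v :
  hol F (vcons (x +i* y) v) -> holomorphic_at (fun x y => F (vcons (x +i* y) v)) x y.
Proof.
move=> [w wP]; exists (w ord0) => e e0; have [r r0 rP] := wP e e0.
(* Two real increments below [r / 2] give a complex one of modulus below [r]. *)
exists (r / 2) => [|x' y' xr yr]; first by rewrite divr_gt0.
pose k := (x' - x) +i* (y' - y).
have e1 : vcons (x' +i* y') v = vcons (x +i* y) v + vcons k 0.
  apply/rowP => i; rewrite [RHS]mxE.
  case: (unliftP ord0 i) => [j|] ->; rewrite ?vconsS ?vcons0 ?mxE ?addr0//.
  by apply: complex_ext => /=; rewrite addrC subrK.
have e2 : norm1 (vcons k (0 : 'rV_n)) = normc k.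
  rewrite /norm1 big_ord_recl vcons0 big1 ?addr0// => i _.
  by rewrite vconsS mxE ComplexField.Normc.normc0.
have kle : normc k <= `|x' - x| + `|y' - y| by exact: normc_le_ReIm.
have := rP (vcons k 0); rewrite e2 -e1 big_ord_recl vcons0.
rewrite big1 ?addr0; last by move=> i _; rewrite vconsS mxE mulr0.
have kr : normc k < r by rewrite (le_lt_trans kle)// [r]splitr ltrD.
move=> /(_ kr) h; rewrite (le_trans h)//.
by rewrite ler_wpM2l// ltW.
Qed.

End several_variables.

(** * Shifting all coordinates into the complex domain *)

Section complex_shift.
Context {R : realType}.
Implicit Types (n : nat).

Lemma norm1_lt n (h : 'rV[R[i]]_n) r : 0 < r ->
  (forall i, normc (h 0 i) < r) -> norm1 h < n.+1%:R * r.
Proof.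
move=> r0 hr; apply: (@le_lt_trans _ _ (n%:R * r)).
  rewrite /norm1 (le_trans (ler_sum _ (fun i _ => ltW (hr i))))//.
  by rewrite sumr_const card_ord mulr_natl.
by rewrite ltr_pM2r// ltr_nat.
Qed.

Definition cvec n (x y : 'rV[R]_n) : 'rV[R[i]]_n := \row_i (x 0 i +i* y 0 i).

Lemma cvec_vcons n x y (v w : 'rV[R]_n) :
  cvec (vcons x v) (vcons y w) = vcons (x +i* y) (cvec v w).
Proof.
apply/rowP => i; rewrite mxE.
by case: (unliftP ord0 i) => [j|] ->; rewrite ?vconsS ?vcons0 ?mxE.
Qed.

Lemma hol_ccont n (F : 'rV[R[i]]_n -> R[i]) y : (forall z, hol F z) ->
  ccont (fun x => F (cvec x y)).
Proof.
move=> hF.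
have key (x : 'rV[R]_n) (e : R) : 0 < e -> exists2 r, 0 < r & forall u : 'rV[R]_n,
    (forall i, `|u 0 i - x 0 i| < r) -> normc (F (cvec u y) - F (cvec x y)) < e.
  move=> e0; have [K K0 [r r0 rP]] := hol_lipschitz (hF (cvec x y)).
  have K1 : 0 < K + 1 by rewrite ltr_pwDr.
  pose r' := Num.min r (e / (K + 1)) / n.+1%:R.
  have r'0 : 0 < r' by rewrite divr_gt0// lt_min r0 divr_gt0.
  exists r' => // u ur.
  pose h := cvec (u - x) 0.
  have -> : cvec u y = cvec x y + h.
    by apply/rowP => i; rewrite !mxE; apply: complex_ext => /=; ring.
  have : norm1 h < n.+1%:R * r'.
    by apply: norm1_lt => // i; rewrite !mxE normcR.
  rewrite mulrC divfK ?pnatr_eq0// lt_min => /andP[h1 h2].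
  rewrite ltr_pdivlMr// in h2; rewrite (le_lt_trans (rP _ h1))//.
  by rewrite (le_lt_trans _ h2)// mulrC ler_wpM2l ?norm1_ge0// lerDl.
split; apply/continuous_rV => x e e0; have [r r0 rP] := key x e e0; exists r => // u /rP.
  by apply: le_lt_trans; rewrite (le_trans _ (normRe_le _))// cReD cReN.
by apply: le_lt_trans; rewrite (le_trans _ (normIm_le _))// cImD cImN.
Qed.

(** Induction on the dimension. The bound is required on a whole box of imaginary parts because the
    shift passes through intermediate contours; a slice at [x] obeys it with [C / (1 + x^2)] in
    place of [C]. *)
Lemma integralC_shift n (F : 'rV[R[i]]_n -> R[i]) M C (y : 'rV[R]_n) :
  (forall z, hol F z) ->
  (forall x y : 'rV[R]_n, (forall i, `|y 0 i| <= M) -> normc (F (cvec x y)) <= C / wt x) ->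
  (forall i, `|y 0 i| <= M) ->
  integralC (fun x => F (cvec x y)) = integralC (fun x => F (cvec x 0)).
Proof.
elim: n F C y => [|n IHn] F C y hF FC yM.
  by rewrite (_ : y = 0)//; apply/rowP => -[].
have cd (y' : 'rV[R]_n.+1) : (forall i, `|y' 0 i| <= M) -> cdom (fun x => F (cvec x y')).
  move=> y'M; split; first exact: hol_ccont.
  by exists C => x; exact: FC.
rewrite (vcons_eta y); set b := y 0 ord0; set w := \row_i _.
have bM : `|b| <= M by exact: yM.
have wM i : `|w 0 i| <= M by rewrite mxE.
have M0 : 0 <= M by rewrite (le_trans _ bM).
have consM (b' : R) (w' : 'rV[R]_n) : `|b'| <= M -> (forall i, `|w' 0 i| <= M) ->
    forall i, `|vcons b' w' 0 i| <= M.
  by move=> b'M w'M i; case: (unliftP ord0 i) => [j|] ->; rewrite ?vconsS ?vcons0.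
have zM i : `|(0 : 'rV[R]_n) 0 i| <= M by rewrite mxE normr0.
have v0 : vcons (0 : R) 0 = 0 :> 'rV[R]_n.+1.
  by apply/rowP => i; case: (unliftP ord0 i) => [j|] ->; rewrite ?vconsS ?vcons0 !mxE.
have inner x b' : `|b'| <= M ->
    integralC (fun v => F (vcons (x +i* b') (cvec v w))) =
    integralC (fun v => F (vcons (x +i* b') (cvec v 0))).
  move=> b'M; apply: (IHn (fun z => F (vcons (x +i* b') z)) (C / (1 + x ^+ 2))) => //.
    by move=> z; exact: hol_slice_r.
  move=> v y' y'M; rewrite -cvec_vcons (le_trans (FC _ _ _))//; first exact: consM.
  by rewrite wt_cons invfM mulrA.
(* On this contour the induction hypothesis has removed every imaginary part but the first. *)
transitivity (integralC (fun x => F (cvec x (vcons b 0)))).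
  rewrite integralC_vcons1; last by apply: cd; exact: consM.
  rewrite integralC_vcons1; last by apply: cd; exact: consM.
  congr integralC1; apply/funext => x.
  under eq_integralC do rewrite cvec_vcons; under [RHS]eq_integralC do rewrite cvec_vcons.
  exact: inner.
rewrite integralC_vcons2; last by apply: cd; exact: consM.
rewrite -v0 integralC_vcons2; last by apply: cd; apply: consM => //; rewrite normr0.
apply: eq_integralC => v.
have hs x b' : holomorphic_at (fun x y => F (vcons (x +i* y) (cvec v 0))) x b'.
  exact: hol_slice_l.
have bd x b' : `|b'| <= M ->
    normc (F (vcons (x +i* b') (cvec v 0))) <= (C / wt v) / (1 + x ^+ 2).
  move=> b'M; rewrite -cvec_vcons (le_trans (FC _ _ _))//; first exact: consM.
  by rewrite wt_cons invfM mulrA [C / _ / _]mulrAC.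
transitivity (integralC1 (fun x => F (vcons (x +i* b) (cvec v 0)))).
  by congr integralC1; apply/funext => x; rewrite cvec_vcons.
transitivity (integralC1 (fun x => F (vcons (x +i* 0) (cvec v 0)))); last first.
  by congr integralC1; apply/funext => x; rewrite cvec_vcons.
have [b0|b0] := leP 0 b.
  apply/esym; apply: (holomorphic_shift hs b0) => x y' /andP[y0 y1].
  by apply: bd; rewrite ger0_norm// (le_trans y1)// (le_trans (ler_norm _)).
apply: (holomorphic_shift hs (ltW b0)) => x y' /andP[y0 y1].
by apply: bd; rewrite ler0_norm// (le_trans _ bM)// ler0_norm ?lerN2// ltW.
Qed.

End complex_shift.

(** * Normed-space differentiability against the real-valued formulation *)

Section differentiability.

Lemma norm_rV_le_sum (K : numFieldType) n (h : 'rV[K]_n) :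
  `|h| <= \sum_i `|h 0 i|.
Proof.
have [h0|h0] := eqVneq `|h| 0; first by rewrite h0 sumr_ge0.
have [[i j] ->] : exists i, `|h| = `|h i.1 i.2| by exact: mx_norm_neq0.
by rewrite (ord1 i) (bigD1 j)//= lerDl sumr_ge0.
Qed.

Lemma coord_le_norm (K : numFieldType) n (h : 'rV[K]_n) i : `|h 0 i| <= `|h|.
Proof.
rewrite real_leNgt ?normr_real//; apply/negP => hi.
have : ball (0 : 'rV[K]_n) `|h 0 i| h by rewrite mx_norm_ball /ball_/= sub0r normrN.
by case=> _ /(_ 0 i); rewrite -ball_normE/= mxE sub0r normrN ltxx.
Qed.

Context {R : realType}.

Lemma normC_normc (z : R[i]) : `|z| = (normc z)%:C.
Proof. by []. Qed.

Lemma differentiable_hol n (F : 'rV[R[i]]_n -> R[i]) z :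
  differentiable (F : 'rV[R[i]]_n -> R[i]^o) z -> hol F z.
Proof.
move=> dF.
pose df : {linear 'rV[R[i]]_n -> R[i]^o} := 'd (F : 'rV[R[i]]_n -> R[i]^o) z.
exists (fun i => df (delta_mx 0 i)) => e e0.
have /eqaddoP/(_ e%:C) := diff_locally dF.
rewrite ltcR => /(_ e0) /nbhs_rV[r r0 rP].
(* A positive element of [R[i]] is real, so its real part can serve as radius. *)
have rE : r = (Re r)%:C by rewrite RRe_real// gtr0_real.
exists (Re r) => [|h hr]; first by rewrite -ltcR -rE.
have hi i : `|h 0 i - (0 : 'rV[R[i]]_n) 0 i| < r.
  by rewrite mxE subr0 rE normC_normc ltcR (le_lt_trans (normc_le_norm1 _ _)).
have dfE : df h = \sum_i df (delta_mx 0 i) * h 0 i.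
  rewrite {1}[h]row_sum_delta linear_sum; apply: eq_bigr => i _.
  by rewrite linearZ mulrC.
have := rP h hi; rewrite -[(_ - _) h]/(F (h + z) - (F z + df h)).
rewrite opprD addrA [h + z]addrC dfE normC_normc => hP.
rewrite -lecR rmorphM/= (le_trans hP)//; apply: ler_wpM2l.
  by rewrite lecR ltW.
apply: (le_trans (norm_rV_le_sum _)); rewrite /norm1 rmorph_sum/=.
by apply: ler_sum => i _; rewrite normC_normc.
Qed.

Lemma hol_entire n (F : 'rV[R[i]]_n -> R[i]) :
  (forall z, hol F z) -> entire F.
Proof.
move=> hF z; have [w wP] := hF z.
pose V : normedModType R[i] := 'rV[R[i]]_n.
pose L (h : 'rV[R[i]]_n) : R[i]^o := \sum_i w i * h 0 i.
have Llin : linear L.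
  move=> a u v; rewrite /L scaler_sumr -big_split /=; apply: eq_bigr => i _.
  by rewrite !mxE mulrDr; congr (_ + _); exact: mulrCA.
pose LM := GRing.isLinear.Build _ _ _ _ _ Llin.
pose Ll : {linear V -> R[i]^o} := HB.pack L LM.
have cL : continuous (Ll : V -> R[i]^o).
  move=> u; apply: cvg_big => [||i _]; [exact: add_continuous|exact: nbhs_filter|].
  apply: cvgMl_tmp; first exact: nbhs_filter.
  exact: coord_continuous.
have dL : (F : V -> R[i]^o) \o shift z = cst (F z : R[i]^o) + Ll +o_ 0 id.
  apply/eqaddoP => e e0.
  have eE : e = (Re e)%:C by rewrite RRe_real// gtr0_real.
  have e0' : 0 < Re e by rewrite -ltcR -eE.
  (* [norm1 h] is at most [n] times the max norm, so error and radius are both divided; [n.+1] also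
     covers dimension 0. *)
  have en : 0 < Re e / n.+1%:R by rewrite divr_gt0.
  have [r r0 rP] := wP _ en.
  apply/nbhs_rV; exists (r / n.+1%:R)%:C => [|h hr]; first by rewrite ltcR divr_gt0.
  have : norm1 h < n.+1%:R * (r / n.+1%:R).
    apply: norm1_lt => [|i]; first by rewrite divr_gt0.
    by have := hr i; rewrite mxE subr0 normC_normc ltcR.
  rewrite mulrC divfK ?pnatr_eq0// => /rP hP.
  rewrite -[(_ - _) h]/(F (h + z) - (F z + L h)) opprD addrA [h + z]addrC normC_normc.
  apply: (@le_trans _ _ (Re e / n.+1%:R * norm1 h)%:C); first by rewrite lecR.
  rewrite eE rmorphM/= rmorphM/= -mulrA; apply: ler_wpM2l; first by rewrite lecR ltW.
  rewrite fmorphV rmorph_nat mulrC ler_pdivrMr ?ltr0n// /norm1 rmorph_sum/=.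
  apply: (@le_trans _ _ (\sum_(i < n) `|h|)).
    by apply: ler_sum => i _; rewrite -normC_normc coord_le_norm.
  by rewrite sumr_const card_ord mulr_natr ler_wpMn2l.
by apply/diff_locallyP; rewrite (diff_unique cL dL).
Qed.

End differentiability.

(** * The inverse transform and its support *)

Section inverse_transform.
Context {R : realType}.
Implicit Types (n : nat).

Lemma dotC n (x y : 'rV[R]_n) : dot x y = dot y x.
Proof. by apply: eq_bigr => i _; rewrite mulrC. Qed.

Lemma dotDr n (x y z : 'rV[R]_n) : dot x (y + z) = dot x y + dot x z.
Proof. by rewrite /dot -big_split /=; apply: eq_bigr => i _; rewrite mxE mulrDr. Qed.

Lemma dotNr n (x y : 'rV[R]_n) : dot x (- y) = - dot x y.
Proof. by rewrite /dot -sumrN; apply: eq_bigr => i _; rewrite mxE mulrN. Qed.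

Lemma dotZr n (x y : 'rV[R]_n) t : dot x (t *: y) = t * dot x y.
Proof. by rewrite /dot mulr_sumr; apply: eq_bigr => i _; rewrite mxE mulrCA. Qed.

Lemma dotDl n (x y z : 'rV[R]_n) : dot (y + z) x = dot y x + dot z x.
Proof. by rewrite !(dotC _ x) dotDr. Qed.

Lemma dotNl n (x y : 'rV[R]_n) : dot (- y) x = - dot y x.
Proof. by rewrite !(dotC _ x) dotNr. Qed.

Lemma dotZl n (x y : 'rV[R]_n) t : dot (t *: y) x = t * dot y x.
Proof. by rewrite !(dotC _ x) dotZr. Qed.

Lemma dot0l n (x : 'rV[R]_n) : dot 0 x = 0.
Proof. by rewrite /dot big1// => i _; rewrite mxE mul0r. Qed.

Lemma dot_delta n (x : 'rV[R]_n) i : dot x (delta_mx 0 i) = x 0 i.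
Proof.
rewrite /dot (bigD1 i)//= mxE !eqxx mulr1 big1 ?addr0// => j ji.
by rewrite mxE eqxx /= (negbTE ji) mulr0.
Qed.

(** The form in which the remainder estimates for the exponential deliver directional derivatives,
    without computing a limit each time. *)
Lemma is_derive_quadratic n (k : 'rV[R]_n -> R) (x v : 'rV[R]_n) (L K : R) :
  (forall t : R, `|t| <= 1 -> `|k (x + t *: v) - k x - t * L| <= K * t ^+ 2) ->
  is_derive x v k L.
Proof.
move=> kL.
have kc : (fun h : R => h^-1 *: ((k \o shift x) (h *: v) - k x)) @ 0^' --> L.
  apply/cvgrPdist_le => e e0; near=> h.
  have h0 : h != 0 by near: h; exact: nbhs_dnbhs_neq.
  rewrite /= -normrN opprB [h *: v + x]addrC.
  have -> : h^-1 *: (k (x + h *: v) - k x) - L = h^-1 * (k (x + h *: v) - k x - h * L).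
    by rewrite mulrBr mulrA mulVf// mul1r.
  rewrite normrM normfV mulrC ler_pdivrMr ?normr_gt0//.
  have h1 : `|h| <= 1 by near: h; exact: dnbhs0_le.
  rewrite (le_trans (kL h h1))// -[h ^+ 2]real_normK ?num_real// expr2 mulrA.
  rewrite ler_wpM2r//.
  have : `|h| <= e / (`|K| + 1).
    near: h; apply: dnbhs0_le; first by rewrite divr_gt0// ltr_pwDr.
  rewrite ler_pdivlMr ?ltr_pwDr// => he.
  apply: le_trans he; rewrite mulrC ler_wpM2l//.
  by rewrite (le_trans (ler_norm _))// lerDl.
apply: DeriveDef; first by apply/cvg_ex; exists L.
exact: (cvg_lim _ kc).
Unshelve. all: by end_near. Qed.

Lemma wt_coord_sqr n (x : 'rV[R]_n) i : 1 + x 0 i ^+ 2 <= wt x.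
Proof.
rewrite /wt (bigD1 i)//= ler_peMr ?addr_ge0 ?sqr_ge0//.
elim/big_ind: _ => // [a b a1 b1|j _]; last by rewrite lerDl sqr_ge0.
by rewrite -[1]mulr1 ler_pM.
Qed.

Lemma wt_coord n (x : 'rV[R]_n) i : `|x 0 i| <= wt x.
Proof.
apply: le_trans (wt_coord_sqr x i).
rewrite -[x 0 i ^+ 2]real_normK ?num_real//.
by have := sqr_ge0 (`|x 0 i| - 1); rewrite sqrrB; have := normr_ge0 (x 0 i); lra.
Qed.

(** Powers of [wt] stand in for powers of [1 + |x|]: [wt] dominates every coordinate and its inverse
    is integrable, so spending one power pays for either. *)
Definition rapid n (p : 'rV[R]_n -> R[i]) : Prop :=
  ccont p /\ forall N, exists C, forall x, normc (p x) <= C / wt x ^+ N.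

Lemma rapid_cdom n (p : 'rV[R]_n -> R[i]) : rapid p -> cdom p.
Proof. by move=> [cp /(_ 1%N)[C hC]]; split=> //; exists C. Qed.

Lemma rapidZ n c (p : 'rV[R]_n -> R[i]) : rapid p -> rapid (fun x => c * p x).
Proof.
move=> [cp hp]; split; first by apply: ccontM => //; exact: ccont_cst.
move=> N; have [C hC] := hp N; exists (normc c * C) => x.
by rewrite ComplexField.Normc.normcM -mulrA ler_wpM2l ?normc_ge0.
Qed.

Lemma rapid_coord n i (p : 'rV[R]_n -> R[i]) : rapid p ->
  rapid (fun x => ('i%C * (x 0 i)%:C) * p x).
Proof.
move=> [cp hp]; split.
  apply: ccontM => //; apply: ccontM; first exact: ccont_cst.
  by apply: ccont_realC; exact: coord_continuous.
move=> N; have [C hC] := hp N.+1; exists C => x.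
rewrite !ComplexField.Normc.normcM normcR.
have -> : normc ('i%C : R[i]) = 1 by rewrite /= expr0n add0r expr1n sqrtr1.
have w0 := wt_gt0 x; rewrite mul1r.
apply: (le_trans (ler_pM (normr_ge0 _) (normc_ge0 _) (wt_coord x i) (hC x))).
by rewrite exprS invfM mulrCA mulrA -mulrA [wt x * _]mulrA divff ?lt0r_neq0// mul1r.
Qed.

(** The inverse Fourier transform without its normalising factor, which is later put into [p]. *)
Definition ift n (p : 'rV[R]_n -> R[i]) (x : 'rV[R]_n) : R[i] :=
  integralC (fun y => p y * cexp ('i%C * (dot y x)%:C)).

Lemma normc_cexp_im (t : R) : normc (cexp ('i%C * t%:C)) = 1.
Proof. by rewrite normc_cexp mulic_real /= expR0. Qed.

Lemma ccont_cexp_dot n (x : 'rV[R]_n) : ccont (fun y => cexp ('i%C * (dot y x)%:C)).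
Proof.
apply: ccont_cexp; apply: ccontM; first exact: ccont_cst.
by apply: ccont_realC; exact: continuous_dot.
Qed.

Lemma ift_cdom n (p : 'rV[R]_n -> R[i]) x : cdom p ->
  cdom (fun y => p y * cexp ('i%C * (dot y x)%:C)).
Proof.
move=> [cp [C hC]]; split; first by apply: ccontM => //; exact: ccont_cexp_dot.
by exists C => y; rewrite ComplexField.Normc.normcM normc_cexp_im mulr1.
Qed.

(** Decay of order 2 is spent: one power of [wt] absorbs the coordinate of [y] produced by the
    exponential, the other makes the rest integrable. *)
Lemma ift_lipschitz n (p : 'rV[R]_n -> R[i]) : rapid p ->
  exists2 K, 0 <= K & forall x y, normc (ift p y - ift p x) <= K * \sum_i `|y 0 i - x 0 i|.
Proof.
move=> rp; have [cp /(_ 2%N)[C hC]] := rp; have dp := rapid_cdom rp.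
have C0 : 0 <= C.
  have := hC 0; rewrite ler_pdivlMr ?exprn_gt0 ?wt_gt0//.
  by apply: le_trans; rewrite mulr_ge0 ?normc_ge0// exprn_ge0// ltW// wt_gt0.
exists (2 * (C * 2 * rint (fun y : 'rV[R]_n => (wt y)^-1))) => [|x y].
  rewrite !mulr_ge0//; apply: Rintegral_ge0 => t _; rewrite invr_ge0 ltW// wt_gt0//.
set S := \sum_i _.
have S0 : 0 <= S by rewrite sumr_ge0.
rewrite /ift -integralCB; [|exact/cdom_cintegrable/ift_cdom..].
have rw : rintegrable (fun v : 'rV[R]_n => C * 2 * S * (wt v)^-1).
  exact/rintegrableZ/rintegrable_wtV.
have -> : 2 * (C * 2 * rint (fun y : 'rV[R]_n => (wt y)^-1)) * S =
  2 * rint (fun v : 'rV[R]_n => C * 2 * S * (wt v)^-1).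
  by rewrite rintZ; [ring|exact: rintegrable_wtV].
apply: normc_integralC_le => //.
  by apply: cintegrableB; exact/cdom_cintegrable/ift_cdom.
move=> v; have w0 := wt_gt0 v.
have -> : dot v y = dot v x + dot v (y - x) by rewrite -dotDr addrC subrK.
rewrite rmorphD/= mulrDr cexpD mulrA -{2}[p v * cexp _]mulr1 -mulrBr.
rewrite 2!ComplexField.Normc.normcM normc_cexp_im mulr1.
have dS : `|dot v (y - x)| <= wt v * S.
  rewrite (le_trans (ler_norm_sum _ _ _))// /S mulr_sumr ler_sum// => i _.
  by rewrite normrM !mxE ler_wpM2r// wt_coord.
apply: (le_trans (ler_pM (normc_ge0 _) (normc_ge0 _) (hC v) (normc_cexp_imB1_le _))).
apply: (@le_trans _ _ (C / wt v ^+ 2 * (2 * (wt v * S)))).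
  by rewrite ler_wpM2l ?ler_pM2l// divr_ge0// exprn_ge0// ltW.
move: (wt v) w0 S {S0 rw dS} => w w0 S.
by rewrite le_eqVlt; apply/orP; left; apply/eqP; field; rewrite lt0r_neq0.
Qed.

Lemma continuous_ift n (p : 'rV[R]_n -> R[i]) : rapid p ->
  continuous (fun x => Re (ift p x)).
Proof.
move=> rp; have [K K0 hK] := ift_lipschitz rp.
apply/continuous_rV => x e e0.
have K1 : 0 < K + 1 by rewrite ltr_pwDr.
exists (e / (K + 1) / n.+1%:R) => [|y yx]; first by rewrite !divr_gt0.
rewrite -cReN -cReD (le_lt_trans (normRe_le _))// (le_lt_trans (hK x y))//.
have : \sum_i `|y 0 i - x 0 i| < e / (K + 1).
  rewrite (@le_lt_trans _ _ (n%:R * (e / (K + 1) / n.+1%:R)))//.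
    rewrite (le_trans (ler_sum _ (fun i _ => ltW (yx i))))//.
    by rewrite sumr_const card_ord mulr_natl.
  by rewrite mulrC mulrAC -mulrA gtr_pMr ?divr_gt0// ltr_pdivrMr// mul1r ltr_nat.
rewrite ltr_pdivlMr// => h; apply: le_lt_trans h; rewrite mulrC ler_wpM2l ?lerDl//.
exact: sumr_ge0.
Qed.

(** Here the order is 3: the quadratic remainder costs two powers of [wt], integrability the
    third. *)
Lemma is_derive_ift n (p : 'rV[R]_n -> R[i]) x i : rapid p ->
  is_derive x (delta_mx 0 i) (fun x => Re (ift p x))
    (Re (ift (fun y => ('i%C * (y 0 i)%:C) * p y) x)).
Proof.
move=> rp; have [cp /(_ 3%N)[C hC]] := rp; have dp := rapid_cdom rp.
have dpi := rapid_cdom (rapid_coord i rp).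
have C0 : 0 <= C.
  have := hC 0; rewrite ler_pdivlMr ?exprn_gt0 ?wt_gt0//.
  by apply: le_trans; rewrite mulr_ge0 ?normc_ge0// exprn_ge0// ltW// wt_gt0.
apply: (@is_derive_quadratic _ _ _ _ _
  (2 * (C * 2 * rint (fun y : 'rV[R]_n => (wt y)^-1)))) => t _.
rewrite -cReN -cReD.
have -> : t * Re (ift (fun y => ('i%C * (y 0 i)%:C) * p y) x) =
    Re (t%:C * ift (fun y => ('i%C * (y 0 i)%:C) * p y) x).
  by rewrite cReM /= mul0r subr0.
rewrite -cReN -cReD (le_trans (normRe_le _))//.
have i0 z : cintegrable (fun y => p y * cexp ('i%C * (dot y z)%:C)).
  exact/cdom_cintegrable/ift_cdom.
have i1 : cintegrable (fun y => ('i%C * (y 0 i)%:C * p y) * cexp ('i%C * (dot y x)%:C)).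
  exact/cdom_cintegrable/ift_cdom.
rewrite /ift -integralCZ// -!integralCB//; last 2 first.
- exact: cintegrableB.
- exact: cintegrableZ.
have rw : rintegrable (fun v : 'rV[R]_n => C * 2 * t ^+ 2 * (wt v)^-1).
  exact/rintegrableZ/rintegrable_wtV.
have -> : 2 * (C * 2 * rint (fun y : 'rV[R]_n => (wt y)^-1)) * t ^+ 2 =
  2 * rint (fun v : 'rV[R]_n => C * 2 * t ^+ 2 * (wt v)^-1).
  by rewrite rintZ; [ring|exact: rintegrable_wtV].
apply: normc_integralC_le => //.
  by apply: cintegrableB; [exact: cintegrableB|exact: cintegrableZ].
move=> v; have w0 := wt_gt0 v.
rewrite dotDr dotZr dot_delta rmorphD/= mulrDr cexpD.
set E := cexp ('i%C * (dot v x)%:C); set s := t * v 0 i.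
have -> : p v * (E * cexp ('i%C * s%:C)) - p v * E - t%:C * ('i%C * (v 0 i)%:C * p v * E) =
   p v * E * (cexp ('i%C * s%:C) - 1 - 'i%C * s%:C).
  by rewrite /s rmorphM/=; ring.
rewrite 2!ComplexField.Normc.normcM normc_cexp_im mulr1.
apply: (le_trans (ler_pM (normc_ge0 _) (normc_ge0 _) (hC v) (normc_cexp_imB1B_le _))).
apply: (@le_trans _ _ (C / wt v ^+ 3 * (2 * (t ^+ 2 * wt v ^+ 2)))).
  apply: ler_wpM2l; first by rewrite divr_ge0// exprn_ge0// ltW.
  rewrite ler_pM2l// /s exprMn ler_wpM2l ?sqr_ge0//.
  rewrite -[v 0 i ^+ 2]real_normK ?num_real// lerXn2r ?wt_coord// nnegrE//.
  exact: ltW.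
move: (wt v) w0 => w w0.
by rewrite le_eqVlt; apply/orP; left; apply/eqP; field; rewrite lt0r_neq0.
Qed.

(** Rapid decrease survives multiplication by [i y_i], so every iterated partial derivative is again
    the real part of some [ift q]. *)
Lemma smooth_ift n (p : 'rV[R]_n -> R[i]) : rapid p -> smooth (fun x => Re (ift p x)).
Proof.
move=> rp.
have key s : exists2 q, rapid q & partials s (fun x => Re (ift p x)) = fun x => Re (ift q x).
  elim: s => [|i s [q rq sq]]; first by exists p.
  exists (fun y : 'rV[R]_n => ('i%C * (y 0 i)%:C) * q y); first exact: rapid_coord.
  apply/funext => x; rewrite /= sq; have := is_derive_ift x i rq.
  by case.
move=> s; have [q rq ->] := key s; split; first exact: continuous_ift.
by move=> x i; have := is_derive_ift x i rq; case.
Qed.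

Lemma smoothC_ift n (p : 'rV[R]_n -> R[i]) : rapid p -> smoothC (ift p).
Proof.
move=> rp; split; first exact: smooth_ift.
(* An imaginary part is the real part after multiplication by [- i], and that factor can be absorbed
   into [p]. *)
rewrite (_ : (fun x => _) = fun x => Re (ift (fun y => - 'i%C * p y) x)).
  by apply: smooth_ift; exact: rapidZ.
apply/funext => x; rewrite /ift.
transitivity (Re (- 'i%C * ift p x)).
  by rewrite cReM /= oppr0 mul0r mulN1r opprK add0r.
rewrite /ift -integralCZ; last by apply/cdom_cintegrable/ift_cdom/rapid_cdom.
by congr Re; apply: eq_integralC => y; rewrite mulrA.
Qed.

End inverse_transform.

(** The character [exp (i x.z)] for real [x] and complex [z]. *)
Definition phase {R : realType} n (x : 'rV[R]_n) (z : 'rV[R[i]]_n) : R[i] :=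
  cexp (\sum_i ('i%C * (x 0 i)%:C) * z 0 i).

Lemma phaseE (R : realType) n (x y v : 'rV[R]_n) :
  phase x (cvec v y) = cexp ((- dot y x)%:C + 'i%C * (dot v x)%:C).
Proof.
congr cexp; rewrite /dot -sumrN !rmorph_sum mulr_sumr -big_split /=.
by apply: eq_bigr => i _; rewrite mxE; apply: complex_ext; rewrite /=; ring.
Qed.

(** * Separation from a convex set, and vanishing outside it *)

Section support.
Context {R : realType} (n : nat) (A : set 'rV[R]_n).
Hypotheses (A0 : A !=set0) (cA : compact A).

Lemma supporting_attained (x : 'rV[R]_n) :
  exists2 a, A a & supporting A x = dot a x.
Proof. by have [] := supporting_max x A0 cA. Qed.

Lemma dot_le_supporting (a x : 'rV[R]_n) : A a -> dot a x <= supporting A x.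
Proof. by have [_] := supporting_max x A0 cA; apply. Qed.

Lemma compact_coord_bounded : exists2 L, 0 <= L & forall a, A a -> forall i, `|a 0 i| <= L.
Proof.
have [M [_ MP]] := compact_bounded cA.
exists (`|M| + 1) => [|a /MP aM i]; first by rewrite addr_ge0.
apply: (le_trans (coord_le_norm a i)); apply: aM.
by rewrite (le_lt_trans (ler_norm _))// ltrDl.
Qed.

Lemma supportingZ t (x : 'rV[R]_n) : 0 <= t ->
  supporting A (t *: x) = t * supporting A x.
Proof.
move=> t0; apply/eqP; rewrite eq_le; apply/andP; split.
  have [a Aa ->] := supporting_attained (t *: x).
  by rewrite dotZr ler_wpM2l// dot_le_supporting.
have [a Aa ->] := supporting_attained x.
by rewrite -dotZr dot_le_supporting.
Qed.

Lemma supporting_bounded M : exists B, forall y : 'rV[R]_n,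
  (forall i, `|y 0 i| <= M) -> supporting A y <= B.
Proof.
have [L L0 LP] := compact_coord_bounded.
exists (\sum_(i < n) L * M) => y yM.
have [a Aa ->] := supporting_attained y.
apply: (le_trans (ler_norm _)); apply: (le_trans (ler_norm_sum _ _ _)).
by apply: ler_sum => i _; rewrite normrM ler_pM// LP.
Qed.

(** The functional is [u = x - a0], where [a0] is a point of [A] nearest to [x]. By convexity no [a]
    in [A] has [(a - a0).u > 0], since moving slightly from [a0] towards [a] would come closer to
    [x]. *)
Lemma separating_functional (x : 'rV[R]_n) :
  convex_set (A : set (convex_lmodType 'rV[R]_n)) ->
  ~ A x -> exists y, supporting A y < dot x y.
Proof.
move=> convA nAx; pose f (a : 'rV[R]_n) := dot (x - a) (x - a).
have cf : continuous f.
  rewrite (_ : f = fun a => dot x x - (dot a x + dot a x) + dot a a).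
    apply: rV_continuousD.
      apply: rV_continuousD; first exact: cst_continuous.
      by apply/rV_continuousN/rV_continuousD; exact: continuous_dot.
    have cc i : continuous (fun a : 'rV[R]_n => a 0 i) by exact: coord_continuous.
    move=> a; apply: cvg_big => [||i _]; [exact: add_continuous|exact: nbhs_filter|].
    exact: (rV_continuousM (cc i) (cc i)).
  apply/funext => a; rewrite /f !dotDl !dotDr !dotNl !dotNr (dotC x a); ring.
have [a0 /set_mem Aa0 a0min] := compact_EVT_min A0 cA (continuous_subspaceT cf).
pose u := x - a0.
have uu : 0 < dot u u.
  rewrite lt_def; apply/andP; split; last by apply: sumr_ge0 => i _; rewrite -expr2 sqr_ge0.
  apply/eqP => u0; apply: nAx; rewrite (_ : x = a0)//; apply/rowP => i.
  have /eqP := u0; rewrite psumr_eq0; last by move=> j _; rewrite -expr2 sqr_ge0.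
  move=> /allP/(_ i); rewrite mem_index_enum => /(_ isT).
  by rewrite mulf_eq0 orbb !mxE subr_eq0 => /eqP.
exists u; have [a Aa ->] := supporting_attained u.
suff : dot (a - a0) u <= 0.
  rewrite dotDl dotNl => h; apply: (@le_lt_trans _ _ (dot a0 u)); first by lra.
  by rewrite -subr_gt0 -dotNl -dotDl.
rewrite leNgt; apply/negP; set w := a - a0 => wu.
have ww : 0 <= dot w w by apply: sumr_ge0 => i _; rewrite -expr2 sqr_ge0.
(* Small enough that [t^2 * w.w] stays below [2 * t * w.u], and at most 1 so that [a0 + t w] lies on
   the segment from [a0] to [a]. *)
pose t := Num.min 1 (dot w u / (dot w w + 1)).
have t0 : 0 < t by rewrite lt_min ltr01 divr_gt0// ltr_pwDr.
have t1 : t <= 1 by rewrite ge_min lexx.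
have tw : t * (dot w w + 1) <= dot w u.
  by rewrite -ler_pdivlMr ?ltr_pwDr// ge_min lexx orbT.
have Ap : A (a0 + t *: w).
  have := convA a a0 (Itv01 (ltW t0) t1) (mem_set Aa) (mem_set Aa0).
  move=> /set_mem; rewrite -[conv _ _ _]/((t *: a + (1 - t) *: a0) : 'rV[R]_n).
  by congr A; rewrite /w scalerBl scale1r scalerBr addrCA.
have := a0min _ (mem_set Ap); rewrite /f.
have -> : x - (a0 + t *: w) = u - t *: w by rewrite opprD addrA.
have e (p q : 'rV[R]_n) : dot (p - t *: q) (p - t *: q) =
    dot p p - 2 * t * dot q p + t * (t * dot q q).
  by rewrite !dotDl !dotDr !dotNl !dotNr !dotZl !dotZr (dotC p q); ring.
rewrite -/u e.
have : t * (t * (dot w w + 1)) <= t * dot w u by rewrite ler_pM2l.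
have := mulr_gt0 t0 wu; have := mulr_gt0 t0 t0; lra.
Qed.

(** Each of the [n] factors is at most [(1 + |z|)^2]; this converts decay in [|z|] into decay in
    [wt]. *)
Lemma wt_le_normCd (x y : 'rV[R]_n) : wt x <= (1 + normCd (cvec x y)) ^+ (2 * n).
Proof.
set N := normCd _.
have N0 : 0 <= N by exact: sqrtr_ge0.
have xN i : `|x 0 i| <= N.
  rewrite -(@ler_pXn2r _ 2) ?nnegrE// sqr_sqrtr; last first.
    by apply: sumr_ge0 => j _; rewrite sqr_ge0.
  rewrite (bigD1 i)//= ler_wpDr//; first by apply: sumr_ge0 => j _; rewrite sqr_ge0.
  by rewrite lerXn2r ?nnegrE ?normc_ge0// (le_trans _ (normRe_le _))// mxE.
rewrite exprM -{2}[n]card_ord -prodr_const; apply: ler_prod => i _.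
rewrite addr_ge0 ?sqr_ge0//=.
rewrite sqrrD expr1n mul1r -[x 0 i ^+ 2]real_normK ?num_real//.
rewrite -addrA lerD2l ler_wpDl ?mulrn_wge0// lerXn2r ?nnegrE//.
Qed.

Context (F : 'rV[R[i]]_n -> R[i]).
Hypothesis hF : rapidly_decreasing_entire A F.

Lemma entire_hol z : hol F z.
Proof. by apply: differentiable_hol; case: hF => + _; apply. Qed.

Lemma growth N : exists2 C, 0 < C & forall x y : 'rV[R]_n,
  normc (F (cvec x y)) <= C * expR (supporting A y) / wt x ^+ N.
Proof.
(* [wt x ^+ N] is at most [1 + normCd z] to the power [2 * n * N]. *)
have [_ /(_ (2 * n * N)%N)[C C0 hC]] := hF; exists C => // x y.
have yE : map_mx (@complex.Im R) (cvec x y) = y by apply/rowP => i; rewrite !mxE.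
have := hC (cvec x y); rewrite yE => h; rewrite (le_trans h)//.
rewrite mulrAC; apply: ler_wpM2l; first by rewrite mulr_ge0 ?expR_ge0// ltW.
have w0 : 0 < wt x ^+ N by rewrite exprn_gt0// wt_gt0.
rewrite lef_pV2 ?posrE//; last by rewrite exprn_gt0// ltr_pwDl// sqrtr_ge0.
rewrite exprM lerXn2r ?nnegrE ?wt_le_normCd//; first by rewrite ltW// wt_gt0.
by rewrite exprn_ge0// addr_ge0// sqrtr_ge0.
Qed.

Lemma rapid_restriction : rapid (fun x => F (cvec x 0)).
Proof.
split; first by apply: hol_ccont; exact: entire_hol.
by move=> N; have [C _ hC] := growth N; exists (C * expR (supporting A 0)) => x.
Qed.

(** What matters is that [K] does not depend on [y], which is about to be scaled up. The whole
    dependence on [y] sits in the exponential, one part coming from the growth of [F] and the other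
    from the character on the shifted contour. *)
Lemma ift_restriction_bound : exists2 K, 0 <= K & forall x y : 'rV[R]_n,
  normc (ift (fun v => F (cvec v 0)) x) <= K * expR (supporting A y - dot y x).
Proof.
have [C C0 hC] := growth 1.
pose I := rint (fun v : 'rV[R]_n => (wt v)^-1).
have I0 : 0 <= I by apply: Rintegral_ge0 => t _; rewrite invr_ge0 ltW// wt_gt0.
exists (2 * (C * I)) => [|x y]; first by rewrite !mulr_ge0// ltW.
pose G z := F z * phase x z.
have hG z : hol G z by apply: holM; [exact: entire_hol|exact: hol_cexp].
have Gbound v w : normc (G (cvec v w)) <= C * expR (supporting A w - dot w x) / wt v.
  rewrite ComplexField.Normc.normcM phaseE normc_cexp cReD mulic_real /= addr0.
  rewrite expRD mulrA [leRHS]mulrAC ler_wpM2r ?expR_ge0//; exact: hC.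
have [M M0 yM] : exists2 M, 0 <= M & forall i, `|y 0 i| <= M.
  exists (\sum_i `|y 0 i|) => [|i]; first exact: sumr_ge0.
  by rewrite (bigD1 i)//= lerDl sumr_ge0.
have [B BP] := supporting_bounded M.
have -> : ift (fun v => F (cvec v 0)) x = integralC (fun v => G (cvec v 0)).
  by apply: eq_integralC => v; rewrite /G phaseE dot0l oppr0 add0r.
(* This crude constant, uniform over a box that contains [y], only licenses the shift; the final
   estimate uses [Gbound] at [y] itself. *)
rewrite -(@integralC_shift _ n G M (C * expR (B + \sum_i M * `|x 0 i|)) y)//; last first.
  move=> v w wM; rewrite (le_trans (Gbound v w))// ler_wpM2r//; first by rewrite invr_ge0 ltW// wt_gt0.
  rewrite ler_pM2l// ler_expR lerD ?BP// -dotNl (le_trans (ler_norm _))//.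
  rewrite (le_trans (ler_norm_sum _ _ _))// ler_sum// => i _.
  by rewrite normrM mxE normrN ler_wpM2r.
have rw : rintegrable (fun v : 'rV[R]_n => C * expR (supporting A y - dot y x) * (wt v)^-1).
  exact/rintegrableZ/rintegrable_wtV.
have -> : 2 * (C * I) * expR (supporting A y - dot y x) =
    2 * rint (fun v : 'rV[R]_n => C * expR (supporting A y - dot y x) * (wt v)^-1).
  by rewrite rintZ; [rewrite /I; ring|exact: rintegrable_wtV].
apply: normc_integralC_le => //.
apply: cdom_cintegrable; split; first exact: hol_ccont.
by exists (C * expR (supporting A y - dot y x)).
Qed.

Lemma ift_restriction_eq0 (x : 'rV[R]_n) :
  convex_set (A : set (convex_lmodType 'rV[R]_n)) ->
  ~ A x -> ift (fun v => F (cvec v 0)) x = 0.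
Proof.
move=> convA /(separating_functional convA)[y yx].
have [K K0 hK] := ift_restriction_bound.
apply: ComplexField.Normc.eq0_normc; apply/eqP; rewrite eq_le normc_ge0 andbT.
rewrite leNgt; apply/negP; set N := normc _ => N0.
pose s := dot x y - supporting A y.
have s0 : 0 < s by rewrite subr_gt0.
(* A finite [t] is enough: since [exp (t s) >= 1 + t s], the choice [t = K / (N s)] gives
   [N + K <= K]. *)
have bound t : 0 <= t -> N * (1 + t * s) <= K.
  move=> t0; have := hK x (t *: y); rewrite supportingZ// dotZl -mulrBr.
  rewrite (dotC y x) -[_ - dot x y]opprB -/s mulrN expRN => h.
  rewrite ler_pdivlMr ?expR_gt0// in h; apply: le_trans h.
  by rewrite ler_pM2l// expR_ge1Dx.
have t0 : 0 <= K / (N * s) by rewrite divr_ge0// ltW// mulr_gt0.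
have := bound _ t0; rewrite (_ : N * _ = N + K); first by lra.
by field; rewrite !lt0r_neq0.
Qed.

End support.

(** * Fourier inversion *)

Section poisson_kernel.
Context {R : realType}.
Notation mu := (@lebesgue_measure R).
Implicit Types (e u : R).

Lemma is_derive_continuous (F f : R -> R) :
  (forall x : R, is_derive x (1 : R) F (f x)) -> continuous F.
Proof.
by move=> dF x; apply/differentiable_continuous/derivable1_diffP/ex_derive.
Qed.

Lemma iseg_FTC (f F : R -> R) (a b : R) : a <= b -> continuous f ->
  (forall x : R, is_derive x (1 : R) F (f x)) -> iseg f a b = F b - F a.
Proof.
rewrite le_eqVlt => /predU1P[->|ab] cf dF.
  by rewrite /iseg set_itv1 Rintegral_set1 subrr.
have cF := is_derive_continuous dF.
rewrite /iseg /Rintegral (continuous_FTC2 ab (continuous_subspaceT cf) (F := F))//.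
  split; first by move=> x _; exact: ex_derive.
    by apply: cvg_at_right_filter; exact: cF.
  by apply: cvg_at_left_filter; exact: cF.
by move=> x _; rewrite derive1E; exact: derive_val.
Qed.

Lemma continuous_affine (a b : R) : continuous (fun x : R => a * x + b).
Proof.
move=> x; apply: (cvgD (f := fun x => a * x) (g := cst b)); last exact: cvg_cst.
by apply: cvgMl_tmp; exact: cvg_id.
Qed.

Lemma continuous_decay e : continuous (fun x : R => expR (- e * `|x|)).
Proof.
move=> x; apply: (continuous_comp (f := fun x => - e * `|x|) (g := expR)).
  by apply: cvgMl_tmp; exact: norm_continuous.
exact: continuous_expR.
Qed.

(** Follows from [exp u >= 1 + u^2 / 2] at [u = e |x|]: the product of [1 + 2 / e^2] and
    [1 + e^2 x^2 / 2] is at least [1 + x^2]. *)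
Lemma decay_le e (x : R) : 0 < e ->
  expR (- e * `|x|) <= (1 + 2 / e ^+ 2) / (1 + x ^+ 2).
Proof.
move=> e0; have e2 : 0 < e ^+ 2 by rewrite exprn_gt0.
have x2 : 0 < 1 + x ^+ 2 by rewrite ltr_pwDl// sqr_ge0.
rewrite mulNr expRN -[_ / (1 + _)]invrK lef_pV2 ?posrE ?expR_gt0//; last first.
  by rewrite invr_gt0 divr_gt0// ltr_pwDr// divr_gt0.
have ex0 : 0 <= e * `|x| by apply: mulr_ge0 => //; exact: ltW.
apply: le_trans (expR_ge1Dxn 1 ex0); rewrite (_ : 2`! = 2)%N// exprMn real_normK ?num_real//.
rewrite invf_div ler_pdivrMr; last by rewrite ltr_pwDr// divr_gt0.
rewrite (_ : (1 + _) * _ = 1 + x ^+ 2 + (2 / e ^+ 2 + e ^+ 2 * x ^+ 2 / 2)); last first.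
  by field; rewrite lt0r_neq0.
have h1 : 0 <= 2 / e ^+ 2 by apply: divr_ge0 => //; exact: ltW.
have h2 : 0 <= e ^+ 2 * x ^+ 2 / 2 by rewrite divr_ge0// mulr_ge0// sqr_ge0.
by rewrite lerDl addr_ge0.
Qed.

(** The phase [p] covers both parts of [exp (i u x)] at once: 0 gives the cosine and [- pi / 2] the
    sine. *)
Definition wave e u p (x : R) : R := expR (- e * `|x|) * cos (u * x + p).

Lemma continuous_wave e u p : continuous (wave e u p).
Proof.
move=> x; apply: (cvgM (f := fun x => expR (- e * `|x|)) (g := fun x => cos (u * x + p))).
  exact: continuous_decay.
apply: (continuous_comp (f := fun x => u * x + p) (g := @cos R)).
  exact: continuous_affine.
exact: continuous_cos.
Qed.

Lemma integrable_wave e u p : 0 < e -> mu.-integrable setT (EFin \o wave e u p).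
Proof.
move=> e0; apply: (@integrable_dominated_oneDsqrV _ _ (1 + 2 / e ^+ 2)).
  exact: continuous_wave.
move=> x; rewrite (le_trans _ (decay_le x e0))// /wave normrM ger0_norm ?expR_ge0//.
by rewrite ler_piMr ?expR_ge0// cos_max.
Qed.

(** An antiderivative of [exp (c x) * cos (u x + p)] when [c^2 = e^2]; the two signs of [c] serve
    the two half-lines. *)
Let Phi e u p (c x : R) : R :=
  expR (c * x) * (c * cos (u * x + p) + u * sin (u * x + p)) / (e ^+ 2 + u ^+ 2).

Let is_derive_Phi e u p c (x : R) : 0 < e -> c ^+ 2 = e ^+ 2 ->
  is_derive x (1 : R) (Phi e u p c) (expR (c * x) * cos (u * x + p)).
Proof.
move=> e0 ce; have D0 : e ^+ 2 + u ^+ 2 != 0 by rewrite lt0r_neq0// ltr_pwDl ?sqr_ge0// exprn_gt0.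
have dl (a b y : R) : is_derive y (1 : R) (fun y => a * y + b) a.
  by apply: is_derive_eq; rewrite /GRing.scale /= mulr1 addr0.
have dE : is_derive x (1 : R) (fun y => expR (c * y)) (expR (c * x) * c).
  apply: (is_derive1_comp (f := expR) (g := fun y : R => c * y)).
  by apply: is_derive_eq; rewrite /GRing.scale /= mulr1.
have dC : is_derive x (1 : R) (fun y => cos (u * y + p)) (- sin (u * x + p) * u).
  exact: (is_derive1_comp (f := @cos R) (g := fun y : R => u * y + p)).
have dS : is_derive x (1 : R) (fun y => sin (u * y + p)) (cos (u * x + p) * u).
  exact: (is_derive1_comp (f := @sin R) (g := fun y : R => u * y + p)).
have dsum := is_deriveD (is_deriveZ c dC) (is_deriveZ u dS).
have dprod := is_deriveZ ((e ^+ 2 + u ^+ 2)^-1) (is_deriveM dE dsum).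
have -> : Phi e u p c = (e ^+ 2 + u ^+ 2)^-1 \*: ((fun y => expR (c * y)) *
   ((c \*: (fun y => cos (u * y + p))) + (u \*: (fun y => sin (u * y + p)))) : R -> R).
  by apply/funext => y; rewrite /Phi mulrC.
apply: (is_derive_eq dprod); rewrite /GRing.scale /=.
rewrite (_ : (_ + _) x = c * cos (u * x + p) + u * sin (u * x + p))//.
apply: (mulfI D0); rewrite mulrA mulfV// mul1r -ce; ring.
Qed.

Let Phi_le e u p c (x : R) : 0 < e -> `|Phi e u p c x| <=
  expR (c * x) * ((`|c| + `|u|) / (e ^+ 2 + u ^+ 2)).
Proof.
move=> e0; have D0 : 0 < e ^+ 2 + u ^+ 2 by rewrite ltr_pwDl ?sqr_ge0// exprn_gt0.
rewrite /Phi !normrM normfV (ger0_norm (expR_ge0 _)) (gtr0_norm D0) -mulrA.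
rewrite ler_wpM2l ?expR_ge0// ler_wpM2r ?invr_ge0 ?(ltW D0)//.
rewrite (le_trans (ler_normD _ _))// !normrM.
by rewrite lerD// ler_piMr ?cos_max ?sin_max.
Qed.

(** Splitting at 0 removes the absolute value. The boundary terms at [-n] and [n] together are at
    most [K * exp (- e n)]. *)
Lemma integral_wave e u p : 0 < e ->
  \int[mu]_x wave e u p x = 2 * e * cos p / (e ^+ 2 + u ^+ 2).
Proof.
move=> e0; have cw := @continuous_wave e u p.
have D0 : 0 < e ^+ 2 + u ^+ 2 by rewrite ltr_pwDl ?sqr_ge0// exprn_gt0.
have hc := cvg_iseg (integrable_wave u p e0) cw.
apply: (@cvg_unique _ (@norm_hausdorff _ _) _ _ _ _ hc).
have cf c : continuous (fun x : R => expR (c * x) * cos (u * x + p)).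
  by move=> x; apply: (cvgM (f := fun x => expR (c * x)) (g := fun x => cos (u * x + p)));
    [apply: (continuous_comp (f := fun x => c * x) (g := expR));
      [by apply: cvgMl_tmp; exact: cvg_id|exact: continuous_expR]
    |apply: (continuous_comp (f := fun x => u * x + p) (g := @cos R));
      [exact: continuous_affine|exact: continuous_cos]].
have isegE (n : nat) : iseg (wave e u p) (- n%:R) n%:R =
    Phi e u p e 0 - Phi e u p e (- n%:R) + (Phi e u p (- e) n%:R - Phi e u p (- e) 0).
  have n0 : 0 <= n%:R :> R by [].
  have nn0 : - n%:R <= 0 :> R by rewrite oppr_le0.
  rewrite (iseg_split cw nn0 n0); congr (_ + _).
    rewrite -(iseg_FTC nn0 (cf e) (fun x => is_derive_Phi u p x e0 erefl)).
    apply: eq_Rintegral => x; rewrite inE/= in_itv/= => /andP[_ x0].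
    by rewrite /wave ler0_norm// mulrNN.
  rewrite -(iseg_FTC n0 (cf (- e)) (fun x => is_derive_Phi u p x e0 (sqrrN e))).
  apply: eq_Rintegral => x; rewrite inE/= in_itv/= => /andP[x0 _].
  by rewrite /wave ger0_norm.
(* The sine terms are the same for both signs of [c] and cancel. *)
have P0 : Phi e u p e 0 - Phi e u p (- e) 0 = 2 * e * cos p / (e ^+ 2 + u ^+ 2).
  rewrite /Phi !mulr0 !expR0 !mul1r add0r -mulrBl; congr (_ / _); ring.
pose K := 2 * ((e + `|u|) / (e ^+ 2 + u ^+ 2)).
apply/cvgrPdist_le => d d0; near=> n.
rewrite isegE -P0 (_ : _ - (_ + _) = Phi e u p e (- n%:R) - Phi e u p (- e) n%:R); last by ring.
rewrite (le_trans (ler_normB _ _))//.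
have h1 := Phi_le u p e (- n%:R) e0; have h2 := Phi_le u p (- e) n%:R e0.
rewrite mulrN -mulNr in h1; rewrite normrN in h2; rewrite (gtr0_norm e0) in h1 h2.
rewrite (le_trans (lerD h1 h2))// -mulrDr [X in _ * X](_ : _ = K); last by rewrite /K mulr_natl mulr2n.
have K0 : 0 <= K.
  by apply: mulr_ge0 => //; apply: divr_ge0; [apply: addr_ge0 => //|]; exact: ltW.
rewrite {1}mulNr expRN mulrC ler_pdivrMr ?expR_gt0//.
apply: (@le_trans _ _ (d * (1 + e * n%:R))); last by rewrite ler_pM2l// expR_ge1Dx.
rewrite -ler_pdivrMl// (@le_trans _ _ (e * n%:R))// ?lerDr// -ler_pdivrMl//.
apply: (@le_trans _ _ (Num.trunc (e^-1 * (d^-1 * K))).+1%:R); first exact/ltW/truncnS_gt.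
by rewrite ler_nat; near: n; exists (Num.trunc (e^-1 * (d^-1 * K))).+1.
Unshelve. all: by end_near. Qed.

Lemma cos_subpihalf (x : R) : cos (x - pi / 2) = sin x.
Proof. by rewrite cosB cos_pihalf sin_pihalf mulr0 add0r mulr1. Qed.

(** The constant [c] is carried for the induction on the dimension, where it is the value of the
    integral over the other coordinates. *)
Lemma integral_poisson e u c : 0 < e ->
  integralC1 (fun x => c%:C * ((expR (- e * `|x|))%:C * cexp ('i%C * (u * x)%:C))) =
  (c * (2 * e / (e ^+ 2 + u ^+ 2)))%:C.
Proof.
move=> e0; apply: complex_ext => /=.
  have := integral_wave u 0 e0; rewrite cos0 mulr1 => <-.
  rewrite -RintegralZl//; last exact: integrable_wave.
  apply: eq_Rintegral => x _.
  by rewrite !(mul0r, mul1r, mulr0, add0r, subr0, addr0, oppr0, expR0) /wave addr0.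
have := integral_wave u (- (pi / 2)) e0; rewrite cosN cos_pihalf mulr0 mul0r => h.
rewrite -[RHS](mulr0 c) -[X in _ = _ * X]h -RintegralZl//; last exact: integrable_wave.
move: h => _; apply: eq_Rintegral => x _.
by rewrite !(mul0r, mul1r, mulr0, add0r, subr0, addr0, oppr0, expR0) /wave cos_subpihalf.
Qed.

(** The substitution [(x - l) / e] reduces this to the integral of [1 / (1 + x^2)]. *)
Lemma integral_cauchy e (l : R) : 0 < e ->
  (\int[mu]_x (e / (pi * (e ^+ 2 + (x - l) ^+ 2)))%:E = 1%:E)%E.
Proof.
move=> e0; have pi0 := pi_gt0 R.
pose F (x : R) := e^-1 * x + - (e^-1 * l).
have dF (x : R) : is_derive x (1 : R) F e^-1.
  by rewrite /F; apply: is_derive_eq; rewrite /GRing.scale /= mulr1 ?oppr0 ?addr0.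
have F' : (F^`())%classic = cst e^-1.
  by apply/funext => x; rewrite derive1E; exact: derive_val.
have ei : 0 < e^-1 by rewrite invr_gt0.
pose G (x : R) := pi^-1 * (oneDsqr x)^-1.
have <- : (\int[mu]_x (G x)%:E = 1%:E)%E.
  rewrite /G; under eq_integral do rewrite EFinM.
  rewrite ge0_integralZl//; last 2 first.
  - by apply/measurable_EFinP; exact: measurable_oneDsqrV.
  - by rewrite lee_fin invr_ge0 ltW.
  by rewrite integral_oneDsqrV -EFinM mulVf// lt0r_neq0.
rewrite [RHS](increasing_ge0_integration_by_substitutionT (F := F)); last 9 first.
- by move=> x y xy; rewrite /F ltrD2r ltr_pM2l.
- by rewrite F'; exact: cst_continuous.
- by rewrite F'; exact: is_cvg_cst.
- by rewrite F'; exact: is_cvg_cst.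
- by move=> x; exact: ex_derive.
- apply/cvgrNyPle => M; near=> x; rewrite /F -mulrBr -ler_pdivlMl// invrK lerBlDr.
  by near: x; apply: nbhs_ninfty_le; rewrite num_real.
- apply/cvgryPge => M; near=> x; rewrite /F -mulrBr -ler_pdivrMl// invrK lerBrDr.
  by near: x; apply: nbhs_pinfty_ge; rewrite num_real.
- by move=> x; apply: cvgMl_tmp; exact: continuous_oneDsqrV.
- by move=> x; rewrite mulr_ge0// invr_ge0// ltW.
apply: eq_integral => x _; congr EFin.
rewrite F' -[((_ \o _) * _) x]/(G (F x) * e^-1) /G /F /oneDsqr.
have h : e ^+ 2 + (x - l) ^+ 2 != 0 by rewrite lt0r_neq0// ltr_pwDl ?sqr_ge0// exprn_gt0.
have h2 : 1 + (e^-1 * x + - (e^-1 * l)) ^+ 2 != 0 by rewrite lt0r_neq0// ltr_pwDl ?sqr_ge0.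
have -> : 1 + (e^-1 * x - e^-1 * l) ^+ 2 = (e ^+ 2 + (x - l) ^+ 2) / e ^+ 2.
  by field; rewrite lt0r_neq0.
rewrite invf_div; move: (e ^+ 2 + (x - l) ^+ 2) h => D h.
have p0 : pi != 0 :> R by rewrite lt0r_neq0.
have en0 := lt0r_neq0 e0.
by clear -h p0 en0; move: (pi) p0 => q p0; field; rewrite ?h ?p0 ?en0.
Unshelve. all: by end_near. Qed.

End poisson_kernel.

(** * The damping factor and products of Cauchy densities *)

Section kernels.
Context {R : realType}.
Notation mu := (@lebesgue_measure R).
Implicit Types (e : R) (n : nat).

Lemma continuous_sum_norm n : continuous (fun x : 'rV[R]_n => \sum_i `|x 0 i|).
Proof.
move=> x; apply: cvg_big => [||i _]; [exact: add_continuous|exact: nbhs_filter|].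
apply: (continuous_comp (f := fun x : 'rV[R]_n => x 0 i) (g := @Num.norm R R)).
  exact: coord_continuous.
exact: norm_continuous.
Qed.

Lemma continuous_prod_coord n (k : 'I_n -> R -> R) : (forall i, continuous (k i)) ->
  continuous (fun x : 'rV[R]_n => \prod_i k i (x 0 i)).
Proof.
move=> ck x; apply: cvg_big => [||i _]; [exact: mul_continuous|exact: nbhs_filter|].
apply: (continuous_comp (f := fun x : 'rV[R]_n => x 0 i) (g := k i)).
  exact: coord_continuous.
exact: ck.
Qed.

Definition damp e n (x : 'rV[R]_n) : R := expR (- e * \sum_i `|x 0 i|).

Lemma continuous_damp e n : continuous (@damp e n).
Proof.
have ch : continuous (fun x : 'rV[R]_n => - e * \sum_i `|x 0 i|).
  by apply: rV_continuousM; [exact: cst_continuous|exact: continuous_sum_norm].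
by move=> x; apply: (continuous_comp (ch x)); exact: continuous_expR.
Qed.

Lemma damp_vcons e n x (v : 'rV[R]_n) : damp e (vcons x v) = expR (- e * `|x|) * damp e v.
Proof.
rewrite /damp big_ord_recl vcons0 mulrDr expRD; congr (_ * expR (_ * _)).
by apply: eq_bigr => i _; rewrite vconsS.
Qed.

Lemma damp_le e n (x : 'rV[R]_n) : 0 < e -> damp e x <= (1 + 2 / e ^+ 2) ^+ n / wt x.
Proof.
move=> e0; rewrite /damp mulr_sumr expR_sum /wt -prodfV.
rewrite (_ : _ ^+ n = \prod_(i < n) (1 + 2 / e ^+ 2)) -?big_split /=; last first.
  by rewrite prodr_const card_ord.
by apply: ler_prod => i _; rewrite expR_ge0 decay_le.
Qed.

Lemma cdom_damp e n : 0 < e -> cdom (fun x : 'rV[R]_n => (damp e x)%:C).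
Proof.
move=> e0; split; first exact/ccont_realC/continuous_damp.
by exists ((1 + 2 / e ^+ 2) ^+ n) => x; rewrite normcR ger0_norm ?expR_ge0// damp_le.
Qed.

Lemma rint_rV0 (h : 'rV[R]_0 -> R) : rint h = h 0.
Proof.
rewrite /rint /Rintegral (_ : (fun t => _) = fun => (h 0)%:E).
  have m0 : (lebesgue_tuple R 0 setT = 1)%E by exact: diracT.
  transitivity (fine ((h 0)%:E * lebesgue_tuple R 0 setT)%E); last by rewrite m0 mule1.
  by congr fine; exact: integral_cst.
by apply/funext => t; congr (h _)%:E; apply/rowP => -[].
Qed.

Lemma integralC_damp e n (u : 'rV[R]_n) : 0 < e ->
  integralC (fun x => (damp e x)%:C * cexp ('i%C * (dot u x)%:C)) =
  (\prod_i (2 * e / (e ^+ 2 + u 0 i ^+ 2)))%:C.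
Proof.
move=> e0; elim: n u => [|n IHn] u.
  rewrite big_ord0 integralCE !rint_rV0 /damp /dot !big_ord0 mulr0 expR0 mul1r.
  by rewrite mulr0 cexp0.
have cdE m (w : 'rV[R]_m) : cdom (fun x => (damp e x)%:C * cexp ('i%C * (dot w x)%:C)).
  have := ift_cdom w (cdom_damp m e0); congr (cdom _); apply/funext => x.
  by rewrite dotC.
rewrite integralC_vcons1//.
set w : 'rV[R]_n := \row_i u 0 (lift ord0 i).
have uE : u = vcons (u 0 ord0) w by exact: vcons_eta.
pose c := \prod_i (2 * e / (e ^+ 2 + w 0 i ^+ 2)).
rewrite big_ord_recl (_ : \prod_(i < n) _ = c); last first.
  by apply: eq_bigr => i _; rewrite mxE.
rewrite mulrC -integral_poisson//; congr integralC1; apply/funext => x.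
rewrite -(IHn w) mulrC -integralCZ; last exact/cdom_cintegrable.
apply: eq_integralC => v; rewrite damp_vcons.
have -> : dot u (vcons x v) = u 0 ord0 * x + dot w v.
  rewrite /dot big_ord_recl vcons0; congr (_ + _).
  by apply: eq_bigr => i _; rewrite vconsS mxE.
by rewrite rmorphM rmorphD/= mulrDr cexpD; ring.
Qed.

(** The Poisson kernel of the half-plane at height [e]; it is [1 / (2 pi)] times the transform
    [2 e / (e^2 + u^2)] of the one-variable damping, at [u = x - l]. *)
Definition cauchy_density e (l x : R) : R := e / (pi * (e ^+ 2 + (x - l) ^+ 2)).

Lemma cauchy_ge0 e l x : 0 < e -> 0 <= cauchy_density e l x.
Proof.
move=> e0; apply: divr_ge0; first exact: ltW.
by apply: mulr_ge0; [exact: ltW (pi_gt0 R)|rewrite addr_ge0 ?sqr_ge0].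
Qed.

Lemma continuous_cauchy e l : 0 < e -> continuous (cauchy_density e l).
Proof.
move=> e0 x; apply: cvgMl_tmp; apply: cvgV.
  by rewrite mulf_neq0 ?lt0r_neq0 ?pi_gt0// ltr_pwDl ?sqr_ge0// exprn_gt0.
apply: cvgMl_tmp; apply: cvgD; first exact: cvg_cst.
by apply: cvgM; apply: cvgB; [exact: cvg_id|exact: cvg_cst|exact: cvg_id|exact: cvg_cst].
Qed.

(** For [|u| >= d] one has [1 + u^2 <= (1 + d^-2) * u^2]. The tail is thus of order [e], with the
    density of scale 1 as an integrable profile independent of [e]. *)
Lemma cauchy_far e d l x : 0 < e -> 0 < d -> d <= `|x - l| ->
  cauchy_density e l x <= e * (1 + d ^- 2) * cauchy_density 1 l x.
Proof.
move=> e0 d0 dx; have pi0 := pi_gt0 R.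
rewrite /cauchy_density; move: (x - l) dx => u du.
have d2 : 0 < d ^+ 2 by rewrite exprn_gt0.
have du2 : d ^+ 2 <= u ^+ 2.
  by rewrite -[u ^+ 2]real_normK ?num_real// lerXn2r ?nnegrE// ltW.
have u2 : 0 < u ^+ 2 by exact: lt_le_trans du2.
have e2 : 0 <= e ^+ 2 by rewrite sqr_ge0.
have c0 : 1 <= d ^- 2 * u ^+ 2 by rewrite ler_pdivlMl// mulr1.
have c1 : 0 <= d ^- 2 by rewrite invr_ge0 ltW.
move: (d ^- 2) c0 c1 => c c0 c1.
rewrite -mulrA ler_pM2l// expr1n !mul1r !invfM mulrCA ler_pM2l ?invr_gt0//.
rewrite -[leLHS]mul1r ler_pdivrMr; last by rewrite ltr_wpDl.
rewrite mulrAC ler_pdivlMr ?mul1r; last by rewrite ltr_pwDl// ltW.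
apply: (@le_trans _ _ ((1 + c) * u ^+ 2)); first by rewrite mulrDl mul1r addrC lerD2l.
by apply: ler_wpM2l; [rewrite addr_ge0|rewrite lerDr].
Qed.

(* The scales differ between coordinates because the tail bound [cauchyn_far]
   replaces one of them by 1. *)
Definition cauchyn n (s : 'I_n -> R) (l x : 'rV[R]_n) : R :=
  \prod_i cauchy_density (s i) (l 0 i) (x 0 i).

Lemma cauchyn_ge0 n (s : 'I_n -> R) l x : (forall i, 0 < s i) -> 0 <= cauchyn s l x.
Proof. by move=> s0; apply: prodr_ge0 => i _; exact: cauchy_ge0. Qed.

Lemma continuous_cauchyn n (s : 'I_n -> R) l : (forall i, 0 < s i) ->
  continuous (cauchyn s l).
Proof.
move=> s0; apply: (continuous_prod_coord (k := fun i => cauchy_density (s i) (l 0 i))) => i.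
exact: continuous_cauchy.
Qed.

Lemma integrable_cauchy e l : 0 < e -> mu.-integrable setT (EFin \o cauchy_density e l).
Proof.
move=> e0; apply/integrableP; split.
  by apply/measurable_EFinP; apply: continuous_measurable_fun; exact: continuous_cauchy.
under eq_integral do rewrite /= ger0_norm ?cauchy_ge0//.
by rewrite integral_cauchy// ltry.
Qed.

Lemma rintegrable_cauchyn n (s : 'I_n -> R) l : (forall i, 0 < s i) ->
  rintegrable (cauchyn s l).
Proof.
move=> s0; rewrite /rintegrable.
rewrite (_ : _ \o _ = fun t => \prod_i cauchy_density (s i) (l 0 i) (tnth t i)); last first.
  by apply/funext => t; apply: eq_bigr => i _; rewrite mxE.
apply: (integrable_tuple_prod (k := fun i => cauchy_density (s i) (l 0 i))) => i.
- by apply: continuous_measurable_fun; exact: continuous_cauchy.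
- by move=> x; exact: cauchy_ge0.
- exact: integrable_cauchy.
Qed.

Lemma rint_cauchyn n (s : 'I_n -> R) l : (forall i, 0 < s i) -> rint (cauchyn s l) = 1.
Proof.
move=> s0; rewrite /rint.
rewrite (_ : (fun t => _) = fun t => \prod_i cauchy_density (s i) (l 0 i) (tnth t i)); last first.
  by apply/funext => t; apply: eq_bigr => i _; rewrite mxE.
rewrite (Rintegral_tuple_prod (k := fun i => cauchy_density (s i) (l 0 i))).
- by rewrite big1// => i _; rewrite /Rintegral integral_cauchy.
- by move=> i; apply: continuous_measurable_fun; exact: continuous_cauchy.
- by move=> i x; exact: cauchy_ge0.
- by move=> i; exact: integrable_cauchy.
Qed.

Lemma cauchyn_far n e d i (l x : 'rV[R]_n) : 0 < e -> 0 < d -> d <= `|x 0 i - l 0 i| ->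
  cauchyn (fun=> e) l x <= e * (1 + d ^- 2) * cauchyn (fun j => if j == i then 1 else e) l x.
Proof.
move=> e0 d0 dx; rewrite /cauchyn (bigD1 i)//= [X in _ <= _ * X](bigD1 i)//= eqxx mulrA.
rewrite [X in _ <= _ * X](eq_bigr (fun j => cauchy_density e (l 0 j) (x 0 j))); last first.
  by move=> j /negbTE ->.
apply: ler_wpM2r; last exact: cauchy_far.
by apply: prodr_ge0 => j _; exact: cauchy_ge0.
Qed.

End kernels.

(** * Removing the damping from the inversion formula *)

Section inversion.
Context {R : realType}.
Notation mu := (@lebesgue_measure R).
Implicit Types (e : R) (n : nat).

Lemma continuous_dot_r n (l : 'rV[R]_n) : continuous (dot l).
Proof.
rewrite (_ : dot l = fun x => dot x l); first exact: continuous_dot.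
by apply/funext => x; rewrite dotC.
Qed.

Definition cmeas d (T : measurableType d) (h : T -> R[i]) : Prop :=
  measurable_fun setT (fun t => Re (h t)) /\ measurable_fun setT (fun t => Im (h t)).

Lemma cmeasM d (T : measurableType d) (h k : T -> R[i]) : cmeas h -> cmeas k ->
  cmeas (fun t => h t * k t).
Proof.
move=> [h1 h2] [k1 k2]; split.
  rewrite (_ : (fun t => _) = fun t => Re (h t) * Re (k t) - Im (h t) * Im (k t)).
    by apply: measurable_funB; exact: measurable_funM.
  by apply/funext => t; rewrite cReM.
rewrite (_ : (fun t => _) = fun t => Re (h t) * Im (k t) + Im (h t) * Re (k t)).
  by apply: measurable_funD; exact: measurable_funM.
by apply/funext => t; rewrite cImM.
Qed.

Lemma cmeas_cexp_im d (T : measurableType d) (h : T -> R) : measurable_fun setT h ->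
  cmeas (fun t => cexp ('i%C * (h t)%:C)).
Proof.
move=> mh; split.
  rewrite (_ : (fun t => _) = @cos R \o h).
    apply: measurableT_comp => //; apply: continuous_measurable_fun; exact: continuous_cos.
  by apply/funext => t; rewrite Re_cexp mulic_real /= expR0 mul1r.
rewrite (_ : (fun t => _) = @sin R \o h).
  apply: measurableT_comp => //; apply: continuous_measurable_fun; exact: continuous_sin.
by apply/funext => t; rewrite Im_cexp mulic_real /= expR0 mul1r.
Qed.

Lemma cmeas_comp d (T : measurableType d) n (h : 'rV[R]_n -> R[i])
    (t : T -> n.-tuple (measurableTypeR R)) :
  ccont h -> measurable_fun setT t -> cmeas (fun x => h (row_of (t x))).
Proof.
by move=> [h1 h2] mt; split;
  [exact: (measurableT_comp (measurable_rV h1) mt)|exact: (measurableT_comp (measurable_rV h2) mt)].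
Qed.

Lemma integralC_swap m n (H : 'rV[R]_m -> 'rV[R]_n -> R[i]) a b :
  cmeas (fun p : m.-tuple (measurableTypeR R) * n.-tuple (measurableTypeR R) =>
    H (row_of p.1) (row_of p.2)) ->
  (forall x y, normc (H x y) <= a x * b y) ->
  rintegrable a -> rintegrable b ->
  (forall x, cintegrable (H x)) -> (forall y, cintegrable (H ^~ y)) ->
  integralC (fun x => integralC (H x)) = integralC (fun y => integralC (H ^~ y)).
Proof.
move=> [m1 m2] Hab ia ib i1 i2; rewrite 2!integralCE; congr (_ +i* _).
  apply: (rint_swap (H := fun x y => Re (H x y)) m1 _ ia ib) => [x y|x|y].
  - exact: le_trans (normRe_le _) (Hab x y).
  - by have [] := i1 x.
  - by have [] := i2 y.
apply: (rint_swap (H := fun x y => Im (H x y)) m2 _ ia ib) => [x y|x|y].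
- exact: le_trans (normIm_le _) (Hab x y).
- by have [] := i1 x.
- by have [] := i2 y.
Qed.

Lemma cintegrable_le n (h : 'rV[R]_n -> R[i]) k : ccont h ->
  (forall v, normc (h v) <= k v) -> rintegrable k -> cintegrable h.
Proof.
move=> [h1 h2] hk ik; split; apply: (rintegrable_le _ _ ik).
- exact: measurable_rV.
- by move=> v; rewrite (le_trans (normRe_le _)).
- exact: measurable_rV.
- by move=> v; rewrite (le_trans (normIm_le _)).
Qed.

Lemma ccont_ift n (p : 'rV[R]_n -> R[i]) : rapid p -> ccont (ift p).
Proof.
by move=> rp; have [h1 h2] := smoothC_ift rp; split; [have [] := h1 [::]|have [] := h2 [::]].
Qed.

Lemma normc_cexp_Nim (t : R) : normc (cexp (- 'i%C * t%:C)) = 1.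
Proof. by rewrite mulNr -mulrN -rmorphN normc_cexp_im. Qed.

Lemma ift_bounded n (p : 'rV[R]_n -> R[i]) : cdom p ->
  exists2 B, 0 <= B & forall x, normc (ift p x) <= B.
Proof.
move=> dp; have [cp [C hC]] := dp.
have h x : normc (ift p x) <= 2 * rint (fun y : 'rV[R]_n => C * (wt y)^-1).
  apply: normc_integralC_le; first exact/cdom_cintegrable/ift_cdom.
    exact/rintegrableZ/rintegrable_wtV.
  by move=> y; rewrite ComplexField.Normc.normcM normc_cexp_im mulr1.
by exists (2 * rint (fun y : 'rV[R]_n => C * (wt y)^-1)) => //; exact: le_trans (normc_ge0 _) (h 0).
Qed.

(** On the box, [wt] is at most [(1 + L^2) ^ n]. *)
Lemma cdom_box n (h : 'rV[R]_n -> R[i]) (B L : R) : ccont h -> 0 <= L ->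
  (forall x, normc (h x) <= B) ->
  (forall x : 'rV[R]_n, ~ (forall i, `|x 0 i| <= L) -> h x = 0) -> cdom h.
Proof.
move=> ch L0 hB h0; split => //.
have B0 : 0 <= B by exact: le_trans (normc_ge0 _) (hB 0).
exists (B * (1 + L ^+ 2) ^+ n) => x; rewrite ler_pdivlMr ?wt_gt0//.
have [xL|/h0 ->] := pselect (forall i, `|x 0 i| <= L); last first.
  by rewrite ComplexField.Normc.normc0 mul0r mulr_ge0// exprn_ge0// addr_ge0 ?sqr_ge0.
apply: ler_pM => //; [exact: normc_ge0|exact/ltW/wt_gt0|].
rewrite (_ : _ ^+ n = \prod_(i < n) (1 + L ^+ 2)); last by rewrite prodr_const card_ord.
apply: ler_prod => i _; rewrite addr_ge0 ?sqr_ge0//= lerD2l.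
by rewrite -[x 0 i ^+ 2]real_normK ?num_real// lerXn2r ?nnegrE.
Qed.

Section fixed_symbol.
Context (n : nat) (p : 'rV[R]_n -> R[i]).
Hypothesis rp : rapid p.

Let cp : ccont p. Proof. by case: rp. Qed.

(** The damping makes the double integrand absolutely integrable, its modulus being
    [normc (p y) * damp e x]. The inner integral over [x] is then the transform of [damp] at
    [y - l]. *)
Lemma damped_inversion e l : 0 < e ->
  integralC (fun x => (damp e x)%:C * (ift p x * cexp (- 'i%C * (dot l x)%:C))) =
  integralC (fun y => p y * ((2 * pi) ^+ n * cauchyn (fun=> e) l y)%:C).
Proof.
move=> e0; have dp := rapid_cdom rp; have [_ [C hC]] := dp.
have [cK [D hD]] := @cdom_damp R e n e0.
pose H x y := (damp e x)%:C * (cexp (- 'i%C * (dot l x)%:C) * (p y * cexp ('i%C * (dot y x)%:C))).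
have E x y : H x y = p y * ((damp e x)%:C * cexp ('i%C * (dot (y - l) x)%:C)).
  rewrite /H dotDl dotNl rmorphD rmorphN /= mulrDr mulrN -mulNr cexpD; ring.
have nH x y : normc (H x y) = normc (p y) * damp e x.
  rewrite E 2!ComplexField.Normc.normcM normc_cexp_im mulr1 normcR.
  by rewrite ger0_norm ?expR_ge0.
have cH1 x : cintegrable (H x).
  apply: cintegrableZ; apply: cintegrableZ.
  exact/cdom_cintegrable/ift_cdom.
have cH2 y : cintegrable (H ^~ y).
  rewrite (_ : H ^~ y = fun x => p y * ((damp e x)%:C * cexp ('i%C * (dot x (y - l))%:C))).
    by apply/cintegrableZ/cdom_cintegrable/ift_cdom/cdom_damp.
  by apply/funext => x; rewrite E (dotC x).
transitivity (integralC (fun x => integralC (H x))).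
  apply: eq_integralC => x; have ic := cdom_cintegrable (ift_cdom x dp).
  by rewrite /H integralCZ ?integralCZ//; [rewrite [ift p x * _]mulrC|exact: cintegrableZ].
rewrite (integralC_swap (a := fun x => D * (wt x)^-1) (b := fun y => C * (wt y)^-1))//; last 4 first.
- apply: cmeasM; first by apply: (cmeas_comp cK); exact: measurable_fst.
  apply: cmeasM.
    apply: (cmeas_comp (h := fun x => cexp (- 'i%C * (dot l x)%:C)) (t := fst)); last exact: measurable_fst.
    apply: ccont_cexp; apply: ccontM; first exact: ccont_cst.
    by apply: ccont_realC; exact: continuous_dot_r.
  apply: cmeasM; first by apply: (cmeas_comp cp); exact: measurable_snd.
  apply: cmeas_cexp_im; rewrite /dot; apply: measurable_sum => i.
  apply: measurable_funM.
    exact: (measurableT_comp (measurable_row_of i) measurable_snd).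
  exact: (measurableT_comp (measurable_row_of i) measurable_fst).
- move=> x y; rewrite nH mulrC; apply: ler_pM; rewrite ?expR_ge0 ?normc_ge0//.
  by have := hD x; rewrite normcR ger0_norm ?expR_ge0.
- exact/rintegrableZ/rintegrable_wtV.
- exact/rintegrableZ/rintegrable_wtV.
apply: eq_integralC => y.
under eq_integralC do rewrite E.
rewrite integralCZ; last first.
  have := cdom_cintegrable (ift_cdom (y - l) (@cdom_damp R e n e0)).
  by congr cintegrable; apply/funext => x; rewrite dotC.
rewrite integralC_damp//; congr (_ * _%:C).
rewrite (_ : _ ^+ n = \prod_(i < n) (2 * pi)); last by rewrite prodr_const card_ord.
rewrite -big_split /=; apply: eq_bigr => i _; rewrite /cauchy_density !mxE.
have p0 : pi != 0 :> R by rewrite lt0r_neq0// pi_gt0.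
have D0 : e ^+ 2 + (y 0 i - l 0 i) ^+ 2 != 0.
  by rewrite lt0r_neq0// ltr_pwDl ?sqr_ge0// exprn_gt0.
move: (e ^+ 2 + _) D0 => d D0; clear -p0 D0; move: (pi) p0 => q p0.
by field; rewrite ?p0 ?D0.
Qed.

(** Approximate identity with an explicit error: [h] is the oscillation of [p] near [l], and the
    mass away from [l] is linear in [e]. *)
Lemma cauchyn_approx l h : 0 < h -> exists2 D, 0 <= D & forall e, 0 < e ->
  normc (integralC (fun y => p y * ((2 * pi) ^+ n * cauchyn (fun=> e) l y)%:C) -
         ((2 * pi) ^+ n)%:C * p l) <= (2 * pi) ^+ n * (2 * h) + D * e.
Proof.
move=> h0; have pn : 0 <= (2 * pi) ^+ n :> R.
  by rewrite exprn_ge0// mulr_ge0// ltW// pi_gt0.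
have [_ [M hM]] := rapid_cdom rp.
have M0 : 0 <= M.
  have := hM l; rewrite ler_pdivlMr ?wt_gt0//; apply: le_trans.
  by rewrite mulr_ge0 ?normc_ge0// ltW// wt_gt0.
have pM y : normc (p y) <= M.
  by rewrite (le_trans (hM y))// ler_piMr// invf_le1 ?wt_ge1 ?wt_gt0.
have [d d0 dP] : exists2 d : R, 0 < d & forall y : 'rV[R]_n,
    (forall i, `|y 0 i - l 0 i| < d) -> normc (p y - p l) <= h.
  have h2 : 0 < h / 2 by rewrite divr_gt0.
  have [/continuous_rV/(_ l _ h2)[r1 r10 r1P] /continuous_rV/(_ l _ h2)[r2 r20 r2P]] := cp.
  exists (Num.min r1 r2) => [|y yl]; first by rewrite lt_min r10.
  rewrite (le_trans (normc_le_ReIm _))// cReD cImD cReN cImN.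
  rewrite (splitr h) ltW// ltrD ?r1P ?r2P// => i.
    by rewrite (lt_le_trans (yl i))// ge_min lexx.
  by rewrite (lt_le_trans (yl i))// ge_min lexx orbT.
pose c := 1 + d ^- 2.
have c0 : 0 <= c by rewrite addr_ge0// invr_ge0 exprn_ge0// ltW.
(* The inner 2 comes from [normc_integralC_le], [n] counts the coordinates that can be far, [2 * M]
   bounds [p y - p l], and [c] comes from [cauchy_far]. *)
exists ((2 * pi) ^+ n * (2 * (n%:R * (2 * M * c)))) => [|e e0].
  by rewrite !mulr_ge0.
pose s i (j : 'I_n) : R := if j == i then 1 else e.
have s0 i j : 0 < s i j by rewrite /s; case: ifP.
have cQ : ccont (fun y => (cauchyn (fun=> e) l y)%:C).
  by apply: ccont_realC; exact: continuous_cauchyn.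
have iQ := @rintegrable_cauchyn R n (fun=> e) l (fun=> e0).
have nQ y : normc (cauchyn (fun=> e) l y)%:C = cauchyn (fun=> e) l y.
  by rewrite normcR ger0_norm// cauchyn_ge0.
have iQC : cintegrable (fun y => (cauchyn (fun=> e) l y)%:C).
  by apply: (cintegrable_le cQ _ iQ) => y; rewrite nQ.
have ipQ : cintegrable (fun y => p y * (cauchyn (fun=> e) l y)%:C).
  apply: (@cintegrable_le _ _ (fun y => M * cauchyn (fun=> e) l y)).
  - exact: ccontM.
  - by move=> y; rewrite ComplexField.Normc.normcM nQ ler_wpM2r// cauchyn_ge0.
  - exact: rintegrableZ.
have QE : integralC (fun y => (cauchyn (fun=> e) l y)%:C) = 1.
  rewrite integralCE /= rint_cauchyn//; congr (_ +i* _).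
  by rewrite /rint /Rintegral integral0.
have -> : integralC (fun y => p y * ((2 * pi) ^+ n * cauchyn (fun=> e) l y)%:C) -
    ((2 * pi) ^+ n)%:C * p l =
    ((2 * pi) ^+ n)%:C * integralC (fun y => (p y - p l) * (cauchyn (fun=> e) l y)%:C).
  transitivity (((2 * pi) ^+ n)%:C * (integralC (fun y => p y * (cauchyn (fun=> e) l y)%:C)
      - p l * integralC (fun y => (cauchyn (fun=> e) l y)%:C))).
    rewrite QE mulr1 mulrBr -integralCZ//; congr (_ - _).
    by apply: eq_integralC => y; rewrite rmorphM /=; ring.
  congr (_ * _); rewrite -integralCZ// -integralCB//; last exact: cintegrableZ.
  by apply: eq_integralC => y; rewrite mulrBl.
rewrite ComplexField.Normc.normcM normcR ger0_norm// -[X in _ + X]mulrA -mulrDr.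
apply: ler_wpM2l => //.
(* Either every coordinate of [y] is within [d] of [l], and the first term suffices, or some
   coordinate [i] is not, and the [i]-th term of the sum does. *)
pose k y := h * cauchyn (fun=> e) l y + (2 * M * (e * c)) * \sum_i cauchyn (s i) l y.
have isum (r : seq 'I_n) : rintegrable (fun y => \sum_(i <- r) cauchyn (s i) l y) /\
    rint (fun y => \sum_(i <- r) cauchyn (s i) l y) = (size r)%:R.
  elim: r => [|i r [IH1 IH2]].
    rewrite (_ : (fun y => _) = fun=> 0); last by apply/funext => y; rewrite big_nil.
    split; last by rewrite /rint /Rintegral integral0.
    exact: (integrable0 (lebesgue_tuple R n) setT).
  have -> : (fun y => \sum_(j <- i :: r) cauchyn (s j) l y) =
      (fun y => cauchyn (s i) l y + \sum_(j <- r) cauchyn (s j) l y).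
    by apply/funext => y; rewrite big_cons.
  have ii := rintegrable_cauchyn l (s0 i).
  split; first exact: rintegrableD.
  by rewrite rintD// IH2 rint_cauchyn//= mulrS.
have [is1 is2] := isum (index_enum _).
have ik : rintegrable k by apply: rintegrableD; exact: rintegrableZ.
have rk : rint k = h + 2 * M * (e * c) * n%:R.
  rewrite /k rintD; [|exact: rintegrableZ..].
  by rewrite !rintZ// rint_cauchyn// mulr1 is2 /index_enum -enumT size_enum_ord.
rewrite (_ : _ + _ = 2 * rint k); last by rewrite rk; ring.
apply: normc_integralC_le => //.
  rewrite (_ : (fun y => _) = fun y => p y * (cauchyn (fun=> e) l y)%:C -
      p l * (cauchyn (fun=> e) l y)%:C).
    by apply: cintegrableB => //; exact: cintegrableZ.
  by apply/funext => y; rewrite mulrBl.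
move=> y; rewrite ComplexField.Normc.normcM nQ /k.
have [yl|] := pselect (forall i, `|y 0 i - l 0 i| < d).
  apply: ler_wpDr; last by rewrite ler_wpM2r ?dP// cauchyn_ge0.
  rewrite !mulr_ge0//; first exact: ltW.
  by apply: sumr_ge0 => i _; exact: cauchyn_ge0.
move=> /existsNP[i /negP]; rewrite -leNgt => di.
apply: ler_wpDl; first by apply: mulr_ge0; [exact: ltW|exact: cauchyn_ge0].
rewrite -mulrA; apply: ler_pM => //; [exact: normc_ge0|exact: cauchyn_ge0| |].
  rewrite (le_trans (le_normcB _ _))// mulr_natl mulr2n lerD//.
apply: (le_trans (cauchyn_far e0 d0 di)); apply: ler_wpM2l.
  by apply: mulr_ge0 => //; exact: ltW.
rewrite (bigD1 i)//= lerDl; apply: sumr_ge0 => j _; exact: cauchyn_ge0.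
Qed.

(** On the box [1 - damp e x] is at most [e] times the sum of the [|x_i|], hence at most
    [e * n * L]; off the box the integrand is zero. *)
Lemma damp_error (L : R) l : 0 <= L -> (forall x : 'rV[R]_n, ~ (forall i, `|x 0 i| <= L) -> ift p x = 0) ->
  exists2 D, 0 <= D & forall e, 0 < e ->
  normc (integralC (fun x => ift p x * cexp (- 'i%C * (dot l x)%:C)) -
    integralC (fun x => (damp e x)%:C * (ift p x * cexp (- 'i%C * (dot l x)%:C)))) <= D * e.
Proof.
move=> L0 hL; have ci := ccont_ift rp.
have [B B0 hB] := ift_bounded (rapid_cdom rp).
have di : cdom (ift p) by exact: cdom_box L0 hB hL.
have cE : ccont (fun x : 'rV[R]_n => cexp (- 'i%C * (dot l x)%:C)).
  apply: ccont_cexp; apply: ccontM; first exact: ccont_cst.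
  by apply: ccont_realC; exact: continuous_dot_r.
have dj : cdom (fun x => ift p x * cexp (- 'i%C * (dot l x)%:C)).
  rewrite (_ : (fun x => _) = fun x => cexp (- 'i%C * (dot l x)%:C) * ift p x).
    by apply: (cdomM (M := 1)) => // x; rewrite normc_cexp_Nim.
  by apply/funext => x; rewrite mulrC.
have [_ [C hC]] := dj.
have C0 : 0 <= C.
  have := hC 0; rewrite ler_pdivlMr ?wt_gt0//; apply: le_trans.
  by rewrite mulr_ge0 ?normc_ge0// ltW// wt_gt0.
have I0 : 0 <= rint (fun v : 'rV[R]_n => (wt v)^-1).
  by apply: Rintegral_ge0 => t _; rewrite invr_ge0 ltW// wt_gt0.
exists (2 * ((n%:R * L) * C * rint (fun y : 'rV[R]_n => (wt y)^-1))) => [|e e0].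
  by rewrite !mulr_ge0.
have dk : cdom (fun x => (damp e x)%:C * (ift p x * cexp (- 'i%C * (dot l x)%:C))).
  apply: (cdomM (M := 1)) => //; first exact/ccont_realC/continuous_damp.
  move=> x; rewrite normcR ger0_norm ?expR_ge0// /damp mulNr -[leRHS](@expR0 R) ler_expR oppr_le0.
  by apply: mulr_ge0; [exact: ltW|exact: sumr_ge0].
rewrite -integralCB; [|exact: cdom_cintegrable..].
rewrite (_ : _ * e = 2 * rint (fun x : 'rV[R]_n => e * (n%:R * L) * C * (wt x)^-1)); last first.
  by rewrite rintZ; [ring|exact: rintegrable_wtV].
apply: normc_integralC_le.
- by apply: cintegrableB; exact: cdom_cintegrable.
- exact/rintegrableZ/rintegrable_wtV.
move=> x; rewrite -[X in X - _]mul1r -mulrBl ComplexField.Normc.normcM -[leRHS]mulrA.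
have [xL|/hL ->] := pselect (forall i, `|x 0 i| <= L); last first.
  by rewrite mul0r ComplexField.Normc.normc0 mulr0 !mulr_ge0 ?invr_ge0// ltW// wt_gt0.
apply: ler_pM; rewrite ?normc_ge0//.
have -> : 1 - (damp e x)%:C = (1 - damp e x)%:C by rewrite rmorphB.
have S0 : 0 <= \sum_i `|x 0 i| by exact: sumr_ge0.
have SL : \sum_i `|x 0 i| <= n%:R * L.
  by rewrite (le_trans (ler_sum _ (fun i _ => xL i)))// sumr_const card_ord mulr_natl.
have h1 := expR_ge1Dx (- e * \sum_i `|x 0 i|).
have h2 : damp e x <= 1.
  rewrite /damp mulNr -[leRHS](@expR0 R) ler_expR oppr_le0.
  by apply: mulr_ge0 => //; exact: ltW.
rewrite normcR ger0_norm ?subr_ge0// lerBlDr -lerBlDl (le_trans _ h1)//.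
by rewrite mulNr lerD2l lerN2 ler_pM2l.
Qed.

Lemma ift_inversion (L : R) l : 0 <= L -> (forall x : 'rV[R]_n, ~ (forall i, `|x 0 i| <= L) -> ift p x = 0) ->
  integralC (fun x => ift p x * cexp (- 'i%C * (dot l x)%:C)) = ((2 * pi) ^+ n)%:C * p l.
Proof.
move=> L0 hL; apply/eqP; rewrite -subr_eq0; apply/eqP.
apply: ComplexField.Normc.eq0_normc; apply/eqP; rewrite eq_le normc_ge0 andbT.
have [D D0 hD] := damp_error l L0 hL.
have pn : 0 < (2 * pi) ^+ n :> R by rewrite exprn_gt0// mulr_gt0// pi_gt0.
apply/ler_addgt0Pr => h h0; rewrite add0r.
(* Half of [h] goes to the oscillation term, through [h'], and the other half to the two errors
   linear in [e]. *)
pose h' := h / 4 / (2 * pi) ^+ n.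
have h'0 : 0 < h' by rewrite !divr_gt0.
have [D' D'0 hD'] := cauchyn_approx l h'0.
pose e := h / 2 / (D + D' + 1).
have DD : 0 < D + D' + 1 by rewrite ltr_wpDl// addr_ge0.
have e0 : 0 < e by rewrite !divr_gt0.
have := hD e e0; have := hD' e e0; rewrite -damped_inversion//.
set a := integralC _; set b := integralC _; set c := _ * p l => h1 h2.
have -> : b - c = (b - a) + (a - c) by rewrite addrA subrK.
rewrite (le_trans (le_normcD _ _))// (le_trans (lerD h2 h1))//.
have -> : (2 * pi) ^+ n * (2 * h') = h / 2.
  rewrite /h'; move: ((2 * pi) ^+ n) pn => q q0; field; rewrite lt0r_neq0//.
have he : e * (D + D' + 1) = h / 2 by rewrite divfK// lt0r_neq0.
by rewrite [leRHS]splitr addrCA lerD2l -mulrDl mulrC -he ler_pM2l// lerDl.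
Qed.

End fixed_symbol.
End inversion.

(** * Transforms of compactly supported functions *)

Section integration_by_parts.
Context {R : realType}.
Notation mu := (@lebesgue_measure R).
Implicit Types (n : nat).

Lemma is_derive_vcons_l n (k : 'rV[R]_n.+1 -> R) x (v : 'rV[R]_n) c :
  is_derive (vcons x v) (delta_mx 0 ord0) k c ->
  is_derive x (1 : R) (fun x => k (vcons x v)) c.
Proof.
have E : (fun h : R => h^-1 *: (((fun x => k (vcons x v)) \o shift x) (h *: (1 : R)) -
    k (vcons x v))) = (fun h : R => h^-1 *: ((k \o shift (vcons x v)) (h *: delta_mx 0 ord0) -
    k (vcons x v))).
  apply/funext => h /=; congr (_ *: (k _ - _)).
  apply/rowP => i; rewrite !mxE eqxx /=.
  case: (unliftP ord0 i) => [j|] -> /=; rewrite ?unlift_none ?liftK/=.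
    by rewrite mulr0 add0r.
  by rewrite /GRing.scale/= !mulr1.
move=> [dk <-]; apply: DeriveDef; first by rewrite /derivable E; exact: dk.
by rewrite /derive E.
Qed.

Lemma is_derive_vcons_r n (k : 'rV[R]_n.+1 -> R) x (v : 'rV[R]_n) j c :
  is_derive (vcons x v) (delta_mx 0 (lift ord0 j)) k c ->
  is_derive v (delta_mx 0 j) (fun v => k (vcons x v)) c.
Proof.
have E : (fun h : R => h^-1 *: (((fun v => k (vcons x v)) \o shift v) (h *: delta_mx 0 j) -
    k (vcons x v))) = (fun h : R => h^-1 *: ((k \o shift (vcons x v))
    (h *: delta_mx 0 (lift ord0 j)) - k (vcons x v))).
  apply/funext => h /=; congr (_ *: (k _ - _)).
  apply/rowP => i; rewrite !mxE eqxx /=.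
  case: (unliftP ord0 i) => [j'|] -> /=; rewrite ?unlift_none ?liftK ?mxE ?eqxx//=.
  by rewrite mulr0 add0r.
move=> [dk <-]; apply: DeriveDef; first by rewrite /derivable E; exact: dk.
by rewrite /derive E.
Qed.

(** For the first coordinate this is the fundamental theorem of calculus on [[-n, n]], whose
    endpoint values tend to 0; for a later one the induction hypothesis makes every slice vanish. *)
Lemma rint_partial n j (k dk : 'rV[R]_n -> R) : dom k -> dom dk ->
  (forall x, is_derive x (delta_mx 0 j) k (dk x)) -> rint dk = 0.
Proof.
elim: n j k dk => [[]//|n IHn] j k dk dk0 dk1 kdk.
case: (unliftP ord0 j) => [j'|] jE; rewrite {}jE in kdk.
  rewrite rint_vcons1//; under eq_Rintegral => x _.
    rewrite (IHn j' _ _ (dom_vcons_r x dk0) (dom_vcons_r x dk1)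
      (fun v => is_derive_vcons_r (kdk (vcons x v)))).
    over.
  by rewrite /Rintegral integral0.
rewrite rint_vcons2// (_ : (fun v => _) = fun=> 0).
  by rewrite /rint /Rintegral integral0.
apply/funext => v; have [ck [C hC]] := dk0; have [cdk _] := dk1.
have cs : continuous (fun x => dk (vcons x v)) by exact: continuous_vcons_l.
apply: (@Rintegral_eq0_of_iseg _ _ (2 * (C / wt v))) => //.
  exact: dom_vcons_l.
have hv x : `|k (vcons x v)| <= (C / wt v) / (1 + x ^+ 2).
  by have := hC (vcons x v); rewrite wt_cons invfM mulrA [C / _ / _]mulrAC.
move=> m; have mm : - m%:R <= m%:R :> R by rewrite (@le_trans _ _ 0)// oppr_le0.
rewrite (iseg_FTC mm cs (fun x => is_derive_vcons_l (kdk (vcons x v)))).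
rewrite (le_trans (ler_normB _ _))// -mulrA mulr_natl mulr2n.
by apply: lerD; rewrite (le_trans (hv _))// sqrrN.
Qed.

End integration_by_parts.

(** * Growth and holomorphy of the Fourier-Laplace transform *)

Section compact_support.
Context {R : realType} (n : nat) (A : set 'rV[R]_n).
Hypotheses (A0 : A !=set0) (cA : compact A).

(** The constant is the maximum over [A] of [|h| * wt]. *)
Lemma dom_of_compact_support (h : 'rV[R]_n -> R) : continuous h ->
  (forall x, ~ A x -> h x = 0) -> dom h.
Proof.
move=> ch h0; split => //.
have cw : continuous (fun x : 'rV[R]_n => `|h x| * wt x).
  apply: rV_continuousM.
    by move=> x; apply: (continuous_comp (ch x)); exact: norm_continuous.
  apply: (continuous_prod_coord (k := fun _ t => 1 + t ^+ 2)) => i t.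
  by apply: cvgD; [exact: cvg_cst|apply: cvgM; exact: cvg_id].
have [c _ cP] := compact_EVT_max A0 cA (continuous_subspaceT cw).
exists (`|h c| * wt c) => x; rewrite ler_pdivlMr ?wt_gt0//.
have [Ax|/h0 ->] := pselect (A x); first by apply: cP; exact: mem_set.
by rewrite normr0 mul0r mulr_ge0// ltW// wt_gt0.
Qed.

(** The complement of [A] is open, so the function differentiated vanishes on a whole neighbourhood
    of the point. *)
Lemma partials_eq0 (u : 'rV[R]_n -> R) s : (forall x, ~ A x -> u x = 0) ->
  forall x, ~ A x -> partials s u x = 0.
Proof.
have clA : closed A by apply: compact_closed cA; exact: norm_hausdorff.
move=> u0; elim: s => [|i s IHs] //= x nAx.
rewrite (near_eq_derive (g := cst 0)); first exact: derive_cst.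
have : nbhs x (~` A) by apply: open_nbhs_nbhs; split => //; exact: closed_openC.
by apply: filterS => y; exact: IHs.
Qed.

Lemma normc_phaseN (x : 'rV[R]_n) (z : 'rV[R[i]]_n) :
  normc (phase (- x) z) = expR (dot x (map_mx (@complex.Im R) z)).
Proof.
have zE : z = cvec (map_mx (@complex.Re R) z) (map_mx (@complex.Im R) z).
  by apply/rowP => i; rewrite !mxE; case: (z 0 i).
rewrite {1}zE phaseE normc_cexp cReD mulic_real /= addr0 dotNr opprK.
by rewrite dotC.
Qed.

Lemma ccont_phaseN (z : 'rV[R[i]]_n) : ccont (fun x => phase (- x) z).
Proof.
have zE : z = cvec (map_mx (@complex.Re R) z) (map_mx (@complex.Im R) z).
  by apply/rowP => i; rewrite !mxE; case: (z 0 i).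
rewrite zE; set a := map_mx _ _; set b := map_mx _ _.
rewrite (_ : (fun x => _) = fun x => cexp ((dot x b)%:C + 'i%C * (- 1)%:C * (dot x a)%:C)).
  apply: ccont_cexp; apply: ccontD; first by apply: ccont_realC; exact: continuous_dot.
  by apply: ccontM; [exact: ccont_cst|apply: ccont_realC; exact: continuous_dot].
apply/funext => x; rewrite phaseE !dotNr opprK (dotC b) (dotC a) rmorphN /= -mulrA.
by rewrite rmorphN mulN1r.
Qed.

Lemma phaseN_shift (x : 'rV[R]_n) t j (z : 'rV[R[i]]_n) :
  phase (- (x + t *: delta_mx 0 j)) z = phase (- x) z * cexp (t%:C * (- 'i%C * z 0 j)).
Proof.
rewrite /phase -cexpD; congr cexp.
have -> : t%:C * (- 'i%C * z 0 j) = \sum_i (if i == j then t%:C * (- 'i%C * z 0 i) else 0).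
  by rewrite -big_mkcond big_pred1_eq.
rewrite -big_split; apply: eq_bigr => i _ /=; rewrite !mxE eqxx /=.
case: (i == j); first by rewrite mulr1 opprD rmorphD rmorphN /=; ring.
by rewrite mulr0 !addr0.
Qed.

(** Derivatives are available for real-valued functions; the multiplier [s] covers the real part
    with 1 and the imaginary part with [- i]. *)
Lemma is_derive_phaseN (s : R[i]) (x : 'rV[R]_n) j (z : 'rV[R[i]]_n) :
  is_derive x (delta_mx 0 j) (fun x => Re (s * phase (- x) z))
    (Re (s * (- 'i%C * z 0 j) * phase (- x) z)).
Proof.
set w : R[i] := - 'i%C * z 0 j.
apply: (is_derive_quadratic (K :=
  normc (s * phase (- x) z) * (4 * normc w ^+ 2 * expR (normc w)))) => t t1.
rewrite phaseN_shift -/w -cReN -cReD.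
have -> : t * Re (s * w * phase (- x) z) = Re (t%:C * (s * w * phase (- x) z)).
  by rewrite [RHS]cReM /= mul0r subr0.
rewrite -cReN -cReD (le_trans (normRe_le _))//.
have -> : s * (phase (- x) z * cexp (t%:C * w)) - s * phase (- x) z -
    t%:C * (s * w * phase (- x) z) = s * phase (- x) z * (cexp (t%:C * w) - 1 - t%:C * w).
  ring.
rewrite -[leRHS]mulrA ComplexField.Normc.normcM; apply: ler_wpM2l; first exact: normc_ge0.
rewrite (le_trans (normc_cexpB1B_le _))// ComplexField.Normc.normcM normcR.
have w0 := normc_ge0 w.
have -> : 4 * normc w ^+ 2 * expR (normc w) * t ^+ 2 =
    4 * (`|t| * normc w) ^+ 2 * expR (normc w).
  by rewrite exprMn real_normK ?num_real//; ring.
apply: ler_wpM2l; first by rewrite mulr_ge0// sqr_ge0.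
by rewrite ler_expR ler_piMl.
Qed.

(** The integrand is the partial derivative of [u x * Re (s * phase (- x) z)], which vanishes off
    [A]. *)
Lemma rint_by_parts (s : R[i]) (z : 'rV[R[i]]_n) j (u du : 'rV[R]_n -> R) :
  continuous u -> continuous du -> (forall x, is_derive x (delta_mx 0 j) u (du x)) ->
  (forall x, ~ A x -> u x = 0) -> (forall x, ~ A x -> du x = 0) ->
  rint (fun x => Re (s * ((du x)%:C * phase (- x) z +
    (- 'i%C * z 0 j) * ((u x)%:C * phase (- x) z)))) = 0.
Proof.
move=> cu cdu udu u0 du0; set w : R[i] := - 'i%C * z 0 j.
have cRe (c : R[i]) : continuous (fun x : 'rV[R]_n => Re (c * phase (- x) z)).
  by have [] := ccontM (ccont_cst n c) (ccont_phaseN z).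
rewrite (_ : (fun x => _) = fun x => u x * Re (s * w * phase (- x) z) +
    Re (s * phase (- x) z) * du x).
  apply: (@rint_partial _ _ j (fun x => u x * Re (s * phase (- x) z))).
  - apply: dom_of_compact_support => [|x /u0 ->]; last by rewrite mul0r.
    exact: rV_continuousM.
  - apply: dom_of_compact_support => [|x nx]; last by rewrite u0// du0// mul0r mulr0 addr0.
    by apply: rV_continuousD; exact: rV_continuousM.
  - move=> x; have d := is_derive_phaseN s x j z.
    exact: (is_deriveM (udu x) d).
apply/funext => x.
rewrite (_ : s * _ = (u x)%:C * (s * w * phase (- x) z) + (du x)%:C * (s * phase (- x) z)).
  rewrite cReD (cReM (u x)%:C) (cReM (du x)%:C) /= !mul0r !subr0.
  by rewrite [du x * _]mulrC.
by move: (phase _ _) => P; ring.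
Qed.

Lemma cintegrable_of_compact_support (h : 'rV[R]_n -> R[i]) : ccont h ->
  (forall x, ~ A x -> h x = 0) -> cintegrable h.
Proof.
by move=> [h1 h2] h0; split; apply/dom_rintegrable/dom_of_compact_support => // x /h0 ->.
Qed.

Lemma cintegrable_phase (g : 'rV[R]_n -> R[i]) z : ccont g ->
  (forall x, ~ A x -> g x = 0) -> cintegrable (fun x => g x * phase (- x) z).
Proof.
move=> cg g0; apply: cintegrable_of_compact_support => [|x /g0 ->]; last by rewrite mul0r.
by apply: ccontM => //; exact: ccont_phaseN.
Qed.

Lemma cintegrable_phase_real (u : 'rV[R]_n -> R) z : continuous u ->
  (forall x, ~ A x -> u x = 0) -> cintegrable (fun x => (u x)%:C * phase (- x) z).
Proof.
move=> cu u0; apply: (cintegrable_phase (g := fun x => (u x)%:C)) => [|x /u0 ->//].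
exact: ccont_realC.
Qed.

Lemma integralC_by_parts (z : 'rV[R[i]]_n) j (u du : 'rV[R]_n -> R) :
  continuous u -> continuous du -> (forall x, is_derive x (delta_mx 0 j) u (du x)) ->
  (forall x, ~ A x -> u x = 0) -> (forall x, ~ A x -> du x = 0) ->
  integralC (fun x => (du x)%:C * phase (- x) z) =
  ('i%C * z 0 j) * integralC (fun x => (u x)%:C * phase (- x) z).
Proof.
move=> cu cdu udu u0 du0.
have h s := rint_by_parts s z cu cdu udu u0 du0.
have i1 := cintegrable_phase_real z cdu du0; have i2 := cintegrable_phase_real z cu u0.
apply/eqP; rewrite -subr_eq0 -mulNr -mulNr -integralCZ// -integralCD//; last exact: cintegrableZ.
apply/eqP; rewrite integralCE; apply: complex_ext => /=.
  by rewrite -[RHS](h 1); apply: eq_rint => x; rewrite mul1r.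
rewrite -[RHS](h (- 'i%C)); apply: eq_rint => x.
by rewrite [RHS]cReM /= oppr0 mul0r mulN1r opprK add0r.
Qed.

(** The Fourier-Laplace transform: up to the normalising factor, [fourier g] continued to complex
    frequencies. *)
Definition laplace (g : 'rV[R]_n -> R[i]) (z : 'rV[R[i]]_n) : R[i] :=
  integralC (fun x => g x * phase (- x) z).

Lemma laplace_pow (u : 'rV[R]_n -> R) (z : 'rV[R[i]]_n) j N : smooth u ->
  (forall x, ~ A x -> u x = 0) ->
  laplace (fun x => (partials (nseq N j) u x)%:C) z =
  ('i%C * z 0 j) ^+ N * laplace (fun x => (u x)%:C) z.
Proof.
move=> su u0; elim: N => [|N IHN]; first by rewrite expr0 mul1r.
rewrite exprS -mulrA -IHN; have [c1 d1] := su (nseq N j); have [c2 _] := su (nseq N.+1 j).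
apply: (integralC_by_parts z c1 c2) => //.
- exact: partials_eq0.
- exact: partials_eq0.
Qed.

Lemma laplace_le (u : 'rV[R]_n -> R) : continuous u -> (forall x, ~ A x -> u x = 0) ->
  exists2 C, 0 <= C & forall z, normc (laplace (fun x => (u x)%:C) z) <=
    C * expR (supporting A (map_mx (@complex.Im R) z)).
Proof.
move=> cu u0.
have cn : continuous (fun x => `|u x|).
  by move=> x; apply: (continuous_comp (cu x)); exact: norm_continuous.
have iu : rintegrable (fun x => `|u x|).
  by apply/dom_rintegrable/dom_of_compact_support => // x /u0 ->; rewrite normr0.
exists (2 * rint (fun x => `|u x|)) => [|z].
  by rewrite mulr_ge0//; apply: Rintegral_ge0.
set E := expR _.
rewrite (_ : _ * E = 2 * rint (fun x => E * `|u x|)); last by rewrite rintZ//; ring.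
apply: normc_integralC_le; [exact: cintegrable_phase_real|exact: rintegrableZ|].
move=> x; rewrite ComplexField.Normc.normcM normcR normc_phaseN mulrC.
have [Ax|/u0 ->] := pselect (A x); last by rewrite normr0 !mulr0.
by rewrite ler_wpM2r// ler_expR dot_le_supporting.
Qed.

(** With [m] the maximum of 1 and the [a i], the left base is at most [n.+1 * m], while [m ^ N] is
    one of the terms on the right. Separate bounds on the powers of the coordinates thus control a
    power of [1 + |z|]. *)
Lemma expr_1Dsum_le (a : 'I_n -> R) N : (forall i, 0 <= a i) ->
  (1 + \sum_i a i) ^+ N <= n.+1%:R ^+ N * (1 + \sum_i a i ^+ N).
Proof.
move=> a0; pose m := \big[Num.max/1]_i a i.
have m1 : 1 <= m by exact: bigmax_ge_id.
have ma i : a i <= m by exact: le_bigmax.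
have mN : m ^+ N <= 1 + \sum_i a i ^+ N.
  rewrite /m; elim/big_ind: _ => [|x y xN yN|i _].
  - by rewrite expr1n lerDl sumr_ge0// => i _; rewrite exprn_ge0.
  - by rewrite /Order.max; case: ifP.
  - rewrite (bigD1 i)//= addrCA lerDl addr_ge0// sumr_ge0// => j _.
    by rewrite exprn_ge0.
apply: (@le_trans _ _ ((n.+1%:R * m) ^+ N)).
  rewrite lerXn2r ?nnegrE//; first by rewrite addr_ge0// sumr_ge0.
    by rewrite mulr_ge0// (le_trans _ m1).
  rewrite mulrS mulrDl mul1r lerD// (le_trans (ler_sum _ (fun i _ => ma i)))//.
  by rewrite sumr_const card_ord mulr_natl.
by rewrite exprMn ler_wpM2l// exprn_ge0.
Qed.

Lemma normCd_le_sum (z : 'rV[R[i]]_n) : normCd z <= \sum_i normc (z 0 i).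
Proof.
have S0 : 0 <= \sum_i normc (z 0 i) by apply: sumr_ge0 => i _; exact: normc_ge0.
rewrite -(@ler_pXn2r _ 2) ?nnegrE ?sqrtr_ge0//.
rewrite sqr_sqrtr; last by apply: sumr_ge0 => i _; rewrite sqr_ge0.
rewrite expr2 mulr_suml; apply: ler_sum => i _; rewrite expr2.
apply: ler_wpM2l; first exact: normc_ge0.
by rewrite (bigD1 i)//= lerDl; apply: sumr_ge0 => j _; exact: normc_ge0.
Qed.

Lemma laplace_growth (u : 'rV[R]_n -> R) N : smooth u -> (forall x, ~ A x -> u x = 0) ->
  exists2 C, 0 <= C & forall z, normc (laplace (fun x => (u x)%:C) z) <=
    C * (1 + normCd z) ^- N * expR (supporting A (map_mx (@complex.Im R) z)).
Proof.
move=> su u0.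
have [C0 C00 hC0] := laplace_le (su [::]).1 u0.
have /choice[C hC] (j : 'I_n) : exists C : R, 0 <= C /\ forall z : 'rV[R[i]]_n,
    normc (z 0 j) ^+ N * normc (laplace (fun x => (u x)%:C) z) <=
    C * expR (supporting A (map_mx (@complex.Im R) z)).
  have [C C1 hC] := laplace_le (su (nseq N j)).1 (partials_eq0 (nseq N j) u0).
  exists C; split => // z; rewrite (le_trans _ (hC z))// laplace_pow//.
  rewrite [leRHS]ComplexField.Normc.normcM; apply: ler_wpM2r; first exact: normc_ge0.
  elim: N {C hC C1} => [|N IHN]; first by rewrite !expr0 normcR normr1.
  rewrite !exprS ComplexField.Normc.normcM; apply: ler_pM => //.
  - exact: normc_ge0.
  - by rewrite exprn_ge0// normc_ge0.
  rewrite ComplexField.Normc.normcM.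
  by rewrite (_ : normc 'i%C = 1) ?mul1r//= expr0n add0r expr1n sqrtr1.
(* [C0] bounds the transform itself, and [C j] its product with the [N]-th power of [|z_j|]. *)
exists (n.+1%:R ^+ N * (C0 + \sum_j C j)) => [|z].
  rewrite mulr_ge0 ?exprn_ge0// addr_ge0// sumr_ge0// => j _.
  by have [] := hC j.
have N1 : 0 < (1 + normCd z) ^+ N by rewrite exprn_gt0// ltr_pwDl// sqrtr_ge0.
rewrite mulrAC ler_pdivlMr// mulrC.
apply: (@le_trans _ _ (n.+1%:R ^+ N * (1 + \sum_i normc (z 0 i) ^+ N) *
    normc (laplace (fun x => (u x)%:C) z))).
  apply: ler_wpM2r; first exact: normc_ge0.
  apply: le_trans (expr_1Dsum_le _ (fun i => normc_ge0 (z 0 i))).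
  rewrite lerXn2r ?nnegrE ?addr_ge0 ?sqrtr_ge0//.
    by apply: sumr_ge0 => i _; exact: normc_ge0.
  by rewrite lerD2l normCd_le_sum.
rewrite -!mulrA; apply: ler_wpM2l; first exact: exprn_ge0.
rewrite !mulrDl mul1r; apply: lerD; first exact: hC0.
rewrite !mulr_suml; apply: ler_sum => i _.
by have [_] := hC i; apply.
Qed.

(** Coordinates are at most [L] on [A], so for [norm1 h <= 1] the remainder of the exponential is at
    most [4 * (L * norm1 h)^2 * exp L], uniformly in [x]. The partial derivatives are the integrals
    of the [D i]. *)
Lemma hol_laplace (g : 'rV[R]_n -> R[i]) z : ccont g -> (forall x, ~ A x -> g x = 0) ->
  hol (laplace g) z.
Proof.
move=> cg g0; have [L L0 hL] := compact_coord_bounded cA.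
have ig z' : cintegrable (fun x => g x * phase (- x) z') by exact: cintegrable_phase.
pose D i (x : 'rV[R]_n) := - 'i%C * (x 0 i)%:C * (g x * phase (- x) z).
have iD i : cintegrable (D i).
  apply: cintegrable_of_compact_support => [|x /g0]; last by rewrite /D => ->; rewrite mul0r mulr0.
  apply: ccontM; last by apply: ccontM => //; exact: ccont_phaseN.
  apply: ccontM; first exact: ccont_cst.
  by apply: ccont_realC; exact: coord_continuous.
(* Integrability is known for the real and imaginary parts, so the sum of their absolute values
   serves as majorant of the modulus. *)
have [k k0 hk] : exists2 k : 'rV[R]_n -> R, rintegrable k &
    forall x, normc (g x * phase (- x) z) <= k x.
  have [i1 i2] := ig z.
  exists (fun x => `|Re (g x * phase (- x) z)| + `|Im (g x * phase (- x) z)|).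
    by apply: rintegrableD; [exact: (integrable_norm i1)|exact: (integrable_norm i2)].
  by move=> x; exact: normc_le_ReIm.
have K0 : 0 <= rint k.
  by apply: Rintegral_ge0 => t _; exact: le_trans (normc_ge0 _) (hk _).
pose K := 2 * (rint k * (4 * L ^+ 2 * expR L)).
have KK : 0 <= K by rewrite /K !mulr_ge0 ?expR_ge0.
exists (fun i => integralC (D i)) => e e0.
exists (Num.min 1 (e / (K + 1))) => [|h]; first by rewrite lt_min ltr01 divr_gt0// ltr_pwDr.
rewrite lt_min => /andP[h1 h2]; have N0 := norm1_ge0 h.
pose l (x : 'rV[R]_n) := \sum_i - 'i%C * (x 0 i)%:C * h 0 i.
have isum (r : seq 'I_n) : cintegrable (fun x => \sum_(i <- r) h 0 i * D i x) /\
    integralC (fun x => \sum_(i <- r) h 0 i * D i x) = \sum_(i <- r) integralC (D i) * h 0 i.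
  elim: r => [|i r [IH1 IH2]].
    rewrite big_nil (_ : (fun x => _) = fun=> 0); last by apply/funext => x; rewrite big_nil.
    split; first by split; exact: (integrable0 (lebesgue_tuple R n) setT).
    by rewrite integralCE /rint /Rintegral integral0.
  have -> : (fun x => \sum_(j <- i :: r) h 0 j * D j x) =
      (fun x => h 0 i * D i x + \sum_(j <- r) h 0 j * D j x).
    by apply/funext => x; rewrite big_cons.
  have ii := cintegrableZ (h 0 i) (iD i).
  split; first exact: cintegrableD.
  by rewrite integralCD// IH2 integralCZ// big_cons mulrC.
have [is1 <-] := isum (index_enum _).
have phD x : phase (- x) (z + h) = phase (- x) z * cexp (l x).
  rewrite /phase -cexpD; congr cexp; rewrite -big_split; apply: eq_bigr => i _ /=.
  by rewrite !mxE rmorphN /=; ring.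
rewrite /laplace -!integralCB//; last exact: cintegrableB.
have Kn : rintegrable (fun x => (4 * L ^+ 2 * expR L) * norm1 h ^+ 2 * k x).
  exact: rintegrableZ.
apply: (@le_trans _ _ (2 * rint (fun x => (4 * L ^+ 2 * expR L) * norm1 h ^+ 2 * k x))).
  apply: normc_integralC_le => //.
    by apply: cintegrableB => //; exact: cintegrableB.
  move=> x.
  have -> : g x * phase (- x) (z + h) - g x * phase (- x) z - \sum_i h 0 i * D i x =
      g x * phase (- x) z * (cexp (l x) - 1 - l x).
    have -> : \sum_i h 0 i * D i x = g x * phase (- x) z * l x.
      by rewrite /l mulr_sumr; apply: eq_bigr => i _; rewrite /D; ring.
    by rewrite phD; ring.
  rewrite ComplexField.Normc.normcM mulrC.
  have [Ax|/g0 ->] := pselect (A x); last first.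
    rewrite mul0r ComplexField.Normc.normc0 mulr0 mulr_ge0//.
      by rewrite mulr_ge0 ?sqr_ge0// mulr_ge0 ?expR_ge0// mulr_ge0 ?sqr_ge0.
    exact: le_trans (normc_ge0 _) (hk _).
  apply: ler_pM; rewrite ?normc_ge0//.
  have lx : normc (l x) <= L * norm1 h.
    rewrite /l (le_trans (normc_sum_le _))// /norm1 mulr_sumr; apply: ler_sum => i _.
    rewrite 2!ComplexField.Normc.normcM normcR; apply: ler_wpM2r; first exact: normc_ge0.
    rewrite normcN (_ : normc 'i%C = 1) ?mul1r ?hL//.
    by rewrite /= expr0n add0r expr1n sqrtr1.
  rewrite (le_trans (normc_cexpB1B_le _))//.
  rewrite [leRHS](_ : _ = 4 * (L * norm1 h) ^+ 2 * expR L); last by ring.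
  apply: ler_pM => //.
  - by rewrite mulr_ge0// sqr_ge0.
  - by rewrite ler_pM2l// lerXn2r ?nnegrE ?normc_ge0// mulr_ge0.
  - by rewrite ler_expR (le_trans lx)// ler_piMr// ltW.
rewrite rintZ// (_ : 2 * _ = K * norm1 h * norm1 h); last by rewrite /K; ring.
rewrite ler_wpM2r//; rewrite ltr_pdivlMr ?ltr_pwDr// in h2.
by rewrite (le_trans _ (ltW h2))// mulrC ler_wpM2l// lerDl.
Qed.

End compact_support.

(** * The two implications, with the normalising factor in place *)

Theorem theorem3p4 (R : realType) (d : nat) (A : set 'rV[R]_d)
    (A_nonempty : A !=set0) (A_compact : compact A)
    (A_convex : convex_set (A : set (convex_lmodType 'rV[R]_d)))
    (A_symmetric : A = [set - a | a in A])
    (f : 'rV[R]_d -> R[i]) :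
  (exists g : 'rV[R]_d -> R[i],
      [/\ smoothC g, supp g `<=` A & forall lambda, f lambda = fourier g lambda])
  <->
  (exists F : 'rV[R[i]]_d -> R[i],
      rapidly_decreasing_entire A F /\
      forall x, F (map_mx (fun t : R => t%:C) x) = f x).
Proof.
have a0 : 0 < 2 * pi :> R by rewrite mulr_gt0// pi_gt0.
pose c : R := (2 * pi) `^ (- (d%:R / 2)).
have c0 : 0 < c by exact: powR_gt0.
split=> [[g [[su sv] gA fg]]|[F [hF Ff]]].
  have g0 x : ~ A x -> g x = 0.
    by move=> nAx; apply: contra_notP nAx => /eqP gx; apply: gA; exact: subset_closure.
  have u0 x : ~ A x -> Re (g x) = 0 by move=> /g0 ->.
  have v0 x : ~ A x -> Im (g x) = 0 by move=> /g0 ->.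
  have cg : ccont g by split; [have [] := su [::]|have [] := sv [::]].
  pose F := laplace (fun x => c%:C * g x).
  have FE z : F z = c%:C * laplace g z.
    rewrite /F /laplace -integralCZ; last exact: (cintegrable_phase A_nonempty A_compact).
    by apply: eq_integralC => x; rewrite mulrA.
  (* The growth estimate concerns real-valued functions, hence the splitting of [g]. *)
  have lapE z : laplace g z = laplace (fun x => (Re (g x))%:C) z +
      'i%C * laplace (fun x => (Im (g x))%:C) z.
    have [cu cv] := cg.
    have iu := cintegrable_phase_real A_nonempty A_compact z cu u0.
    have iv := cintegrable_phase_real A_nonempty A_compact z cv v0.
    rewrite /laplace -integralCZ// -integralCD//; last exact: cintegrableZ.
    apply: eq_integralC => x; rewrite mulrA -mulrDl; congr (_ * _).
    by rewrite mulic_real; apply: complex_ext => /=; rewrite ?addr0 ?add0r.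
  exists F; split; first split.
  - apply: hol_entire => z; apply: (hol_laplace A_nonempty A_compact).
      by apply: ccontM => //; exact: ccont_cst.
    by move=> x /g0 ->; rewrite mulr0.
  - move=> N; have [C C0 hC] := laplace_growth A_nonempty A_compact N su u0.
    have [D D0 hD] := laplace_growth A_nonempty A_compact N sv v0.
    (* The [+ 1] makes the constant strictly positive, since [C] and [D] may both be 0. *)
    exists (c * (C + D) + 1) => [|z].
      by rewrite ltr_wpDl// mulr_ge0 ?addr_ge0// ltW.
    set W := (1 + normCd z) ^- N; set E := expR _.
    have WE : 0 <= W * E.
      by rewrite mulr_ge0 ?expR_ge0// invr_ge0 exprn_ge0// addr_ge0// sqrtr_ge0.
    rewrite FE lapE -mulrA mulrDl mul1r; apply: ler_wpDr => //.
    rewrite ComplexField.Normc.normcM normcR (gtr0_norm c0) -mulrA.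
    apply: ler_wpM2l; first exact: ltW.
    rewrite mulrDl (le_trans (le_normcD _ _))// !mulrA; apply: lerD; first exact: hC.
    rewrite ComplexField.Normc.normcM (_ : normc 'i%C = 1) ?mul1r; first exact: hD.
    by rewrite /= expr0n add0r expr1n sqrtr1.
  - move=> x; rewrite fg /fourier -/c FE; congr (_ * _).
    apply: eq_integralC => y; congr (_ * cexp _).
    rewrite /dot rmorph_sum mulr_sumr; apply: eq_bigr => i _.
    by rewrite !mxE rmorphN rmorphM /=; ring.
have [L L0 hL] := compact_coord_bounded A_compact.
have rF := rapid_restriction hF.
(* The factor [c] makes [ift p] the normalised inverse transform of the restriction of [F]. *)
pose p v := c%:C * F (cvec v 0); have rp : rapid p by exact: rapidZ.
have ift0 x : ~ A x -> ift p x = 0.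
  move=> nAx; have iF := cdom_cintegrable (ift_cdom x (rapid_cdom rF)).
  rewrite /ift /p; under eq_integralC do rewrite -mulrA.
  by rewrite integralCZ// -/(ift _ x) (ift_restriction_eq0 A_nonempty A_compact hF)// mulr0.
exists (ift p); split; first exact: smoothC_ift.
- have clA : closed A by apply: compact_closed A_compact; exact: norm_hausdorff.
  rewrite /supp [X in _ `<=` X](closure_id A).1//; apply: closure_subset => x /=.
  by move=> /eqP; apply: contra_notP; exact: ift0.
move=> l; rewrite /fourier -/c (ift_inversion rp l L0); last first.
  by move=> x xL; apply: ift0 => Ax; apply: xL; exact: hL.
rewrite -Ff /p !mulrA -!rmorphM /=.
(* One [c] belongs to [fourier], the other to [p], and [(2 pi)^d] comes from the unnormalised
   inversion formula. *)
have -> : c * (2 * pi) ^+ d * c = 1.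
  rewrite mulrAC -powRD; last by rewrite (lt0r_neq0 a0) implybT.
  rewrite -opprD -splitr powRN powR_mulrn; last exact: ltW.
  by rewrite mulVf// lt0r_neq0// exprn_gt0.
rewrite mul1r; congr F; apply/rowP => i; rewrite !mxE.
by [].
Qed.
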